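(* Let $\mathbf{A}\neq\mathbf{0}$ be a real $m\times n$ matrix with thin SVD $\mathbf{A}=\mathbf{U}\mathbf{\Sigma}\mathbf{V}^T$, and let $\mathbf{X}$ be computed by the sampling algorithm (described in the context) with $c$ samples and the leverage score probabilities $p_j^{lev}=\|\mathbf{V}^Te_j\|_2^2/\mathrm{rank}(\mathbf{A})$, $1\leq j\leq n$. Given $0<\delta<1$ and $0<\epsilon\leq 1$, if $$c\geq c_0(\epsilon)\,\mathrm{rank}(\mathbf{A})\,\frac{\ln(\mathrm{rank}(\mathbf{A})/\delta)}{\epsilon^2},\qquad\text{where}\quad c_0(\epsilon)=2+\frac{2\epsilon}{3},$$ then with probability at least $1-\delta$, $$\frac{\|\mathbf{X}-\mathbf{A}\mathbf{A}^T\|_2}{\|\mathbf{A}\mathbf{A}^T\|_2}\leq\epsilon.$$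
   Context: $\|\cdot\|_2$ is the two-norm (spectral norm for matrices); $A_1,\ldots,A_n$ are the columns of $\mathbf{A}$ and $e_1,\ldots,e_n$ those of $\mathbf{I}_n$. In the thin SVD of a matrix of rank $k$, $\mathbf{U}$ ($m\times k$) and $\mathbf{V}$ ($n\times k$) have orthonormal columns and $\mathbf{\Sigma}$ is the $k\times k$ diagonal matrix of the non-zero singular values. Sampling algorithm: given a real $m\times n$ matrix $\mathbf{A}$, a number of samples $1\leq c\leq n$ and probabilities $p_j\geq 0$ with $\sum_{j=1}^n p_j=1$, sample indices $t_1,\ldots,t_c$ from $\{1,\ldots,n\}$ independently and with replacement, with $\mathbb{P}[t_j=i]=p_i$; let $\mathbf{S}$ be the $n\times c$ matrix with columns $e_{t_j}/\sqrt{c\,p_{t_j}}$; output $$\mathbf{X}=(\mathbf{A}\mathbf{S})(\mathbf{A}\mathbf{S})^T=\sum_{j=1}^c\frac{1}{c\,p_{t_j}}A_{t_j}A_{t_j}^T.$$ An index $i$ with $p_i=0$ is never selected. *)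

(* Defs.v *)
From HB Require Import structures.
From mathcomp Require Import all_boot all_order all_algebra.
From mathcomp Require Import all_classical all_reals all_analysis.

Set Implicit Arguments.
Unset Strict Implicit.
Unset Printing Implicit Defensive.

Import Order.TTheory GRing.Theory Num.Theory.
Import numFieldNormedType.Exports.

Local Open Scope classical_set_scope.
Local Open Scope ring_scope.

Section two_norm.
Context {R : realType}.

(* The library's norm on matrices is the max-norm, hence these definitions. *)
Definition norm2 (n : nat) (x : 'cV[R]_n) : R :=
  Num.sqrt (\sum_i x i 0 ^+ 2).

(* The supremum is over the unit ball rather than the unit sphere so that the
   set is nonempty (and bounded) for every n, including n = 0. *)
Definition spectral_norm (m n : nat) (M : 'M[R]_(m, n)) : R :=
  sup [set norm2 (M *m x) | x in [set x : 'cV[R]_n | norm2 x <= 1]].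

End two_norm.

Section gram_sampling.
Context {R : realType}.

Definition thin_svd (m n k : nat) (A : 'M[R]_(m, n))
    (U : 'M[R]_(m, k)) (Sigma : 'M[R]_k) (V : 'M[R]_(n, k)) : Prop :=
  [/\ k = \rank A,
      U^T *m U = 1%:M,
      V^T *m V = 1%:M,
      is_diag_mx Sigma /\ (forall i, 0 < Sigma i i) &
      A = U *m Sigma *m V^T].

(* delta_mx j 0 is the column vector e_j. *)
Definition leverage_prob (m n k : nat) (A : 'M[R]_(m, n)) (V : 'M[R]_(n, k))
    (j : 'I_n) : R :=
  norm2 (V^T *m (delta_mx j 0 : 'cV[R]_n)) ^+ 2 / (\rank A)%:R.

(* Column j is e_(t j) / sqrt (c p_(t j)).  If p (t j) = 0 this column is 0 by
   the convention 0^-1 = 0; such indices have probability 0 of being drawn. *)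
Definition sampling_mx (n c : nat) (p : 'I_n -> R) (t : 'I_c -> 'I_n) :
    'M[R]_(n, c) :=
  \matrix_(i, j) ((delta_mx (t j) 0 : 'cV[R]_n) i 0
                    / Num.sqrt (c%:R * p (t j))).

Definition sampled_gram (m n c : nat) (A : 'M[R]_(m, n)) (p : 'I_n -> R)
    (t : 'I_c -> 'I_n) : 'M[R]_m :=
  (A *m sampling_mx p t) *m (A *m sampling_mx p t)^T.

Definition c0 (eps : R) : R := 2 + 2 * eps / 3.

End gram_sampling.

Section iid_sampling.
Context {d : measure_display} {T : measurableType d} {R : realType}
  (P : probability T R).

(* Random variables with values in a finite type, which carries the discrete
   sigma-algebra; {RV P >-> S} is not available because the library's
   measurable types are pointed and 'I_n need not be. *)
Definition discrete_rv (S : finType) (X : T -> S) : Prop :=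
  forall B : set S, measurable (X @^-1` B).

Definition mutually_independent (I S : finType) (X : I -> T -> S) : Prop :=
  forall (J : {set I}) (B : I -> set S),
    P (\bigcap_(i in [set` J]) (X i @^-1` B i)) =
    (\prod_(i in J) P (X i @^-1` B i))%E.

Definition iid_indices (n c : nat) (p : 'I_n -> R) (t : 'I_c -> T -> 'I_n) :
    Prop :=
  [/\ forall j, discrete_rv (t j),
      mutually_independent t &
      forall (j : 'I_c) (i : 'I_n), P [set w | t j w = i] = (p i)%:E].

End iid_sampling.

(* Main.v *)
Require Import Defs.
From HB Require Import structures.
From mathcomp Require Import all_boot all_order all_algebra.
From mathcomp Require Import cyclic separable cyclotomic.
From mathcomp Require Import ring lra zify.
From mathcomp Require Import all_classical all_reals all_analysis.
From mathcomp Require Import complex.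

Set Implicit Arguments.
Unset Strict Implicit.
Unset Printing Implicit Defensive.

Import Order.TTheory GRing.Theory Num.Theory.
Import numFieldNormedType.Exports.

Local Open Scope ring_scope.

(** Let k be the rank of A, let v_i be the i-th row of V and u_i = v_i / |v_i|.
A draw t picks the unit vector u_t, and E (u_t^T u_t) = I/k ([average_dir]).
If Z is the sum of the c drawn matrices u_t^T u_t, then
X - A A^T = U Sigma ((k/c) Z - 1) Sigma U^T ([sampling_zsum]), and
|A A^T| is the square of the largest singular value. Hence the relative error
is at most eps as soon as all eigenvalues of Z lie between (1 - eps) c/k and
(1 + eps) c/k ([deviation_small]).

Matrix Chernoff and Bernstein inequalities bound each of the two ways of
failing by k exp(- c eps^2 / ((2 + 2 eps/3) (k - 1))), up to lower order terms.
Their sum has a factor 2 which the sample size does not pay for: it contains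
ln (k / delta), not ln (2 k / delta). The proof recovers this factor by
replacing the exponential test function with the cubed positive part.

_Matrices versus counts._ Put f(y) = max(0, y - s)^3 and Phi(W) = tr f(W).
For a unit vector u with squared coordinates w_l in an eigenbasis of W, with
eigenvalues l_l,
  Phi(W + a u^T u) - Phi(W) <= sum_l w_l (f(l_l + a) - f(l_l))
([trcube_rank_one]). It follows by splitting a into small steps: Klein's
inequality ([klein]) bounds each step by a derivative taken in the current
eigenbasis, and [rank_one_square] moves that derivative to the eigenbasis of W;
this is where the square of the positive part, the derivative of the test
function, is special. Since the w_l average to 1/k, a draw is on average no
worse than a Bernoulli(1/k) trial whose success shifts all eigenvalues by a, and
induction on the draws gives E Phi(Z) <= k E f(N) with N of law Bin(c, 1/k)
([sampled_trcube]). The lower tail is the same statement with a = -1.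

_The scalar tail._ It remains to bound E max(0, N - s)^3 / (m - s)^3 for a good
choice of s below the level m. The Chernoff tilting gives exp (- c D), with D
the relative entropy ([bin_cube_plain]). A sharper bound, with an extra factor
of order a^(-1/2), where 2 a is the squared number of standard deviations
between the mean and m, comes from writing the tilted sum as an average over
roots of unity: the generating function of the binomial law and that of the
cubes are both explicit, their moduli depend only on x = cos^2 of half the
argument, and the moments of x on the circle are the normalised central
binomial coefficients ([cubes_fourier], [bin_cube_sharp]).

_Numbers._ Write A = c eps^2 / (2 (k - 1) (1 + eps/3)). The hypothesis on c says
A (1 - 1/k) >= ln (k / delta), and the upper tail is at most exp (- A), so that a
factor exp (A / k) is available for the sum of the two tails. The sharp factor
is at most half of it ([psi_base]), which covers the sum for small eps; for
larger eps the lower tail decays visibly faster than the upper one, because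
its relative entropy is larger by the factor 1 + [lam], and a plain bound is
enough for one tail or for both ([regimeP], [two_tails]). For k = 2 the plain
bounds have room to spare and for k = 1 the error vanishes. *)

(** * Elementary inequalities from calculus *)

Section Calculus.
Variable R : realType.
Implicit Types (x y s : R).

(** The mean value theorem, in the form in which all one-variable inequalities
    below are obtained from the sign of a derivative. *)
Lemma le_of_derive_ge0 (f df : R -> R) (a b : R) : a <= b ->
  (forall x, a <= x <= b -> is_derive x 1 f (df x)) ->
  (forall x, a < x < b -> 0 <= df x) -> f a <= f b.
Proof.
move=> ab Df df0; have [->//|a_ne_b] := eqVneq a b.
have altb : a < b by rewrite lt_neqAle a_ne_b.
have := @MVT R f df a b altb.
case=> [x||c].
- by rewrite in_itv /= => /andP[ax xb]; apply: Df; rewrite !ltW.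
- apply: derivable_within_continuous => x; rewrite in_itv /= => abx.
  by have [] := Df x abx.
rewrite in_itv /= => abc E; rewrite -subr_ge0 E mulr_ge0 ?df0 // subr_ge0 //.
Qed.

Lemma is_derive1_inv_shift (a x : R) : x + a != 0 ->
  is_derive x 1 (fun u : R => (u + a)^-1) (- (x + a) ^- 2).
Proof.
move=> xa; pose g : R -> R := fun u => u + a.
have [dd dE] : is_derive x 1 g 1 by exact: (is_derive_shift x 1 a).
apply: DeriveDef; first exact: (derivableV (f := g)).
by apply: etrans (deriveV (f := g) xa dd) _; rewrite dE /GRing.scale /= mulr1.
Qed.

(** The right-hand side agrees with the logarithm to third order at 1: the
    derivative of the difference is (y - 1)^3 / (y^2 (y + 2)^2). *)
Lemma ln_ge_pade y : 0 < y -> (y - 1) * (5 * y + 1) / (2 * y * (y + 2)) <= ln y.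
Proof.
move=> y0.
pose f (t : R) : R := ln t + (4^-1 * (t + 0)^-1 + 27 / 4 * (t + 2)^-1).
pose df (t : R) : R := (t - 1) ^+ 3 / (t ^+ 2 * (t + 2) ^+ 2).
have Df (t : R) : 0 < t -> is_derive t 1 f (df t).
  move=> t0; have tn0 : t != 0 by rewrite gt_eqF.
  have t2n0 : t + 2 != 0 by rewrite gt_eqF //; lra.
  have d1 : is_derive t 1 (@ln R) t^-1 by exact: is_derive1_ln.
  have d2 : t != 0 -> is_derive t 1 (fun u : R => (u + 0)^-1) (- t ^- 2).
    by move=> t'; rewrite -[t in t ^- 2]addr0; apply: is_derive1_inv_shift; rewrite addr0.
  have d3 := is_derive1_inv_shift t2n0.
  have d4 := is_deriveD d1 (is_deriveD (is_deriveZ 4^-1 (d2 tn0)) (is_deriveZ (27 / 4) d3)).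
  apply: (is_derive_eq d4).
  by rewrite /df /GRing.scale /=; field; rewrite tn0 t2n0.
have fE (t : R) : 0 < t ->
    f t - f 1 = ln t - (t - 1) * (5 * t + 1) / (2 * t * (t + 2)).
  move=> t0; have tn0 : t != 0 by rewrite gt_eqF.
  have t2n0 : t + 2 != 0 by rewrite gt_eqF //; lra.
  rewrite /f ln1 !addr0; field; rewrite tn0 t2n0 /=; lra.
rewrite -subr_ge0 -fE // subr_ge0.
have dfE (t : R) : 0 < t -> 0 <= df t * (t - 1).
  move=> t0; rewrite /df mulrAC -exprSr divr_ge0 //.
    by rewrite exprn_even_ge0.
  by rewrite mulr_ge0 // exprn_ge0 //; lra.
have [y1|y1] := leP 1 y.
  apply: (@le_of_derive_ge0 f df) => // x /andP[x1 x2].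
    by apply: Df; lra.
  have := dfE x; rewrite pmulr_lge0 ?subr_gt0 //; apply; lra.
suff : - f y <= - f 1 by rewrite lerN2.
pose g (t : R) : R := - f t; pose dg (t : R) : R := - df t.
apply: (@le_of_derive_ge0 g dg y 1 (ltW y1)) => x.
  move=> /andP[yx _]; have x0 : 0 < x by exact: lt_le_trans yx.
  have d := Df x x0.
  exact: (is_deriveN d).
move=> /andP[yx x1]; rewrite /dg oppr_ge0.
have := dfE x; rewrite nmulr_lge0 ?subr_lt0 //; apply; lra.
Qed.

(** With v = exp (- x/2) this is x <= 2 sinh (x/2). *)
Lemma ln_inv_le (v : R) : 0 < v -> v <= 1 -> - (2 * ln v) <= v^-1 - v.
Proof.
move=> v0 v1; have vn0 : v != 0 by rewrite gt_eqF.
have := ln_ge_pade v0.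
have : (v - v^-1) / 2 <= (v - 1) * (5 * v + 1) / (2 * v * (v + 2)).
  rewrite -subr_ge0.
  have -> : (v - 1) * (5 * v + 1) / (2 * v * (v + 2)) - (v - v^-1) / 2 =
     (1 - v) ^+ 3 / (2 * v * (v + 2)).
    by field; rewrite vn0 gt_eqF //; lra.
  apply: divr_ge0; first by rewrite exprn_ge0 // subr_ge0.
  by rewrite !mulr_ge0 ?(ltW v0) //; lra.
lra.
Qed.

(** The left-hand side is the Laplace transform of the Gamma(2) law; the
    right-hand side is its two-point Gauss-Radau quadrature with a node at 0.
    The remainder has a constant sign. *)
Lemma radau_bound s : 0 <= s -> (1 + s) ^- 2 <= 3^-1 + 2 / 3 * expR (- (3 * s)).
Proof.
move=> s0.
pose f (t : R) : R := (1 + t) ^+ 2 * (1 + 2 * expR (- 3 * t)).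
pose df (t : R) : R := 2 * (1 + t) * (1 - expR (- 3 * t) * (1 + 3 * t)).
have Df (t : R) : is_derive t 1 f (df t).
  have d0 : is_derive t 1 (fun u : R => 1 + u) 1.
    have d := is_deriveD (is_derive_cst (1 : R) t 1) (is_derive_id t (1 : R)).
    by apply: (is_derive_eq d); rewrite add0r.
  have d1 : is_derive t 1 (fun u : R => - 3 * u) (- 3).
    have d := is_deriveZ (- 3 : R) (is_derive_id t (1 : R)).
    by apply: (is_derive_eq d); rewrite /GRing.scale /= mulr1.
  have d2 : is_derive t 1 (fun u : R => expR (- 3 * u)) (- 3 * expR (- 3 * t)).
    have d := is_derive1_comp (is_derive_expR (- 3 * t)) d1.
    apply: (is_derive_eq d); rewrite /GRing.scale /=; ring.
  have d3 : is_derive t 1 (fun u : R => (1 + u) ^+ 2) (2 * (1 + t)).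
    have d := is_deriveX 2 d0.
    by apply: (is_derive_eq d); rewrite /GRing.scale /= mulr1.
  have d4 : is_derive t 1 (fun u : R => 1 + 2 * expR (- 3 * u)) (- 6 * expR (- 3 * t)).
    have d := is_deriveD (is_derive_cst (1 : R) t 1) (is_deriveZ (2 : R) d2).
    by apply: (is_derive_eq d); rewrite /GRing.scale /=; ring.
  have d := is_deriveM d3 d4.
  by apply: (is_derive_eq d); rewrite /df /GRing.scale /=; ring.
have f0 : f 0 = 3 by rewrite /f mulr0 expR0; ring.
have fs : 3 <= f s.
  rewrite -f0; apply: (@le_of_derive_ge0 f df) => // x /andP[x0 _].
  rewrite /df mulr_ge0 //; first by lra.
  have h := expR_ge1Dx (3 * x); rewrite subr_ge0 mulNr expRN mulrC.
  by rewrite ler_pdivrMr ?expR_gt0 // mul1r.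
have s1 : 0 < 1 + s by lra.
rewrite -mulNr -[X in X <= _]mul1r ler_pdivrMr ?exprn_gt0 //.
by move: fs; rewrite /f; lra.
Qed.
End Calculus.

(** * Averages over the roots of unity *)

Section RootsOfUnity.
Variable C : numClosedFieldType.

Lemma prim_root_closed (n : nat) : (0 < n)%N ->
  {z : C | n.-primitive_root z}.
Proof.
move=> n_gt0; pose p : {poly C} := 'X^n - 1.
have [r Dp] := closed_field_poly_normal p.
apply/sigW; rewrite (monicP _) ?monicXnsubC // scale1r in Dp.
have rn1 : all n.-unity_root r by apply/allP=> z; rewrite -root_prod_XsubC -Dp.
have sz_r : (n < (size r).+1)%N.
  by rewrite -(size_prod_XsubC r id) -Dp size_XnsubC.
have [|z] := hasP (has_prim_root n_gt0 rn1 _ sz_r); last by exists z.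
by rewrite -separable_prod_XsubC -Dp separable_Xn_sub_1 // pnatr_eq0 -lt0n.
Qed.

Lemma norm_prim_root (M : nat) (w : C) (l : nat) :
  (0 < M)%N -> M.-primitive_root w -> `|w ^+ l| = 1.
Proof.
move=> M0 /prim_expr_order wM; rewrite normrX.
have : `|w| ^+ M = 1 by rewrite -normrX wM normr1.
by move/eqP; rewrite pexpr_eq1 // => /eqP ->; rewrite expr1n.
Qed.

Lemma sum_prim_root (M i j : nat) (w : C) :
  M.-primitive_root w -> (i < M)%N -> (j < M)%N ->
  \sum_(l < M) (w ^+ l) ^+ i / (w ^+ l) ^+ j = M%:R * (i == j)%:R.
Proof.
move=> pw iM jM; have M0 : (0 < M)%N by case: M iM {jM pw}.
have w0 : w != 0 by rewrite -normr_gt0 -[w]expr1 (norm_prim_root _ M0 pw).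
pose z := w ^+ i / w ^+ j.
have -> : \sum_(l < M) (w ^+ l) ^+ i / (w ^+ l) ^+ j = \sum_(l < M) z ^+ l.
  by apply: eq_bigr => l _; rewrite expr_div_n -!exprM ![(_ * l)%N]mulnC.
have zM : z ^+ M = 1.
  by rewrite expr_div_n -!exprM ![(_ * M)%N]mulnC !exprM (prim_expr_order pw) !expr1n divr1.
have [ij|ij] := eqVneq i j.
  have -> : z = 1 by rewrite /z ij divff // expf_neq0.
  by rewrite mulr1 (eq_bigr (fun=> 1)) ?sumr_const ?card_ord // => l _; rewrite expr1n.
rewrite mulr0; apply/eqP; have := subrX1 z M; rewrite zM subrr => /esym/eqP.
rewrite mulf_eq0 => /orP[|//]; rewrite subr_eq0 => /eqP z1.
case/eqP: ij; have : w ^+ i = w ^+ j.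
  by rewrite -[LHS](divfK (_ : w ^+ j != 0)) ?expf_neq0 // -/z z1 mul1r.
by move/eqP; rewrite (eq_prim_root_expr pw) !modn_small // => /eqP.
Qed.

(** (1 + z)^2 / (4 z) is the squared cosine of half the argument of z, and only
    the constant term of its n-th power survives the average over roots of
    unity of large order. *)
Lemma sum_prim_root_cos (M n : nat) (w : C) :
  M.-primitive_root w -> (n.*2 < M)%N ->
  \sum_(l < M) ((1 + w ^+ l) ^+ 2 / (4 * w ^+ l)) ^+ n
    = M%:R * ('C(n.*2, n)%:R / 4 ^+ n).
Proof.
move=> pw nM.
have E (z : C) : ((1 + z) ^+ 2 / (4 * z)) ^+ n =
    \sum_(i < n.*2.+1) 'C(n.*2, i)%:R / 4 ^+ n * (z ^+ i / z ^+ n).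
  rewrite expr_div_n [(4 * z) ^+ n]exprMn -exprM mul2n exprDn invfM mulr_suml.
  apply: eq_bigr => i _; rewrite expr1n mul1r -mulr_natl; ring.
under eq_bigr do rewrite E.
rewrite exchange_big /=.
have n2 : (n < n.*2.+1)%N by lia.
rewrite (bigD1 (Ordinal n2)) //= [X in _ + X]big1 ?addr0 => [|i ni]; last first.
  rewrite -mulr_sumr sum_prim_root //; last 2 first.
  - by apply: leq_ltn_trans nM; rewrite -ltnS.
  - by apply: leq_ltn_trans nM; lia.
  rewrite (_ : (i == n :> nat) = false) ?mulr0 ?mulr0 //.
  by apply/negbTE; apply: contra ni => /eqP Ei; apply/eqP/val_inj.
rewrite -mulr_sumr sum_prim_root ?eqxx ?mulr1 1?mulrC //.
all: by apply: leq_ltn_trans nM; lia.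
Qed.

(** The remainder carries the factor w^J, so that for |w| < 1 the main term is
    the generating function of the cubes. *)
Lemma sum_cubes_geometric (J : nat) (w : C) : w != 1 ->
  \sum_(j < J) j%:R ^+ 3 * w ^+ j =
  w * (1 + 4 * w + w ^+ 2) / (1 - w) ^+ 4 -
  w ^+ J * (w * (1 + 4 * w + w ^+ 2) / (1 - w) ^+ 4
     + 3 * J%:R * (w * (1 + w) / (1 - w) ^+ 3)
     + 3 * J%:R ^+ 2 * (w / (1 - w) ^+ 2) + J%:R ^+ 3 / (1 - w)).
Proof.
move=> w1; have w1' : 1 - w != 0 by rewrite subr_eq0 eq_sym.
elim: J => [|J IH]; first by rewrite big_ord0 expr0 mul1r !expr0n /= !mulr0 !mul0r !addr0 subrr.
rewrite big_ord_recr /= IH [w ^+ J.+1]exprSr -[J.+1%:R]natr1; field.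
by [].
Qed.

End RootsOfUnity.

(** * The central binomial coefficients *)

Section CentralBinomial.
Variable R : realType.

(** The n-th moment of cos^2 (x/2) for x uniform on the circle. *)
Definition cbin (n : nat) : R := 'C(n.*2, n)%:R / 4 ^+ n.

Lemma cbin0 : cbin 0 = 1.
Proof. by rewrite /cbin bin0 expr0 divr1. Qed.

Lemma cbinS n : cbin n.+1 = cbin n * ((2 * n%:R + 1) / (2 * n%:R + 2)).
Proof.
have E : ('C(n.+1.*2, n.+1) * n.+1 = 2 * n.*2.+1 * 'C(n.*2, n))%N.
  have n0 : (0 < n.+1)%N by [].
  have := mul_bin_diag n.*2.+1 n; rewrite doubleS => h1.
  have := mul_bin_left n.*2.+1 n => h2.
  have := mul_bin_diag n.*2 n => h3.
  have h4 := mul_bin_left n.*2 n.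
  have h5 := binS n.*2.+1 n.
  have h6 := binS n.*2 n.
  have e1 : (n.*2.+1 - n = n.+1)%N by lia.
  have e2 : (n.*2 - n = n)%N by lia.
  rewrite e1 in h2; rewrite e2 in h4.
  have e3 : 'C(n.*2.+1, n.+1) = 'C(n.*2.+1, n).
    by apply/eqP; rewrite -(eqn_pmul2l n0) h2.
  nia.
have n1 : n.+1%:R != 0 :> R by rewrite pnatr_eq0.
have E' : 'C(n.+1.*2, n.+1)%:R = 2 * n.*2.+1%:R * 'C(n.*2, n)%:R / n.+1%:R :> R.
  by apply: (mulIf n1); rewrite divfK // -!natrM E.
rewrite /cbin E' exprS.
have -> : n.*2.+1%:R = 2 * n%:R + 1 :> R by rewrite -natr1 -muln2 natrM mulrC.
rewrite -[n.+1%:R]natr1.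
have n1' : n%:R + 1 != 0 :> R by rewrite natr1.
move: (n%:R) n1' => y y0.
have e4 : 4 ^+ n != 0 :> R by rewrite expf_neq0 // pnatr_eq0.
move: (4 ^+ n) e4 => u u0; field; rewrite (_ : 2 * y + 2 = 2 * (y + 1)); last by ring.
by rewrite u0 y0 mulf_neq0.
Qed.

Lemma cbin_ge0 n : 0 <= cbin n.
Proof. by rewrite divr_ge0 ?exprn_ge0. Qed.

(** Up to the shift 26/100 and a constant slightly above 1/pi, this is Wallis'
    asymptotics. The quantity cbin n ^ 2 (n + 26/100) decreases from n = 6 on,
    where it is below 36/113. *)
Lemma cbin_sqr_le n :
  cbin n ^+ 2 <= 36 / 113 / (n%:R + 26 / 100).
Proof.
have base m : cbin m ^+ 2 * (m%:R + 26 / 100) <= 36 / 113 ->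
    cbin m ^+ 2 <= 36 / 113 / (m%:R + 26 / 100).
  by move=> h; rewrite ler_pdivlMr //; have : 0 <= m%:R :> R by []; lra.
apply: base; elim: n => [|n IH]; first by rewrite cbin0; lra.
have [n6|n6] := ltnP n 6.
  have c1 : cbin 1 = 1 / 2 by rewrite cbinS cbin0; field.
  have c2 : cbin 2 = 3 / 8 by rewrite cbinS c1 ; field.
  have c3 : cbin 3 = 5 / 16 by rewrite cbinS c2 ; field.
  have c4 : cbin 4 = 35 / 128 by rewrite cbinS c3 ; field.
  have c5 : cbin 5 = 63 / 256 by rewrite cbinS c4 ; field.
  have c6 : cbin 6 = 231 / 1024 by rewrite cbinS c5 ; field.
  by case: n n6 {IH} => [|[|[|[|[|[|n]]]]]] // _; rewrite ?(c1, c2, c3, c4, c5, c6) ; lra.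
have n6' : 6 <= n%:R :> R by rewrite (ler_nat R 6 n).
apply: le_trans IH; rewrite cbinS exprMn -mulrA ler_wpM2l ?sqr_ge0 //.
rewrite -[n.+1%:R]natr1; move: n6'; set x := n%:R => x6.
rewrite expr_div_n mulrAC ler_pdivrMr; last by apply: exprn_gt0; lra.
nra.
Qed.

End CentralBinomial.

(** * Poisson averages of the central binomial coefficients *)

Section Poisson.
Variable R : realType.
Implicit Types (x nu : R) (n N : nat).

Definition psum x N : R := \sum_(n < N) x ^+ n / n`!%:R.

Lemma psumE x : psum x = series (exp_coeff x).
Proof. by apply/funext => N; rewrite /psum /series /= big_mkord. Qed.

Lemma cvg_psum x : (psum x @ \oo --> expR x)%classic.
Proof. rewrite psumE; exact: is_cvg_series_exp_coeff. Qed.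

Lemma psum_le x N : 0 <= x -> psum x N <= expR x.
Proof.
move=> x0; rewrite psumE; apply: nondecreasing_cvgn_le.
  apply: nondecreasing_series => n _ _; exact: exp_coeff_ge0.
exact: is_cvg_series_exp_coeff.
Qed.

(** The remainder of the exponential series has nonnegative coefficients. *)
Lemma expR_sub_psum_le x y N : 0 <= x <= y ->
  expR x - psum x N <= expR y - psum y N.
Proof.
move=> /andP[x0 xy].
suff H m : (N <= m)%N -> psum x m - psum x N <= psum y m - psum y N.
  have hx : ((fun m => psum x m - psum x N) @ \oo --> expR x - psum x N)%classic.
    by apply: cvgB; [exact: cvg_psum | exact: cvg_cst].
  have hy : ((fun m => psum y m - psum y N) @ \oo --> expR y - psum y N)%classic.
    by apply: cvgB; [exact: cvg_psum | exact: cvg_cst].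
  apply: (ler_cvg_to hx hy); near=> m; apply: H; near: m; exact: nbhs_infty_ge.
move=> /subnKC <-; move: (m - N)%N => d.
rewrite /psum !big_split_ord /= ![_ + _ - _]addrAC !subrr !add0r.
apply: ler_sum => i _; rewrite ler_wpM2r ?invr_ge0 //.
by rewrite lerXn2r // nnegrE // (le_trans x0).
Unshelve. all: by end_near. Qed.

Definition pois nu n : R := expR (- nu) * (nu ^+ n / n`!%:R).
(** The mass of the Poisson law on the integers from N on. *)
Definition pois_tail nu N : R := 1 - \sum_(n < N) pois nu n.

Lemma pois_ge0 nu n : 0 <= nu -> 0 <= pois nu n.
Proof. by move=> nu0; rewrite !mulr_ge0 ?expR_ge0 ?invr_ge0 ?exprn_ge0. Qed.

Lemma sum_pois_le1 nu N : 0 <= nu -> \sum_(n < N) pois nu n <= 1.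
Proof.
move=> nu0; rewrite -mulr_sumr mulrC expRN ler_pdivrMr ?expR_gt0 // mul1r.
exact: psum_le.
Qed.

Lemma pois_tail_cvg nu : (pois_tail nu @ \oo --> (0:R))%classic.
Proof.
have -> : pois_tail nu = (fun N => 1 - expR (- nu) * psum nu N).
  by apply/funext => N; rewrite /pois_tail -mulr_sumr.
have -> : 0 = 1 - expR (- nu) * expR nu by rewrite mulrC expRxMexpNx_1 subrr.
by apply: cvgB; [exact: cvg_cst|apply: cvgMr; exact: cvg_psum].
Qed.

(** The exponential is the generating function of the Poisson law; on [0, 1]
    the terms from N on contribute at most their mass. *)
Lemma expR_poisson_le nu x N : 0 <= nu -> 0 <= x <= 1 ->
  expR (- (nu * (1 - x))) <= \sum_(n < N) pois nu n * x ^+ n + pois_tail nu N.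
Proof.
move=> nu0 /andP[x0 x1].
have -> : expR (- (nu * (1 - x))) = expR (- nu) * expR (nu * x).
  by rewrite -expRD; congr expR; ring.
have -> : \sum_(n < N) pois nu n * x ^+ n = expR (- nu) * psum (nu * x) N.
  by rewrite mulr_sumr; apply: eq_bigr => i _; rewrite /pois exprMn; ring.
have -> : pois_tail nu N = expR (- nu) * (expR nu - psum nu N).
  by rewrite mulrBr mulrC expRxMexpNx_1 mulr_sumr.
rewrite -mulrDr ler_wpM2l ?expR_ge0 // -lerBlDl; apply: expR_sub_psum_le.
by rewrite mulr_ge0 //= -[leRHS]mulr1 ler_wpM2l.
Qed.

(** The bound for the average over the circle of exp (- nu (1 - cos^2 (x/2))):
    its Gaussian asymptotics with an explicit error factor. *)
Definition ibound nu : R := Num.sqrt (36 / 113 / nu) * (1 + 57 / 20 / nu).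

(** By AM-GM each square root in the bound for cbin n is replaced by its value
    at the mean nu plus a multiple of its square; the reciprocals 1/(n + 1) and
    1/((n + 1)(n + 2)) then only shift the Poisson law. *)
Lemma sum_pois_cbin nu N : 0 < nu ->
  \sum_(n < N) pois nu n * cbin R n <= ibound nu.
Proof.
move=> nu0; have nu0' := ltW nu0.
set rho := Num.sqrt (36 / 113 / nu).
have rho0 : 0 < rho by rewrite sqrtr_gt0 divr_gt0 //; lra.
have rho2 : rho ^+ 2 = 36 / 113 / nu by rewrite sqr_sqrtr // divr_ge0 //; lra.
pose s m : R := \sum_(n < N) pois nu (n + m).
have s1 m : s m <= 1.
  apply: le_trans (sum_pois_le1 (m + N) nu0').
  have -> : \sum_(n < m + N) pois nu n = \sum_(n < m) pois nu n + s m.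
    by rewrite big_split_ord; congr (_ + _); apply: eq_bigr => n _; rewrite /= addnC.
  by rewrite lerDr sumr_ge0 // => n _; exact: pois_ge0.
have termb n : pois nu n * cbin R n <= 2^-1 * rho * pois nu n +
   rho^-1 * (2^-1 * (36/113)) * (nu^-1 * pois nu (n + 1) + 57/10 * (nu^-1 ^+ 2 * pois nu (n + 2))).
  have n0 : 0 <= n%:R :> R by [].
  have nn1 : n%:R + 1 != 0 :> R by rewrite natr1.
  have nn2 : n%:R + 2 != 0 :> R by rewrite -natrD addn2.
  have nne : nu != 0 by rewrite gt_eqF.
  have f0 : n`!%:R != 0 :> R by rewrite pnatr_eq0 -lt0n fact_gt0.
  have e1 : nu^-1 * pois nu (n + 1) = pois nu n / (n%:R + 1).
    rewrite /pois addn1 exprS factS natrM -natr1; field.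
    by rewrite f0 nn1 nne.
  have e2 : nu^-1 ^+ 2 * pois nu (n + 2) = pois nu n / (n%:R + 1) / (n%:R + 2).
    have -> : pois nu (n + 2) =
        expR (- nu) * (nu * (nu * nu ^+ n) / ((n%:R + 2) * ((n%:R + 1) * n`!%:R))).
      by rewrite /pois addn2 !exprS !factS !natrM -[n.+1%:R]natr1 -addn2 natrD.
    by rewrite /pois; field; rewrite f0 nne nn1 nn2.
  rewrite e2 e1.
  have := cbin_sqr_le R n; have := cbin_ge0 R n; have := pois_ge0 n nu0'.
  move: (pois nu n) (cbin R n) => P c P0 c0 c2.
  (* AM-GM at rho, the value of the bound at the mean. *)
have h1 : c <= 2^-1 * rho + rho^-1 * (2^-1 * c ^+ 2).
    rewrite -subr_ge0 (_ : _ - _ = 2^-1 * (rho - c) ^+ 2 / rho); last first.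
      by field; rewrite gt_eqF.
    by rewrite divr_ge0 ?(ltW rho0) // mulr_ge0 ?sqr_ge0 // invr_ge0.
  have h2 : c ^+ 2 <= 36 / 113 * ((n%:R + 1)^-1 + 57 / 10 / (n%:R + 1) / (n%:R + 2)).
    apply: le_trans c2 _; apply: ler_wpM2l; first by lra.
    rewrite -subr_ge0.
    have -> : (n%:R + 1)^-1 + 57 / 10 / (n%:R + 1) / (n%:R + 2) - (n%:R + 26 / 100)^-1 =
       ((496/100) * n%:R + 2/1000) / ((n%:R + 1) * (n%:R + 2) * (n%:R + 26 / 100)) :> R.
      field; rewrite nn1 nn2 /= ?andbT; apply/eqP; lra.
    have p1 : 0 <= n%:R + 1 :> R by lra.
    have p2 : 0 <= n%:R + 2 :> R by lra.
    have p3 : 0 <= n%:R + 26 / 100 :> R by lra.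
    apply: divr_ge0; last by rewrite !mulr_ge0.
    lra.
  have -> : 2^-1 * rho * P + rho^-1 * (2^-1 * (36 / 113)) *
      (P / (n%:R + 1) + 57 / 10 * (P / (n%:R + 1) / (n%:R + 2))) =
     P * (2^-1 * rho + rho^-1 * (2^-1 * (36 / 113 * ((n%:R + 1)^-1 + 57 / 10 / (n%:R + 1) / (n%:R + 2))))).
    by field; rewrite nn1 nn2 gt_eqF.
  rewrite ler_wpM2l //; apply: le_trans h1 _; rewrite lerD2l.
  rewrite ler_wpM2l ?invr_ge0 ?(ltW rho0) //; lra.
apply: le_trans (ler_sum _ (fun (n : 'I_N) _ => termb n)) _.
have -> : \sum_(n < N) (2^-1 * rho * pois nu n + rho^-1 * (2^-1 * (36 / 113)) *
     (nu^-1 * pois nu (n + 1) + 57 / 10 * (nu^-1 ^+ 2 * pois nu (n + 2)))) =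
   2^-1 * rho * \sum_(n < N) pois nu n + rho^-1 * (2^-1 * (36 / 113)) *
     (nu^-1 * s 1%N + 57 / 10 * (nu^-1 ^+ 2 * s 2%N)).
  rewrite /s; move: (pois nu) (rho^-1 * _) => P b.
  by rewrite big_split /= -!mulr_sumr big_split /= -!mulr_sumr.
have s0 : \sum_(i < N) pois nu i <= 1 by exact: sum_pois_le1.
have -> : ibound nu = 2^-1 * rho + rho^-1 * (2^-1 * (36/113)) * (nu^-1 + 57/10 * (nu^-1 ^+ 2)).
  have -> : rho^-1 * (2^-1 * (36/113)) * (nu^-1 + 57/10 * nu^-1 ^+ 2) =
     rho^-1 * 2^-1 * rho^+2 * (1 + 57/10 * nu^-1) by rewrite rho2; ring.
  rewrite /ibound -/rho; field; by rewrite !gt_eqF.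
apply: lerD; first by rewrite -[leRHS]mulr1; apply: ler_wpM2l s0; apply: mulr_ge0; [rewrite invr_ge0|exact: ltW].
apply: ler_wpM2l; first by apply: mulr_ge0; [rewrite invr_ge0 ltW|lra].
have i0 : 0 <= nu^-1 by rewrite invr_ge0.
apply: lerD; first by rewrite -[leRHS]mulr1; exact: ler_wpM2l.
apply: ler_wpM2l; first by lra.
by rewrite -[leRHS]mulr1; apply: ler_wpM2l => //; exact: sqr_ge0.
Qed.

End Poisson.

(** * Pointwise bounds on the unit circle *)

Section UnitCircle.
Variable R : realType.
Local Notation C := (R[i])%C.
Local Notation "x %:C" := (real_complex R x) : ring_scope.
Implicit Types (z : C).

(** cos^2 of half the argument of z, when |z| = 1. *)
Definition cos2half z : R := (1 + complex.Re z) / 2.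

Lemma addr_inv_unit z : `|z| = 1 -> z + z^-1 = (2 * complex.Re z)%:C.
Proof. by move=> z1; rewrite invc_norm z1 expr1n invr1 mul1r addcJ rmorphM rmorph_nat. Qed.

Lemma unit_neq0 z : `|z| = 1 -> z != 0.
Proof. by move=> z1; rewrite -normr_gt0 z1 ltr01. Qed.

Lemma cos2halfE z : `|z| = 1 -> (cos2half z)%:C = (1 + z) ^+ 2 / (4 * z).
Proof.
move=> z1; have zn0 := unit_neq0 z1.
have -> : (1 + z) ^+ 2 / (4 * z) = (2 + (z + z^-1)) / 4 by field.
rewrite addr_inv_unit // /cos2half.
rewrite !rmorphM rmorphD fmorphV rmorph1 !rmorph_nat; by field.
Qed.

Lemma cos2half_bound z : `|z| = 1 -> 0 <= cos2half z <= 1.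
Proof.
move=> z1; have := normc_ge_Re z; rewrite z1 -[1]/(1%:C) lecR ler_norml /cos2half.
by move=> /andP[h1 h2]; apply/andP; split; lra.
Qed.

(** Both generating functions are made of affine factors, so that their moduli
    on the unit circle depend on z only through cos2half z. *)
Lemma normc_affine (a b : R) z : `|z| = 1 ->
  `|a%:C + b%:C * z| ^+ 2 = ((a + b) ^+ 2 - 4 * (a * b) * (1 - cos2half z))%:C.
Proof.
move=> z1; have zn0 := unit_neq0 z1.
have zJ : z^*%C = z^-1 by rewrite invc_norm z1 expr1n invr1 mul1r.
have -> : `|a%:C + b%:C * z| ^+ 2 = (a%:C + b%:C * z) * (a%:C + b%:C / z).
  rewrite sqr_normc; congr (_ * _); rewrite rmorphD; congr (_ + _).
    exact: conjc_real.
  by rewrite rmorphM; congr (_ * _); [exact: conjc_real|exact: zJ].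
have -> : (a%:C + b%:C * z) * (a%:C + b%:C / z) =
   a%:C ^+ 2 + b%:C ^+ 2 + a%:C * b%:C * (z + z^-1) by field.
rewrite addr_inv_unit // -!rmorphXn -!rmorphM -!rmorphD; congr _%:C.
by rewrite /cos2half; field.
Qed.

Lemma norm_bernoulli_le (p : R) (c : nat) z : 0 <= p <= 1 -> `|z| = 1 ->
  `|((1 - p)%:C + p%:C * z) ^+ c| <=
    (expR (- (2 * c%:R * (p * (1 - p)) * (1 - cos2half z))))%:C.
Proof.
move=> /andP[p0 p1] z1; have /andP[x0 x1] := cos2half_bound z1.
set t := 1 - cos2half z.
have pq : p * (1 - p) <= 1 / 4.
  by have := sqr_ge0 (p - 1/2); rewrite expr2; lra.
have pq0 : 0 <= p * (1 - p) by rewrite mulr_ge0 //; lra.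
have t1 : 0 <= t <= 1 by rewrite /t; apply/andP; split; lra.
have pqt : 0 <= p * (1 - p) * t <= 1 / 4.
  case/andP: t1 => t0 t1; rewrite mulr_ge0 //=; apply: le_trans pq.
  by rewrite -[leRHS]mulr1 ler_wpM2l.
have h0 : 0 <= 1 - 2 * (p * (1 - p) * t) by lra.
have h : `|(1 - p)%:C + p%:C * z| <= (1 - 2 * (p * (1 - p) * t))%:C.
  rewrite -(@ler_pXn2r _ 2) // ?nnegrE ?normr_ge0 ?ler0c //.
  rewrite normc_affine // -rmorphXn lecR -/t subrK expr1n.
  by have := sqr_ge0 (p * (1 - p) * t); rewrite !expr2; lra.
rewrite normrX; apply: le_trans (lerXn2r _ _ _ h) _.
- by rewrite nnegrE normr_ge0.
- by rewrite nnegrE ler0c.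
rewrite -rmorphXn lecR.
have -> : - (2 * c%:R * (p * (1 - p)) * t) = - (2 * (p * (1 - p) * t)) * c%:R by ring.
rewrite expRM_natr lerXn2r ?nnegrE ?expR_ge0 //.
exact: expR_ge1Dx.
Qed.

(** With r = exp (- theta), om2 is the square of 2 sinh (theta/2). The
    denominator is a power of 1 + 4 t / om2, with t = 1 - cos2half z, and
    Gauss-Radau quadrature turns it into exponentials of t, whose averages are
    known. *)
Lemma norm_cubes_le (r om2 : R) z w : 0 < r < 1 -> `|z| = 1 ->
  w = r%:C / z -> om2 = (1 - r) ^+ 2 / r ->
  `|w * (1 + 4 * w + w ^+ 2) / (1 - w) ^+ 4| <=
   ((6 + om2) / om2 ^+ 2 *
     (3^-1 + 2 / 3 * expR (- (12 / om2 * (1 - cos2half z)))))%:C.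
Proof.
move=> /andP[r0 r1] z1 wE omE; have zn0 := unit_neq0 z1.
have /andP[x0 x1] := cos2half_bound z1; set t := 1 - cos2half z.
have t0 : 0 <= t by rewrite subr_ge0.
have om0 : 0 < om2 by rewrite omE divr_gt0 // exprn_gt0 // subr_gt0.
have zv1 : `|z^-1| = 1 by rewrite normfV z1 invr1.
have tE : cos2half z^-1 = cos2half z.
  rewrite /cos2half; congr ((1 + _) / 2); apply: complexI.
  by apply: (mulfI (_ : 2%:C != 0)); [rewrite -(rmorph0 (real_complex R)) (inj_eq (@complexI R)) | rewrite -!rmorphM /= -!addr_inv_unit // invrK addrC].
have nw : `|w| = r%:C.
  by rewrite wE normrM zv1 mulr1 ger0_norm // ler0c ltW.
have n1w : `|1 - w| ^+ 2 = ((1 - r) ^+ 2 + 4 * r * t)%:C.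
  have -> : 1 - w = 1%:C + (- r)%:C * z^-1 by rewrite wE rmorphN mulNr.
  by rewrite normc_affine // tE -/t; congr _%:C; ring.
have d0 : 0 < (1 - r) ^+ 2 + 4 * r * t.
  by rewrite ltr_wpDr ?mulr_ge0 ?exprn_gt0 ?subr_gt0 // ltW.
rewrite normrM normfV normrX (exprM _ 2 2) n1w.
have num : `|w * (1 + 4 * w + w ^+ 2)| <= (r * (1 + 4 * r + r ^+ 2))%:C.
  rewrite normrM nw [leRHS]rmorphM ler_wpM2l ?ler0c ?(ltW r0) //.
  apply: le_trans (ler_normD _ _) _; rewrite normrX nw [leRHS]rmorphD rmorphXn lerD2r.
  apply: le_trans (ler_normD _ _) _.
  by rewrite normrM nw normr1 normr_nat [leRHS]rmorphD rmorph1 rmorphM rmorph_nat.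
rewrite -rmorphXn -fmorphV.
apply: le_trans (ler_wpM2r _ num) _; first by rewrite ler0c invr_ge0 exprn_ge0 // ltW.
rewrite -rmorphM lecR.
have -> : r * (1 + 4 * r + r ^+ 2) / ((1 - r) ^+ 2 + 4 * r * t) ^+ 2 =
   (6 + om2) / om2 ^+ 2 * (1 + 4 * t / om2) ^- 2.
  have r' : r != 0 by rewrite gt_eqF.
  have r1' : 1 - r != 0 by rewrite subr_eq0 gt_eqF.
  have -> : 1 + 4 * t / om2 = ((1 - r) ^+ 2 + 4 * r * t) / (1 - r) ^+ 2.
    by rewrite omE; field; rewrite r' r1'.
  by rewrite omE; field; rewrite r' r1' gt_eqF.
have -> : 12 / om2 * t = 3 * (4 * t / om2) by field; rewrite gt_eqF.
apply: ler_wpM2l; first by rewrite divr_ge0 ?sqr_ge0 // addr_ge0 // ltW.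
by apply: radau_bound; rewrite divr_ge0 ?mulr_ge0 // ltW.
Qed.

End UnitCircle.

(** * A Fourier bound for a binomial sum of cubes *)

Section Fourier.
Variable R : realType.
Local Notation C := (R[i])%C.
Local Notation "x %:C" := (real_complex R x) : ring_scope.

(** Expanding the exponential as a Poisson mixture of powers of cos2half
    reduces its average over the roots of unity to central binomial
    coefficients. *)
Lemma sum_expR_circle (M N : nat) (w : C) (nu : R) : (0 < M)%N ->
  M.-primitive_root w -> (N.*2 < M)%N -> 0 < nu ->
  \sum_(l < M) expR (- (nu * (1 - cos2half (w ^+ l)))) <=
  M%:R * (ibound nu + pois_tail nu N).
Proof.
move=> M0 pw NM nu0.
have z1 (l : nat) : `|w ^+ l| = 1 by exact: norm_prim_root pw.
have le1 (l : 'I_M) := expR_poisson_le N (ltW nu0) (cos2half_bound (z1 l)).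
apply: le_trans (ler_sum _ (fun l _ => le1 l)) _.
rewrite big_split /= sumr_const card_ord -[_ *+ M]mulr_natl [leRHS]mulrDr lerD2r.
rewrite exchange_big /=.
apply: (@le_trans _ _ (\sum_(n < N) M%:R * (pois nu n * cbin R n))); last first.
  by rewrite -mulr_sumr ler_wpM2l // sum_pois_cbin.
apply: ler_sum => n _; rewrite -mulr_sumr [leRHS]mulrCA.
apply: ler_wpM2l; first by rewrite pois_ge0 // ltW.
rewrite le_eqVlt; apply/orP; left; apply/eqP; apply: complexI.
have nM : (n.*2 < M)%N by apply: leq_ltn_trans NM; rewrite leq_double ltnW.
rewrite rmorphM rmorph_nat /cbin fmorph_div rmorphXn !rmorph_nat.
rewrite -(sum_prim_root_cos pw nM) rmorph_sum; apply: eq_bigr => l _.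
by rewrite -cos2halfE // -rmorphXn.
Qed.

Definition bin_pmf (c : nat) (p : R) (n : nat) : R :=
  'C(c, n)%:R * p ^+ n * (1 - p) ^+ (c - n).

Definition cubes (r : R) (j : nat) : R := j%:R ^+ 3 * r ^+ j.

(** Averaging over roots of unity of large order extracts the pairs (n, j) with
    n + s0 = j + s1. The shifts s0 and s1 encode an integer threshold s1 - s0
    of either sign. *)
Lemma circle_sum_fourier (M c s0 s1 J : nat) (p r : R) (w : C) :
  M.-primitive_root w -> (c + s0 < J)%N -> (J + s1 < M)%N ->
  \sum_(l < M) (w ^+ l) ^+ s0 * ((1 - p)%:C + p%:C * w ^+ l) ^+ c *
     ((w ^+ l) ^- s1 * \sum_(j < J) j%:R ^+ 3 * (r%:C / w ^+ l) ^+ j)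
  = (M%:R * \sum_(n < c.+1) bin_pmf c p n * cubes r (n + s0 - s1))%:C.
Proof.
move=> pw cJ JM; have M0 : (0 < M)%N by case: M JM {pw}.
have z1 (l : nat) : `|w ^+ l| = 1 by exact: norm_prim_root pw.
pose P n : C := (bin_pmf c p n)%:C; pose a j : C := (cubes r j)%:C.
have S1 (z : C) : z ^+ s0 * ((1 - p)%:C + p%:C * z) ^+ c =
    \sum_(n < c.+1) P n * z ^+ (n + s0).
  rewrite exprDn mulr_sumr; apply: eq_bigr => n _.
  rewrite /P /bin_pmf !rmorphM rmorph_nat !rmorphXn -mulr_natl exprMn exprD; ring.
have S2 (z : C) : z != 0 -> z ^- s1 * (\sum_(j < J) j%:R ^+ 3 * (r%:C / z) ^+ j) =
    \sum_(j < J) a j / z ^+ (j + s1).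
  move=> z0; rewrite mulr_sumr; apply: eq_bigr => j _.
  rewrite /a /cubes rmorphM !rmorphXn rmorph_nat expr_div_n exprD invfM; ring.
under eq_bigr => l _.
  rewrite S1 S2 ?unit_neq0 // mulr_suml.
  under eq_bigr => n _.
    rewrite mulr_sumr.
    under eq_bigr => j _ do rewrite mulrACA.
    over.
  over.
rewrite exchange_big /= rmorphM rmorph_nat rmorph_sum mulr_sumr.
apply: eq_bigr => n _; rewrite exchange_big /=.
have nJ : (n + s0 - s1 < J)%N by have := ltn_ord n; lia.
rewrite (bigD1 (Ordinal nJ)) //= [X in _ + X]big1 => [|j jn]; last first.
  rewrite -mulr_sumr sum_prim_root //; last 2 first.
  - by have := ltn_ord n; lia.
  - by have := ltn_ord j; lia.
  rewrite (_ : (n + s0 == j + s1)%N = false) ?mulr0 //; apply/negP => /eqP E.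
  by case/eqP: jn; apply: val_inj; rewrite /= E addnK.
rewrite addr0 -mulr_sumr sum_prim_root //; last 2 first.
- by have := ltn_ord n; lia.
- by have := ltn_ord n; lia.
rewrite rmorphM -/(P n) -/(a _).
have [s1n|ns1] := leqP s1 (n + s0); first by rewrite subnK // eqxx mulr1 mulrC.
have -> : (n + s0 - s1 = 0)%N by apply/eqP; rewrite subn_eq0 ltnW.
by rewrite /a /cubes expr0n /= mul0r rmorph0 !mulr0 mul0r.
Qed.

(** The cubes are summed up to J and the Poisson mixtures up to N, so that only
    finite sums occur; the order of the roots of unity is chosen large enough
    for both. *)
Lemma cubes_fourier_truncated (c s0 s1 J N : nat) (p r om2 nu : R) :
  0 < p < 1 -> 0 < r < 1 -> om2 = (1 - r) ^+ 2 / r ->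
  nu = 2 * c%:R * (p * (1 - p)) -> (0 < c)%N -> (c + s0 < J)%N ->
  \sum_(n < c.+1) bin_pmf c p n * cubes r (n + s0 - s1) <=
    (6 + om2) / om2 ^+ 2 *
    (3^-1 * (ibound nu + pois_tail nu N) +
     2 / 3 * (ibound (nu + 12 / om2) + pois_tail (nu + 12 / om2) N)) +
    16 / (1 - r) ^+ 4 * (J%:R ^+ 3 * r ^+ J).
Proof.
move=> /andP[p0 p1] /andP[r0 r1] omE nuE c0 cJ.
(* Large enough to separate both the frequencies J + s1 and 2 N. *)
pose M := (J + s1 + N.*2).+1.
have [w pw] := @prim_root_closed C M isT.
have JM : (J + s1 < M)%N by rewrite ltnS leq_addr.
have NM : (N.*2 < M)%N by rewrite ltnS leq_addl.
have z1 (l : nat) : `|w ^+ l| = 1 by exact: norm_prim_root pw.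
have om0 : 0 < om2 by rewrite omE divr_gt0 // exprn_gt0 // subr_gt0.
have nu0 : 0 < nu.
  by rewrite nuE !mulr_gt0 ?subr_gt0 // ltr0n.
have nu20 : 0 < nu + 12 / om2 by rewrite addr_gt0 // divr_gt0.
set X := \sum_(n < c.+1) _.
set G := (6 + om2) / om2 ^+ 2; set H := 16 / (1 - r) ^+ 4 * _.
have G0 : 0 <= G by rewrite divr_ge0 ?exprn_ge0 ?addr_ge0 // ltW.
have J0n : (0 < J)%N by exact: leq_ltn_trans (leq0n _) cJ.
have r1' : 0 < 1 - r by rewrite subr_gt0.
have H0 : 0 <= H.
  by rewrite !mulr_ge0 ?invr_ge0 ?exprn_ge0 // ltW.
pose t l : R := 1 - cos2half (w ^+ l).
have key (l : 'I_M) : `|(w ^+ l) ^+ s0 * ((1 - p)%:C + p%:C * w ^+ l) ^+ c *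
     ((w ^+ l) ^- s1 * \sum_(j < J) j%:R ^+ 3 * (r%:C / w ^+ l) ^+ j)| <=
   (expR (- (nu * t l)) * (G * (3^-1 + 2 / 3 * expR (- (12 / om2 * t l))) + H))%:C.
  rewrite /t; move: (w ^+ l) (z1 l) => z zz1.
  rewrite !normrM normfV !normrX zz1 !expr1n invr1 !mul1r rmorphM.
  apply: ler_pM => //; rewrite ?exprn_ge0 ?normr_ge0 //.
    rewrite -normrX nuE; apply: norm_bernoulli_le => //.
    by apply/andP; split; exact: ltW.
  have [q qE] : {q | q = r%:C / z} by exists (r%:C / z).
  rewrite -qE.
  have nq : `|q| = r%:C.
    by rewrite qE normrM normfV zz1 invr1 mulr1 ger0_norm // ler0c ltW.
  have nq1 : `|q| <= 1 by rewrite nq -[1]/(1%:C) lecR ltW.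
  have n1q : (1 - r)%:C <= `|1 - q|.
    have := lerB_normD 1 (- q); rewrite normrN normr1 nq; apply: le_trans.
    by rewrite rmorphB rmorph1.
  have r1c : 0 < (1 - r)%:C by rewrite -[0]/(0%:C) ltcR.
  have n1q0 : 0 < `|1 - q| by apply: lt_le_trans n1q.
  have q1 : q != 1 by move: n1q0; rewrite normr_gt0 subr_eq0 eq_sym.
  rewrite sum_cubes_geometric // rmorphD.
  apply: le_trans (ler_normB _ _) _; apply: lerD.
    by apply: (norm_cubes_le _ zz1 qE omE); rewrite r0.
  set E := ((1 - r)%:C)^-1.
  have i1 : `|1 - q|^-1 <= E by rewrite lef_pV2 ?posrE.
  have E1 : 1 <= E.
    have h1 : (1 - r)%:C <= 1 :> C by rewrite -(rmorph1 (real_complex R)) lecR; lra.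
    by rewrite -(invr1 C) lef_pV2 ?posrE ?ltr01.
  have E0 : 0 <= E by exact: le_trans ler01 E1.
  have bnd (x b : C) (k : nat) : (k <= 4)%N -> `|x| <= b ->
      `|x / (1 - q) ^+ k| <= b * E ^+ 4.
    move=> k4 xb; rewrite normrM normfV normrX -exprVn; apply: ler_pM => //.
    apply: le_trans (ler_weXn2l E1 k4).
    by rewrite lerXn2r // nnegrE ?E0 // invr_ge0.
  have b1 : `|q * (1 + 4 * q + q ^+ 2)| <= 6.
    rewrite normrM -[leRHS]mul1r; apply: ler_pM => //.
    apply: le_trans (ler_normD _ _) _; rewrite normrX.
    have -> : 6 = 5 + 1 :> C by ring.
    apply: lerD; last by rewrite exprn_ile1.
    apply: le_trans (ler_normD _ _) _; rewrite normr1 normrM normr_nat.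
    have -> : 5 = 1 + 4 * 1 :> C by ring.
    by rewrite lerD2l ler_wpM2l.
  have b2 : `|3 * J%:R * (q * (1 + q))| <= 6 * J%:R.
    rewrite !normrM !normr_nat.
    have -> : 6 * J%:R = 3 * J%:R * (1 * 2) :> C by ring.
    rewrite ler_wpM2l // ?mulr_ge0 //; apply: ler_pM => //.
    by apply: le_trans (ler_normD _ _) _; rewrite normr1 lerD2l.
  have b3 : `|3 * J%:R ^+ 2 * q| <= 3 * J%:R ^+ 2.
    rewrite 2!normrM normrX !normr_nat -[leRHS]mulr1 ler_wpM2l //.
  have b4 : `|J%:R ^+ 3 : C| <= J%:R ^+ 3 by rewrite normrX normr_nat.
  have HE : H%:C = r%:C ^+ J * (16 * J%:R ^+ 3 * E ^+ 4).
    rewrite /H /E -exprVn !(rmorphM, fmorphV, rmorphXn, rmorph_nat); ring.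
  rewrite [leRHS]HE normrM normrX nq ler_wpM2l ?exprn_ge0 ?ler0c ?(ltW r0) //.
  have sE : (6 + 6 * J%:R + 3 * J%:R ^+ 2 + J%:R ^+ 3) * E ^+ 4 = 6 * E ^+ 4 +
      6 * J%:R * E ^+ 4 + 3 * J%:R ^+ 2 * E ^+ 4 + J%:R ^+ 3 * E ^+ 4 by ring.
  apply: (@le_trans _ _ ((6 + 6 * J%:R + 3 * J%:R ^+ 2 + J%:R ^+ 3) * E ^+ 4)).
    rewrite sE; do 3?[apply: le_trans (ler_normD _ _) _; apply: lerD].
    - exact: (bnd _ _ 4%N isT b1).
    - by rewrite mulrA; exact: (bnd _ _ 3%N isT b2).
    - by rewrite mulrA; exact: (bnd _ _ 2%N isT b3).
    - by rewrite -[X in _ / X]expr1; exact: (bnd _ _ 1%N isT b4).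
  rewrite ler_wpM2r ?exprn_ge0 //.
  have J1 : 1 <= J%:R :> C by rewrite ler1n.
  have J3 k : (k <= 3)%N -> J%:R ^+ k <= J%:R ^+ 3 :> C by move=> k3; exact: ler_weXn2l.
  have -> : 16 * J%:R ^+ 3 = 6 * J%:R ^+ 3 + 6 * J%:R ^+ 3 + 3 * J%:R ^+ 3 + J%:R ^+ 3 :> C by ring.
  rewrite lerD2r; apply: lerD; first apply: lerD.
  - by rewrite -[leLHS]mulr1 ler_wpM2l // -[1](expr0 (J%:R : C)) J3.
  - by rewrite ler_wpM2l // -[leLHS]expr1 J3.
  - by rewrite ler_wpM2l // J3.
have : M%:R * X <= \sum_(l < M) expR (- (nu * t l)) * (G * (3^-1 + 2 / 3 * expR (- (12 / om2 * t l))) + H).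
  rewrite -lecR rmorph_sum; apply: (@le_trans _ _ `|(M%:R * X)%:C|).
    by apply: real_ler_norm; apply/complex_realP; exists (M%:R * X).
  rewrite -(circle_sum_fourier p r pw cJ JM).
  apply: le_trans (ler_norm_sum _ _ _) _.
  by apply: ler_sum => l _; exact: key.
move=> hX.
rewrite -(ler_pM2l (_ : 0 < M%:R)) ?ltr0n //; apply: le_trans hX _.
apply: (@le_trans _ _ (\sum_(l < M) (G * (3^-1 * expR (- (nu * t l)) +
     2 / 3 * expR (- ((nu + 12 / om2) * t l))) + H))).
  apply: ler_sum => l _; rewrite mulrDr; apply: lerD.
    rewrite mulrCA ler_wpM2l // [(nu + _) * _]mulrDl opprD expRD.
    by rewrite le_eqVlt; apply/orP; left; apply/eqP; ring.
  rewrite -[leRHS]mul1r ler_wpM2r // expR_le1 oppr_le0 mulr_ge0 ?(ltW nu0) //.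
  by rewrite subr_ge0; have /andP[] := cos2half_bound (z1 l).
rewrite big_split /= sumr_const card_ord -[H *+ M]mulr_natl [leRHS]mulrDr lerD2r.
rewrite -mulr_sumr [leRHS]mulrCA ler_wpM2l // big_split /= -!mulr_sumr mulrDr.
apply: lerD; rewrite [leRHS]mulrCA ler_wpM2l //; exact: sum_expR_circle.
Qed.

Lemma cvg_cubes_geometric (r : R) : 0 < r < 1 ->
  ((fun J : nat => J%:R ^+ 3 * r ^+ J) @ \oo --> (0 : R))%classic.
Proof.
move=> /andP[r0 r1]; pose th := - ln r.
have th0 : 0 < th by rewrite oppr_gt0 ln_lt0 // r0.
(* From x^4 / 24 <= exp x at x = th J, and J / (J + 1) >= 1/2. *)
pose K := 48 / th ^+ 4.
have K0 : 0 <= K by rewrite divr_ge0 // exprn_ge0 // ltW.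
apply: (@squeeze_cvgr _ _ _ _ (fun=> 0) (fun J => K * @harmonic R J)).
- apply: nearW => J; rewrite mulr_ge0 ?exprn_ge0 ?(ltW r0) //=.
  have [->|J0] := posnP J; first by rewrite expr0n /= mul0r mulr_ge0 // invr_ge0.
  have J0' : 0 < J%:R :> R by rewrite ltr0n.
  have -> : r ^+ J = (expR (th * J%:R))^-1.
    by rewrite expRM_natr -exprVn /th expRN invrK lnK.
  have h : (th * J%:R) ^+ 4 / 24 <= expR (th * J%:R).
    apply: le_trans (@expR_ge1Dxn R (th * J%:R) 3 _); last by rewrite mulr_ge0 ?ltW.
    by rewrite lerDr.
  rewrite ler_pdivrMr ?expR_gt0 //; apply: le_trans (ler_wpM2l _ h); last first.
    by rewrite mulr_ge0 // invr_ge0.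
  rewrite /K /harmonic /= -[J.+1%:R]natr1.
  have -> : 48 / th ^+ 4 / (J%:R + 1) * ((th * J%:R) ^+ 4 / 24) =
     J%:R ^+ 3 * (2 * J%:R / (J%:R + 1)).
    by field; rewrite (gt_eqF th0) gt_eqF // ltr_pwDr.
  rewrite -[leLHS]mulr1 ler_wpM2l ?exprn_ge0 // ler_pdivlMr ?mul1r ?ltr_pwDr //.
  have : 1 <= J%:R :> R by rewrite ler1n.
  lra.
- exact: cvg_cst.
- by rewrite -[0](mulr0 K); apply: cvgMr; exact: cvg_harmonic.
Qed.

(** The sum of the tilted cubes does not depend on the truncations, which are
    sent to infinity. *)
Lemma cubes_fourier (c s0 s1 : nat) (p r om2 nu : R) :
  0 < p < 1 -> 0 < r < 1 -> om2 = (1 - r) ^+ 2 / r ->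
  nu = 2 * c%:R * (p * (1 - p)) -> (0 < c)%N ->
  \sum_(n < c.+1) bin_pmf c p n * cubes r (n + s0 - s1) <=
    (6 + om2) / om2 ^+ 2 *
    (3^-1 * ibound nu + 2 / 3 * ibound (nu + 12 / om2)).
Proof.
move=> p01 r01 omE nuE c0.
set X := \sum_(n < _) _; set G := (6 + om2) / om2 ^+ 2.
pose u (J : nat) : R := G *
    (3^-1 * (ibound nu + pois_tail nu J) +
     2 / 3 * (ibound (nu + 12 / om2) + pois_tail (nu + 12 / om2) J)) +
    16 / (1 - r) ^+ 4 * (J%:R ^+ 3 * r ^+ J).
have cu : (u @ \oo --> G * (3^-1 * (ibound nu + 0) +
     2 / 3 * (ibound (nu + 12 / om2) + 0)) + 16 / (1 - r) ^+ 4 * 0)%classic.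
  apply: cvgD; last by apply: cvgMr; exact: cvg_cubes_geometric.
  apply: cvgMr; apply: cvgD; apply: cvgMr; apply: cvgD;
    by [exact: cvg_cst | exact: pois_tail_cvg].
rewrite mulr0 !addr0 in cu.
apply: (ler_cvg_to (cvg_cst X) cu); near=> J.
apply: (cubes_fourier_truncated _ _ p01 r01 omE nuE c0).
by near: J; exact: nbhs_infty_gt.
Unshelve. all: by end_near. Qed.

End Fourier.

(** * Third-moment tails of the binomial law *)

Section BinomialTails.
Variable R : realType.
Implicit Types (p pt x y g a om : R) (c n : nat).

Definition pcube x : R := Num.max 0 x ^+ 3.

Lemma pcube_ge0 x : 0 <= pcube x.
Proof. by rewrite exprn_ge0 // le_max lexx. Qed.

Definition bin_cube c p x : R := \sum_(n < c.+1) bin_pmf c p n * pcube (n%:R - x).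

(** The relative entropy of the Bernoulli(pt) law with respect to the
    Bernoulli(p) law. *)
Definition kl pt p : R := pt * ln (pt / p) + (1 - pt) * ln ((1 - pt) / (1 - p)).

(** Bernstein's form of the exponent: the two logarithms are bounded below by
    their Pade approximant, and the sum of the two bounds is exactly this
    fraction. *)
Lemma kl_ge p pt : 0 < p < 1 -> 0 < pt < 1 ->
  (pt - p) ^+ 2 / (2 * (p + (pt - p) / 3) * (1 - p - (pt - p) / 3)) <= kl pt p.
Proof.
move=> /andP[p0 p1] /andP[pt0 pt1].
have term (a b : R) : 0 < a -> 0 < b -> b - a + 3 * (b - a) ^+ 2 / (2 * (b + 2 * a)) <= b * ln (b / a).
  move=> a0 b0; have := ln_ge_pade (divr_gt0 b0 a0).
  move=> /(ler_wpM2l (ltW b0)); apply: le_trans; rewrite le_eqVlt; apply/orP; left.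
  apply/eqP; field; rewrite (gt_eqF a0) (gt_eqF b0) !gt_eqF //=; lra.
have h1 := term p pt p0 pt0.
have h2 := term (1 - p) (1 - pt) _ _; rewrite !subr_gt0 in h2.
have {}h2 := h2 p1 pt1.
apply: le_trans (lerD h1 h2); rewrite le_eqVlt; apply/orP; left.
by apply/eqP; field; rewrite !gt_eqF //=; lra.
Qed.

(** The exponential change of measure from Bin(c, p) to Bin(c, pt) has density
    proportional to the (- n)-th power of this ratio at n. *)
Definition tilt p pt : R := p * (1 - pt) / ((1 - p) * pt).

Lemma tilt_bound p pt : 0 < p -> p < pt -> pt < 1 -> 0 < tilt p pt < 1.
Proof.
move=> p0 ppt pt1; have pt0 : 0 < pt by apply: lt_trans ppt.
have p1 : p < 1 by apply: lt_trans pt1.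
have d0 : 0 < (1 - p) * pt by rewrite mulr_gt0 ?subr_gt0.
by rewrite divr_gt0 ?mulr_gt0 ?subr_gt0 //= ltr_pdivrMr // mul1r; lra.
Qed.

Lemma bin_pmf_tilt c p pt n : 0 < p -> p < pt -> pt < 1 -> (n <= c)%N ->
  bin_pmf c p n = ((1 - p) / (1 - pt)) ^+ c * tilt p pt ^+ n * bin_pmf c pt n.
Proof.
move=> p0 ppt pt1 nc; have pt0 : pt != 0 by rewrite gt_eqF //; apply: lt_trans ppt.
have p1 : 1 - p != 0 by rewrite gt_eqF // subr_gt0; apply: lt_trans pt1.
have q0 : 1 - pt != 0 by rewrite gt_eqF // subr_gt0.
rewrite /bin_pmf /tilt -(subnK nc) addnK; move: (c - n)%N 'C(_, _)%:R => k b.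
rewrite !(expr_div_n, exprD, exprMn).
have h1 : (1 - p) ^+ n != 0 by rewrite expf_neq0.
have h2 : (1 - pt) ^+ n != 0 by rewrite expf_neq0.
have h3 : (1 - pt) ^+ k != 0 by rewrite expf_neq0.
have h4 : pt ^+ n != 0 by rewrite expf_neq0.
move: ((1 - p) ^+ n) ((1 - pt) ^+ n) ((1 - pt) ^+ k) (pt ^+ n) h1 h2 h3 h4 => a1 a2 a3 a4 h1 h2 h3 h4.
by field; rewrite h1 h2 h3 h4.
Qed.

Lemma sum_bin_pmf c p : \sum_(n < c.+1) bin_pmf c p n = 1.
Proof.
have := exprDn (1 - p) p c; rewrite subrK expr1n => ->; apply: eq_bigr => n _.
by rewrite /bin_pmf -mulr_natl; ring.
Qed.

Lemma tilt_kl c p pt : 0 < p -> p < pt -> pt < 1 ->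
  ((1 - p) / (1 - pt)) ^+ c * expR (c%:R * pt * ln (tilt p pt)) = expR (- (c%:R * kl pt p)).
Proof.
move=> p0 ppt pt1; have pt0 : 0 < pt by apply: lt_trans ppt.
have p1 : 0 < 1 - p by rewrite subr_gt0; apply: lt_trans pt1.
have q0 : 0 < 1 - pt by rewrite subr_gt0.
have e : (1 - p) / (1 - pt) = expR (ln ((1 - p) / (1 - pt))).
  by rewrite lnK // posrE divr_gt0.
rewrite e -expRM_natl -expRD; congr expR; rewrite /kl /tilt.
by rewrite !(ln_div, lnM) ?posrE ?mulr_gt0 //; ring.
Qed.

(** Tilting to mean c pt, the cube is compared with the exponential that
    touches it from above; s is chosen so that the point of contact is c pt. *)
Lemma bin_cube_plain c p pt : 0 < p -> p < pt -> pt < 1 -> (0 < c)%N ->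
  exists2 s, s < c%:R * pt &
    bin_cube c p s <= expR (- (c%:R * kl pt p)) * (c%:R * pt - s) ^+ 3.
Proof.
move=> p0 ppt pt1 c0; have pt0 : 0 < pt by apply: lt_trans ppt.
have /andP[r0 r1] := tilt_bound p0 ppt pt1; set r := tilt p pt in r0 r1.
pose th := - ln r; have th0 : 0 < th by rewrite oppr_gt0 ln_lt0 // r0.
exists (c%:R * pt - 3 / th); first by rewrite gtrBl divr_gt0.
set s := _ - _; have -> : c%:R * pt - s = 3 / th by rewrite /s; ring.
have cub v : pcube v <= (3 / th) ^+ 3 * expR (th * v - 3).
  have -> : (3 / th) ^+ 3 * expR (th * v - 3) = ((3 / th) * expR (th * v / 3 - 1)) ^+ 3.
    by rewrite [in RHS]exprMn -expRM_natr; congr (_ * expR _); field.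
  apply: lerXn2r; rewrite ?nnegrE.
  - by rewrite le_max lexx.
  - by rewrite mulr_ge0 ?expR_ge0 ?divr_ge0 // ltW.
  rewrite ge_max; apply/andP; split.
    by rewrite mulr_ge0 ?expR_ge0 // divr_ge0 // ltW.
  have h := expR_ge1Dx (th * v / 3 - 1).
  rewrite [leLHS](_ : v = 3 / th * (1 + (th * v / 3 - 1))); last by field; rewrite gt_eqF.
  by rewrite ler_wpM2l ?divr_ge0 ?(ltW th0).
apply: (@le_trans _ _ (\sum_(n < c.+1) (3 / th) ^+ 3 * (expR (- (c%:R * kl pt p)) * bin_pmf c pt n))).
  apply: ler_sum => n _; rewrite (bin_pmf_tilt p0 ppt pt1) -/r; last by rewrite -ltnS.
  apply: le_trans (ler_wpM2l _ (cub _)) _.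
    rewrite !mulr_ge0 ?(exprn_ge0, invr_ge0, subr_ge0, ltW r0, ltW pt0) //.
    - by rewrite divr_ge0 // subr_ge0 ltW // (lt_trans ppt).
    - exact: ltW.
  rewrite -(tilt_kl c p0 ppt pt1) -/r.
  have -> : r ^+ n = expR (- (th * n%:R)).
    by rewrite -mulNr expRM_natr opprK lnK.
  have -> : c%:R * pt * ln r = - (th * (c%:R * pt)) by rewrite /th; ring.
  rewrite le_eqVlt; apply/orP; left; apply/eqP.
  have -> : th * (n%:R - s) - 3 = th * n%:R - th * (c%:R * pt).
    by rewrite /s; field; rewrite gt_eqF.
  rewrite expRB expRN [in RHS]expRN; field.
  by rewrite !gt_eqF ?expR_gt0 ?subr_gt0.
by rewrite -mulr_sumr -mulr_sumr sum_bin_pmf mulr1 mulrC.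
Qed.

(** The exponential and e^3 x^3 / 27 touch at x = 3; to the right of it their
    ratio is at most a Gaussian factor. *)
Lemma expR_cube_le x g : 0 <= x - 3 <= g ->
  expR x <= expR 3 / 27 * x ^+ 3 * expR (g ^+ 2 / 6).
Proof.
move=> /andP[x3 xg]; pose h := x - 3.
have -> : expR x = expR 3 * expR h by rewrite -expRD /h; congr expR; ring.
have -> : expR 3 / 27 * x ^+ 3 * expR (g ^+ 2 / 6) =
    expR 3 * ((1 + h / 3) ^+ 3 * expR (g ^+ 2 / 6)) by rewrite /h; field.
rewrite ler_wpM2l ?expR_ge0 //.
have h0 : 0 <= h by [].
have y0 : 0 < 1 + h / 3 by rewrite ltr_wpDr ?divr_ge0.
have -> : (1 + h / 3) ^+ 3 = expR (3 * ln (1 + h / 3)).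
  by rewrite expRM_natl lnK // posrE.
rewrite -expRD ler_expR.
have hg : h ^+ 2 <= g ^+ 2 by rewrite lerXn2r // ?nnegrE // (le_trans h0).
have : h / 3 - (h / 3) ^+ 2 / 2 <= ln (1 + h / 3).
  apply: le_trans (ln_ge_pade y0); rewrite -subr_ge0.
  have : 0 <= h / 3 by rewrite divr_ge0.
  move: (h / 3) => y yge0.
  have -> : (1 + y - 1) * (5 * (1 + y) + 1) / (2 * (1 + y) * (1 + y + 2)) -
    (y - y ^+ 2 / 2) = y ^+ 3 * (2 + y) / (2 * (1 + y) * (1 + y + 2)).
    by field; rewrite !gt_eqF //=; lra.
  have y2 : 0 <= 2 + y by lra.
  have y1 : 0 <= 1 + y by lra.
  have y3 : 0 <= 1 + y + 2 by lra.
  by rewrite divr_ge0 // mulr_ge0 // ?exprn_ge0 // mulr_ge0.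
lra.
Qed.

(** The value e^3 / 27 of the contact, times the constants of norm_cubes_le and
    of ibound. *)
Definition sharp_cst : R := expR 3 * Num.sqrt (36 / 113) / 9.

(** The sharp factor: one term for each node of the quadrature. *)
Definition psi a : R :=
  sharp_cst * (3^-1 * (Num.sqrt a)^-1 + 2 / 3 * (Num.sqrt (a + 3))^-1).

Lemma ibound_le a (a' : R) om : 0 < a -> a <= a' -> 0 < om ->
  ibound (4 * a' / om ^+ 2) <=
    om / 2 * Num.sqrt (36 / 113) * (Num.sqrt a')^-1 * expR (om ^+ 2 * (57 / 80 / a)).
Proof.
move=> a0 aa' om0; have a'0 : 0 < a' by apply: lt_le_trans aa'.
rewrite /ibound.
have -> : 36 / 113 / (4 * a' / om ^+ 2) = (om / 2) ^+ 2 * (36 / 113) / a'.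
  by field; rewrite !gt_eqF.
rewrite sqrtrM; last by rewrite mulr_ge0 ?sqr_ge0 // divr_ge0.
rewrite sqrtrM ?sqr_ge0 // sqrtr_sqr ger0_norm; last by rewrite divr_ge0 // ltW.
rewrite sqrtrV; last exact: ltW.
apply: ler_wpM2l; first by rewrite !mulr_ge0 ?sqrtr_ge0 ?invr_ge0 ?sqrtr_ge0 ?divr_ge0 // ltW.
apply: le_trans (expR_ge1Dx _); rewrite lerD2l.
have -> : 57 / 20 / (4 * a' / om ^+ 2) = om ^+ 2 * (57 / 80 / a').
  by field; rewrite !gt_eqF.
by rewrite ler_wpM2l ?sqr_ge0 // ler_wpM2l // lef_pV2 ?posrE.
Qed.

(** The threshold is an integer close to the optimal c pt - 3 / om, so that
    cubes_fourier applies; moving it by less than 1 costs a factor exp (om2 /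
    6). *)
Lemma bin_cube_sharp c p pt a (om2 : R) : 0 < p -> p < pt -> pt < 1 -> (0 < c)%N ->
  a = c%:R * (pt - p) ^+ 2 / (2 * p * (1 - p)) ->
  om2 = (pt - p) ^+ 2 / (p * (1 - p) * pt * (1 - pt)) ->
  exists2 s, s < c%:R * pt &
    bin_cube c p s <= expR (- (c%:R * kl pt p)) *
      (psi a * expR (om2 * (1 / 3 + 57 / 80 / a))) * (c%:R * pt - s) ^+ 3.
Proof.
move=> p0 ppt pt1 c0 aE omE; have pt0 : 0 < pt by apply: lt_trans ppt.
have p1 : p < 1 by apply: lt_trans pt1.
have q0 : 0 < 1 - p by rewrite subr_gt0.
have qt0 : 0 < 1 - pt by rewrite subr_gt0.
have d0 : 0 < pt - p by rewrite subr_gt0.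
have c0' : 0 < c%:R :> R by rewrite ltr0n.
have r01 := tilt_bound p0 ppt pt1; have /andP[r0 r1] := r01.
set r := tilt p pt in r01 r0 r1.
have om20 : 0 < om2 by rewrite omE divr_gt0 ?exprn_gt0 ?mulr_gt0.
have a0 : 0 < a by rewrite aE divr_gt0 ?mulr_gt0 ?exprn_gt0.
pose om := Num.sqrt om2; have om0 : 0 < om by rewrite sqrtr_gt0.
have omK : om ^+ 2 = om2 by rewrite sqr_sqrtr // ltW.
have om2r : om2 = (1 - r) ^+ 2 / r.
  by rewrite omE /r /tilt; field; rewrite !gt_eqF //; lra.
pose th := - ln r; have th0 : 0 < th by rewrite oppr_gt0 ln_lt0 // r0.
have thom : th <= om.
  have v0 : 0 < Num.sqrt r by rewrite sqrtr_gt0.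
  have vK : Num.sqrt r ^+ 2 = r by rewrite sqr_sqrtr // ltW.
  have v1 : Num.sqrt r <= 1 by rewrite -sqrtr1 ler_wsqrtr // ltW.
  have := ln_inv_le v0 v1; rewrite mulr_natl -lnXn // vK -/th => /le_trans; apply.
  rewrite -(@ler_pXn2r _ 2) // ?nnegrE ?(ltW om0) //; last first.
    by rewrite subr_ge0 (le_trans v1) // invf_ge1.
  rewrite omK om2r -[in leRHS]vK; move: v0; set v := Num.sqrt r => v0.
  by rewrite le_eqVlt; apply/orP; left; apply/eqP; field; rewrite gt_eqF.
set m := c%:R * pt.
(* The threshold z may be negative; it is written as a difference of naturals. *)
pose z := Num.floor (m - 3 / om).
have [s0 [s1 zE]] : exists s0 s1 : nat, z%:~R = s1%:R - s0%:R :> R.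
  case: z => k; first by exists 0%N, k; rewrite subr0.
  by exists k.+1, 0%N; rewrite NegzE rmorphN /= sub0r.
pose s : R := z%:~R; pose f := m - s.
have f1 : 3 / om <= f.
  by have := floor_le (m - 3 / om); rewrite -/z -/s /f; lra.
have f2 : f <= 3 / om + 1.
  by have := floorD1_gt (m - 3 / om); rewrite -/z intrD -/s /f; lra.
have f0 : 0 < f by apply: lt_le_trans f1; rewrite divr_gt0.
exists s; first by rewrite -subr_gt0 -/f.
set Z := ((1 - p) / (1 - pt)) ^+ c.
have Z0 : 0 <= Z by rewrite exprn_ge0 // divr_ge0 // ltW.
have rE (k : nat) : r ^+ k = expR (- (th * k%:R)).
  by rewrite -mulNr expRM_natr opprK lnK.
have cubE : bin_cube c p s =
    Z * expR (- (th * s)) * \sum_(n < c.+1) bin_pmf c pt n * cubes r (n + s0 - s1).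
  rewrite mulr_sumr; apply: eq_bigr => n _.
  rewrite (bin_pmf_tilt p0 ppt pt1) -/r -/Z; last by rewrite -ltnS.
  suff H : pcube (n%:R - s) * r ^+ n = expR (- (th * s)) * cubes r (n + s0 - s1).
    rewrite (_ : _ * pcube _ = Z * (pcube (n%:R - s) * r ^+ n) * bin_pmf c pt n); last by ring.
    by rewrite H; ring.
  have sE : s = s1%:R - s0%:R by [].
  have [le|lt] := leqP s1 (n + s0).
    have nE : n%:R - s = (n + s0 - s1)%:R.
      by rewrite sE natrB // natrD; ring.
    rewrite /cubes nE /pcube max_r // mulrCA; congr (_ * _).
    rewrite !rE -expRD; congr expR.
    by rewrite -[n%:R](subrK s) nE; ring.
  have -> : pcube (n%:R - s) = 0.
    rewrite /pcube max_l ?expr0n // sE opprB addrA subr_le0 -natrD ler_nat.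
    exact: ltnW.
  have -> : (n + s0 - s1 = 0)%N by apply/eqP; rewrite subn_eq0 ltnW.
  by rewrite /cubes expr0n /= !mul0r mulr0.
have tiltE : Z * expR (- (th * s)) = expR (- (c%:R * kl pt p)) * expR (th * f).
  rewrite -(tilt_kl c p0 ppt pt1) -/r -/Z -[RHS]mulrA -expRD; congr (_ * expR _).
  by rewrite /f -/m /th; ring.
have pt01 : 0 < pt < 1 by rewrite pt0.
have four := cubes_fourier s0 s1 pt01 r01 om2r (erefl _) c0.
have nuE : 2 * c%:R * (pt * (1 - pt)) = 4 * a / om ^+ 2.
  by rewrite omK omE aE; field; rewrite !gt_eqF.
have nu2E : 4 * a / om ^+ 2 + 12 / om2 = 4 * (a + 3) / om ^+ 2.
  by rewrite omK; field; rewrite gt_eqF.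
rewrite nuE nu2E in four.
rewrite cubE tiltE -[leLHS]mulrA -[leRHS]mulrA ler_wpM2l ?expR_ge0 //.
apply: le_trans (ler_wpM2l (expR_ge0 _) four) _.
have E1 : expR (th * f) <= expR 3 / 27 * (om * f) ^+ 3 * expR (om2 / 6).
  rewrite -omK; apply: (@le_trans _ _ (expR (om * f))).
    by rewrite ler_expR ler_wpM2r // ltW.
  have om3 : om * (3 / om) = 3 by field; rewrite gt_eqF.
  apply: expR_cube_le; apply/andP; split.
    by have := ler_wpM2l (ltW om0) f1; rewrite om3; lra.
  have om4 : om * (3 / om + 1) = 3 + om by rewrite mulrDr om3 mulr1.
  by have := ler_wpM2l (ltW om0) f2; rewrite om4; lra.
have E2 : (6 + om2) / om2 ^+ 2 <= 6 / om ^+ 4 * expR (om2 / 6).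
  have -> : 6 / om ^+ 4 = 6 / om2 ^+ 2 by rewrite -omK -exprM.
  have -> : (6 + om2) / om2 ^+ 2 = 6 / om2 ^+ 2 * (1 + om2 / 6) by field; rewrite gt_eqF.
  by rewrite ler_wpM2l ?expR_ge1Dx // divr_ge0 // exprn_ge0 // ltW.
have I1 := ibound_le a0 (lexx a) om0.
have a3 : a <= a + 3 by rewrite lerDl.
have I2 := ibound_le a0 a3 om0.
set E := expR _ in I1 I2.
set S := 3^-1 * _ + _ in four *.
have S_le : S <= om / 2 * Num.sqrt (36 / 113) *
    (3^-1 * (Num.sqrt a)^-1 + 2 / 3 * (Num.sqrt (a + 3))^-1) * E.
  have k1 : 0 <= 3^-1 :> R by rewrite invr_ge0.
  have k2 : 0 <= 2 / 3 :> R by rewrite divr_ge0.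
  rewrite /S; apply: le_trans (lerD (ler_wpM2l k1 I1) (ler_wpM2l k2 I2)) _.
  by rewrite le_eqVlt; apply/orP; left; apply/eqP; ring.
have ib0 b : 0 < b -> 0 <= ibound b.
  move=> /ltW b0; have c2 : 0 <= 57 / 20 :> R by rewrite divr_ge0.
  by rewrite /ibound mulr_ge0 ?sqrtr_ge0 // addr_ge0 // divr_ge0.
have S0 : 0 <= S.
  have b1 : 0 < 4 * a / om ^+ 2 by rewrite divr_gt0 ?mulr_gt0 ?exprn_gt0.
  have b2 : 0 < 4 * (a + 3) / om ^+ 2.
    by rewrite divr_gt0 ?exprn_gt0 // mulr_gt0 // addr_gt0.
  by rewrite /S addr_ge0 // mulr_ge0 ?invr_ge0 ?divr_ge0 // ib0.
have G0 : 0 <= (6 + om2) / om2 ^+ 2 by rewrite divr_ge0 ?exprn_ge0 ?addr_ge0 // ltW.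
apply: le_trans (ler_pM (expR_ge0 _) _ E1 (ler_pM G0 S0 E2 S_le)) _.
  by rewrite mulr_ge0.
rewrite /psi /sharp_cst.
have -> : expR (om2 * (1 / 3 + 57 / 80 / a)) = expR (om2 / 6) * expR (om2 / 6) * E.
  rewrite /E omK -!expRD; congr expR; field; by rewrite gt_eqF.
rewrite le_eqVlt; apply/orP; left; apply/eqP.
by rewrite -/f; field; rewrite !gt_eqF ?sqrtr_gt0 ?addr_gt0.
Qed.

End BinomialTails.

(** * The spectral theorem for real symmetric matrices *)

Section Spectral.
Variable R : realType.

(** An eigenvalue of the complexified matrix is real, because that matrix is
    hermitian, and it is a root of the real characteristic polynomial. *)
Lemma symmetric_eigenvalue n (W : 'M[R]_n.+1) : W^T = W -> exists r : R, eigenvalue W r.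
Proof.
move=> Ws; pose WC := map_mx (real_complex R) W : 'M[R[i]]_n.+1.
have WCh : WC \is hermsymmx.
  apply: realsym_hermsym.
    apply/is_hermitianmxP; rewrite expr0 scale1r map_mx_id //.
    by rewrite /WC map_trmx Ws.
  by apply/mxOverP => i j; rewrite mxE; apply/complex_realP; exists (W i j).
have /hermitian_normalmx/orthomx_spectralP WE := WCh.
have /mxOverP/(_ 0 0)/complex_realP[r rE] := hermitian_spectral_diag_real WCh.
exists r; rewrite eigenvalue_root_char -(fmorph_root (real_complex R)) map_char_poly.
rewrite -eigenvalue_root_char; apply/eigenvalueP.
exists (row 0 (spectralmx WC)).
  rewrite -/WC [in X in _ *m X]WE -row_mul !mulmxA mulmxV ?spectral_unit // mul1mx.
  by rewrite row_mul row_diag_mx -scalemxAl -rowE /= rE.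
apply/eqP => h; have := spectral_unitarymx WC.
move=> /row_unitarymxP /(_ 0 0); rewrite h eqxx /= => /eqP.
by rewrite linear0l eq_sym oner_eq0.
Qed.

(** The rows of Q are the eigenvectors. *)
Definition eigenbasis n (W Q : 'M[R]_n) (d : 'rV[R]_n) : Prop :=
  Q *m Q^T = 1%:M /\ W = Q^T *m diag_mx d *m Q.

(** The reflection that exchanges v and the first basis vector. *)
Lemma householder n (v : 'rV[R]_n.+1) : v *m v^T = 1%:M ->
  exists2 H : 'M[R]_n.+1, H *m H^T = 1%:M & row 0 H = v.
Proof.
move=> v1; pose e : 'rV[R]_n.+1 := delta_mx 0 0; pose w := v - e.
have ee : e *m e^T = 1%:M.
  by rewrite trmx_delta mul_delta_mx; apply/matrixP=> i j; rewrite !mxE !ord1.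
have ve : v *m e^T = (v 0 0)%:M.
  by rewrite trmx_delta -colE; apply/matrixP=> i j; rewrite !mxE !ord1.
have ev : e *m v^T = (v 0 0)%:M.
  by rewrite -[LHS]trmxK trmx_mul trmxK ve tr_scalar_mx.
have ww : w *m w^T = (2 * (1 - v 0 0))%:M.
  rewrite /w linearB /= mulmxBl !mulmxBr v1 ve ev ee.
  by apply/matrixP=> i j; rewrite !mxE !ord1 /=; ring.
have wv : v *m w^T = (1 - v 0 0)%:M.
  by rewrite /w linearB /= mulmxBr v1 ve; apply/matrixP=> i j; rewrite !mxE !ord1 /=; ring.
have we : e *m w^T = - (1 - v 0 0)%:M.
  by rewrite /w linearB /= mulmxBr ev ee; apply/matrixP=> i j; rewrite !mxE !ord1 /=; ring.
have [w0|wn0] := eqVneq (v 0 0) 1.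
  exists 1%:M; first by rewrite trmx1 mulmx1.
  have : w *m w^T = 0 by rewrite ww w0 subrr mulr0 raddf0.
  move=> /matrixP/(_ 0 0); rewrite !mxE => h.
  have {}h : forall j, w 0 j = 0.
    move=> j; apply/eqP; rewrite -sqrf_eq0 -[_ == 0]orbF; move/eqP: h.
    rewrite psumr_eq0; last by move=> i _; rewrite [w^T _ _]mxE -expr2 sqr_ge0.
    by move=> /allP/(_ j); rewrite mem_index_enum [w^T _ _]mxE -expr2 => /(_ isT) /= ->.
  rewrite rowE mulmx1.
  apply/rowP=> j; have := h j; rewrite /w !mxE => /eqP; rewrite subr_eq0 => /eqP ->.
  by [].
pose b := (1 - v 0 0)^-1; have b0 : 1 - v 0 0 != 0 by rewrite subr_eq0 eq_sym.
pose H := 1%:M - b *: (w^T *m w).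
have Hs : H^T = H.
  by rewrite /H linearB /= linearZ /= trmx1 trmx_mul trmxK.
exists H.
  have XX : (w^T *m w) *m (w^T *m w) = (2 * (1 - v 0 0)) *: (w^T *m w).
    by rewrite mulmxA -[w^T *m w *m w^T]mulmxA ww mul_mx_scalar -scalemxAl.
  rewrite Hs /H; move: (w^T *m w) XX => X XX.
  rewrite mulmxBr mulmx1 mulmxBl mul1mx -scalemxAr -scalemxAl XX !scalerA.
  have -> : b * b * (2 * (1 - v 0 0)) = b + b by rewrite /b; field.
  by rewrite scalerDl; apply/matrixP => i j; rewrite !mxE; ring.
rewrite rowE -/e /H mulmxBr mulmx1 -scalemxAr mulmxA we mulNmx mul_scalar_mx.
by rewrite scalerN scalerA mulVf // scale1r opprK /w addrC subrK.
Qed.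

(** Deflation: a reflection moves a unit eigenvector to the first basis vector,
    and the rest of the matrix is symmetric of smaller size. *)
Lemma spectral_theorem n (W : 'M[R]_n) : W^T = W -> exists Q d, eigenbasis W Q d.
Proof.
elim: n W => [|n IH] W Ws.
  by exists 1%:M, 0; split; apply/matrixP => -[].
have [r /eigenvalueP[v0 vE vn0]] := symmetric_eigenvalue Ws.
have nv : 0 < (v0 *m v0^T) 0 0.
  rewrite mxE lt_def; apply/andP; split.
    apply: contra vn0; rewrite psumr_eq0; last by move=> i _; rewrite [v0^T _ _]mxE -expr2 sqr_ge0.
    move=> /allP h; apply/eqP/rowP => j; apply/eqP; rewrite mxE -sqrf_eq0.
    by have := h j; rewrite mem_index_enum [v0^T _ _]mxE -expr2 => /(_ isT).
  by apply: sumr_ge0 => i _; rewrite [v0^T _ _]mxE -expr2 sqr_ge0.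
pose v := (Num.sqrt ((v0 *m v0^T) 0 0))^-1 *: v0.
have v1 : v *m v^T = 1%:M.
  rewrite /v linearZ /= -scalemxAr -scalemxAl scalerA -expr2 exprVn sqr_sqrtr ?ltW //.
  by apply/matrixP => i j; rewrite !ord1 [LHS]mxE mulVf ?gt_eqF // mxE.
have vW : v *m W = r *: v by rewrite /v -scalemxAl vE scalerA mulrC -scalerA.
have [H H1 Hv] := householder v1.
have HT1 : H^T *m H = 1%:M by apply: mulmx1C.
pose M : 'M[R]_(1 + n) := H *m W *m H^T.
have Ms : M^T = M by rewrite /M !trmx_mul trmxK Ws mulmxA.
have M0 j : M 0 j = (r *: (delta_mx 0 0 : 'rV[R]_(1 + n))) 0 j.
  have <- : (row 0 M) 0 j = M 0 j by exact: mxE.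
  rewrite /M !row_mul Hv vW -scalemxAl -Hv -row_mul H1.
  by rewrite [row 0 1%:M]rowE mulmx1.
have Ml j : M (lshift n 0) j = r *+ (j == lshift n 0).
  have -> : lshift n (0 : 'I_1) = 0 by apply/val_inj.
  by rewrite M0 !mxE eqxx /= mulr_natr.
have Mb : M = block_mx r%:M 0 0 (drsubmx M).
  rewrite -[LHS]submxK; congr block_mx; apply/matrixP => i j; rewrite ?ord1.
  - by rewrite mxE [LHS]mxE Ml mxE !eqxx.
  - by rewrite mxE [LHS]mxE Ml mxE.
  - by rewrite mxE [LHS]mxE -Ms mxE Ml mxE.
have [|Q [d [Q1 WE]]] := IH (drsubmx M).
  by rewrite trmx_drsub Ms.
pose K : 'M[R]_(1 + n) := block_mx 1%:M 0 0 Q.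
have K1 : K *m K^T = 1%:M.
  rewrite /K tr_block_mx mulmx_block !trmx0 !trmx1 !mulmx0 !mul0mx !mulmx1 !addr0 !add0r Q1.
  by rewrite -scalar_mx_block.
exists (K *m H), (row_mx r%:M d : 'rV[R]_(1 + n)); split.
  by rewrite trmx_mul mulmxA -[K *m H *m H^T]mulmxA H1 mulmx1.
suff E : W = (K *m H)^T *m diag_mx (row_mx r%:M d : 'rV[R]_(1 + n)) *m (K *m H) :> 'M[R]_(1 + n) by exact: E.
rewrite diag_mx_row trmx_mul.
have -> : H^T *m K^T *m block_mx (diag_mx r%:M) 0 0 (diag_mx d) *m (K *m H) =
   H^T *m (K^T *m block_mx (diag_mx r%:M) 0 0 (diag_mx d) *m K) *m H.
  by rewrite !mulmxA.
have -> : K^T *m block_mx (diag_mx r%:M) 0 0 (diag_mx d) *m K = M.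
  rewrite /K tr_block_mx !mulmx_block !trmx0 !trmx1 !(mulmx0, mul0mx, mulmx1, mul1mx, addr0, add0r).
  rewrite -WE [RHS]Mb; congr block_mx.
  by apply/matrixP => i j; rewrite !ord1 !mxE /= .
by rewrite /M !mulmxA HT1 mul1mx -mulmxA HT1 mulmx1.
Qed.

End Spectral.

(** * Eigenvalues under a rank-one perturbation *)

Section RankOne.
Variable R : realType.

Lemma mul_tr00 n (u v : 'rV[R]_n) : (u *m v^T) 0 0 = \sum_i u 0 i * v 0 i.
Proof. by rewrite mxE; apply: eq_bigr => i _; rewrite [v^T _ _]mxE. Qed.

(** The squared distance between q and the image of p under the orthogonal
    matrix is nonnegative. *)
Lemma orthogonal_bilinear_le n (o : 'M[R]_n) (p q : 'I_n -> R) : o *m o^T = 1%:M ->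
  \sum_i \sum_j p i * q j * o i j <= (\sum_i p i ^+ 2 + \sum_j q j ^+ 2) / 2.
Proof.
move=> o1; pose P : 'rV[R]_n := \row_i p i; pose Q : 'rV[R]_n := \row_i q i.
have : 0 <= ((P *m o - Q) *m (P *m o - Q)^T) 0 0.
  by rewrite mul_tr00; apply: sumr_ge0 => i _; rewrite -expr2 sqr_ge0.
rewrite linearB /= mulmxBl !mulmxBr.
have -> : P *m o *m (P *m o)^T = P *m P^T.
  by rewrite trmx_mul mulmxA -[P *m o *m o^T]mulmxA o1 mulmx1.
have -> : Q *m (P *m o)^T = (P *m o *m Q^T)^T by rewrite [RHS]trmx_mul trmxK.
have entry (A B D : 'M[R]_1) : (A - B - (B^T - D)) 0 0 = A 0 0 + D 0 0 - 2 * B 0 0.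
  by rewrite !mxE; ring.
rewrite entry !mul_tr00.
have -> : \sum_i P 0 i * P 0 i = \sum_i p i ^+ 2 by apply: eq_bigr => i _; rewrite mxE expr2.
have -> : \sum_i Q 0 i * Q 0 i = \sum_i q i ^+ 2 by apply: eq_bigr => i _; rewrite mxE expr2.
have -> : \sum_i (P *m o) 0 i * Q 0 i = \sum_i \sum_j p i * q j * o i j.
  rewrite exchange_big /=; apply: eq_bigr => j _; rewrite [Q _ _]mxE mxE mulr_suml.
  by apply: eq_bigr => i _; rewrite mxE; ring.
lra.
Qed.

Section Step.
Variables (n : nat) (W M Q Q' : 'M[R]_n) (d d' u : 'rV[R]_n) (a : R).
Hypotheses (WQ : eigenbasis W Q d) (MQ : eigenbasis M Q' d').
Hypotheses (ME : M = W + a *: (u^T *m u)) (u1 : u *m u^T = 1%:M).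

Let o := Q *m Q'^T.
Let x := u *m Q^T.
Let y := u *m Q'^T.

Let Q1 : Q *m Q^T = 1%:M. Proof. by case: WQ. Qed.
Let Q2 : Q^T *m Q = 1%:M. Proof. exact: mulmx1C. Qed.
Let Q'1 : Q' *m Q'^T = 1%:M. Proof. by case: MQ. Qed.
Let Q'2 : Q'^T *m Q' = 1%:M. Proof. exact: mulmx1C. Qed.

Let o1 : o *m o^T = 1%:M.
Proof. by rewrite /o trmx_mul trmxK mulmxA -[Q *m _ *m Q']mulmxA Q'2 mulmx1. Qed.

Let o2 : o^T *m o = 1%:M. Proof. exact: mulmx1C. Qed.

Let xo : x *m o = y.
Proof. by rewrite /x /o mulmxA -[u *m _ *m Q]mulmxA Q2 mulmx1. Qed.

Let yo : y *m o^T = x.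
Proof. by rewrite -xo -mulmxA o1 mulmx1. Qed.

Let x1 : \sum_i x 0 i ^+ 2 = 1.
Proof.
have : (x *m x^T) 0 0 = 1.
  by rewrite /x trmx_mul trmxK mulmxA -[u *m _ *m Q]mulmxA Q2 mulmx1 u1 mxE.
by rewrite mul_tr00 => <-; apply: eq_bigr => i _; rewrite expr2.
Qed.

Let y1 : \sum_i y 0 i ^+ 2 = 1.
Proof.
have : (y *m y^T) 0 0 = 1.
  by rewrite /y trmx_mul trmxK mulmxA -[u *m _ *m Q']mulmxA Q'2 mulmx1 u1 mxE.
by rewrite mul_tr00 => <-; apply: eq_bigr => i _; rewrite expr2.
Qed.

Let gap i j : (d' 0 j - d 0 i) * o i j = a * x 0 i * y 0 j.
Proof.
have : o *m diag_mx d' = diag_mx d *m o + a *: (x^T *m y).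
  have -> : o *m diag_mx d' = Q *m M *m Q'^T.
    by case: MQ => _ ->; rewrite /o !mulmxA -[in RHS]mulmxA Q'1 mulmx1.
  rewrite ME mulmxDr mulmxDl; congr (_ + _).
    by case: WQ => _ ->; rewrite /o !mulmxA Q1 mul1mx.
  by rewrite -scalemxAr -scalemxAl /x /y trmx_mul trmxK !mulmxA.
have entry (A B E : 'M[R]_n) : A = B + a *: E -> A i j = B i j + a * E i j.
  by move=> ->; rewrite !mxE.
move=> /entry; rewrite mul_mx_diag mul_diag_mx.
have -> : (x^T *m y) i j = x 0 i * y 0 j by rewrite mxE big_ord1 [x^T _ _]mxE.
rewrite [X in X = _]mxE [X in _ = X + _]mxE => h.
by rewrite mulrBl [d' 0 j * _]mulrC h; ring.
Qed.

Let C i j := x 0 i * y 0 j * o i j.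

Let C_row i : \sum_j C i j = x 0 i ^+ 2.
Proof.
have -> : x 0 i ^+ 2 = x 0 i * (y *m o^T) 0 i by rewrite yo expr2.
rewrite [(y *m _) 0 i]mxE mulr_sumr; apply: eq_bigr => j _.
by rewrite [(o^T) _ _]mxE /C; ring.
Qed.

Let C_col j : \sum_i C i j = y 0 j ^+ 2.
Proof.
have -> : y 0 j ^+ 2 = y 0 j * (x *m o) 0 j by rewrite xo expr2.
rewrite [(x *m _) 0 j]mxE mulr_sumr; apply: eq_bigr => i _.
by rewrite /C; ring.
Qed.

Let C_gap i j : C i j * (d' 0 j - d 0 i) = a * x 0 i ^+ 2 * y 0 j ^+ 2.
Proof.
have -> : C i j * (d' 0 j - d 0 i) = x 0 i * y 0 j * ((d' 0 j - d 0 i) * o i j) by rewrite /C; ring.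
by rewrite gap; ring.
Qed.

Let C_col_shift j : \sum_i C i j * (d 0 i + a) = y 0 j ^+ 2 * d' 0 j.
Proof.
have : \sum_i (C i j * (d' 0 j - d 0 i) - a * x 0 i ^+ 2 * y 0 j ^+ 2) = 0.
  by apply: big1 => i _; rewrite C_gap subrr.
rewrite sumrB -mulr_suml -mulr_sumr x1 => /eqP; rewrite subr_eq0 => /eqP h.
have -> : \sum_i C i j * (d 0 i + a) = (d' 0 j + a) * (\sum_i C i j) - \sum_i C i j * (d' 0 j - d 0 i).
  by rewrite mulr_sumr -sumrB; apply: eq_bigr => i _; ring.
by rewrite h C_col; ring.
Qed.

Let C_row_shift i : \sum_j C i j * d' 0 j = x 0 i ^+ 2 * (d 0 i + a).
Proof.
have : \sum_j (C i j * (d' 0 j - d 0 i) - a * x 0 i ^+ 2 * y 0 j ^+ 2) = 0.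
  by apply: big1 => j _; rewrite C_gap subrr.
rewrite sumrB -mulr_sumr y1 => /eqP; rewrite subr_eq0 => /eqP h.
have -> : \sum_j C i j * d' 0 j = \sum_j C i j * (d' 0 j - d 0 i) + d 0 i * (\sum_j C i j).
  by rewrite mulr_sumr -big_split; apply: eq_bigr => j _ /=; ring.
by rewrite h C_row; ring.
Qed.

Let pos (z : R) := Num.max 0 z.
Let posE z : pos z * z = pos z ^+ 2.
Proof. by rewrite /pos maxEle; case: ifP => _; rewrite ?mul0r ?expr0n // expr2. Qed.

(** Let o be the matrix of overlaps of the two eigenbases and C i j = x i * y j
    * o i j. The rank-one relation (d' j - d i) o i j = a x i y j gives two
    facts for m_j = d' j - s and n_i = d i + a - s: the sums of squares are S =
    sum C i j pos m_j n_i and T = sum C i j m_j pos n_i, and C i j >= 0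
    wherever the truncation of the other factor matters. For a > 0 this yields
    S <= sum C i j pos m_j pos n_i, which is at most (S + T) / 2 because o is
    orthogonal; for a < 0 the roles of S and T are exchanged. *)
Lemma rank_one_square (s : R) :
  a * (\sum_j y 0 j ^+ 2 * pos (d' 0 j - s) ^+ 2) <=
  a * (\sum_i x 0 i ^+ 2 * pos (d 0 i + a - s) ^+ 2).
Proof.
set S := \sum_j _; set T := \sum_i _.
have mid : \sum_i \sum_j C i j * (pos (d 0 i + a - s) * pos (d' 0 j - s)) <= (S + T) / 2.
  have := orthogonal_bilinear_le (fun i => x 0 i * pos (d 0 i + a - s)) (fun j => y 0 j * pos (d' 0 j - s)) o1.
  rewrite [S + T]addrC.
  have -> : \sum_i (x 0 i * pos (d 0 i + a - s)) ^+ 2 = T by apply: eq_bigr => i _; rewrite exprMn.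
  have -> : \sum_i (y 0 i * pos (d' 0 i - s)) ^+ 2 = S by apply: eq_bigr => i _; rewrite exprMn.
  by apply: le_trans; apply: ler_sum => i _; apply: ler_sum => j _; rewrite le_eqVlt; apply/orP; left; apply/eqP; rewrite /C; ring.
have SE : S = \sum_i \sum_j C i j * ((d 0 i + a - s) * pos (d' 0 j - s)).
  rewrite exchange_big /=; apply: eq_bigr => j _.
  have -> : \sum_i C i j * ((d 0 i + a - s) * pos (d' 0 j - s)) =
     pos (d' 0 j - s) * (\sum_i C i j * (d 0 i + a) - s * \sum_i C i j).
    by rewrite [s * _]mulr_sumr -sumrB mulr_sumr; apply: eq_bigr => i _; ring.
  by rewrite C_col_shift C_col -posE; ring.
have TE : T = \sum_i \sum_j C i j * (pos (d 0 i + a - s) * (d' 0 j - s)).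
  apply: eq_bigr => i _.
  have -> : \sum_j C i j * (pos (d 0 i + a - s) * (d' 0 j - s)) =
     pos (d 0 i + a - s) * (\sum_j C i j * d' 0 j - s * \sum_j C i j).
    by rewrite [s * _]mulr_sumr -sumrB mulr_sumr; apply: eq_bigr => j _; ring.
  by rewrite C_row_shift C_row -posE; ring.
have Csgn i j : 0 <= a * C i j * (d' 0 j - d 0 i).
  have -> : a * C i j * (d' 0 j - d 0 i) = (a * x 0 i * y 0 j) ^+ 2.
    by rewrite -mulrA C_gap; ring.
  exact: sqr_ge0.
have [a0|a0|->] := ltgtP a 0; last by rewrite !mul0r.
- apply: ler_wnM2l; first exact: ltW.
  suff : T <= (S + T) / 2 by move: (S) (T) => v w; lra.
  apply: le_trans mid; rewrite TE; apply: ler_sum => i _; apply: ler_sum => j _.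
  rewrite -subr_ge0 -mulrBr -mulrBr.
  rewrite /pos; case: (leP 0 (d' 0 j - s)) => h2; first by rewrite subrr !mulr0.
  case: (leP 0 (d 0 i + a - s)) => h1; last by rewrite mul0r mulr0.
  have gp : d' 0 j - d 0 i < 0 by lra.
  rewrite mulr_ge0 //; last by rewrite mulr_ge0 //; lra.
  by have := Csgn i j; rewrite -mulrA nmulr_rge0 // nmulr_lle0.
- apply: ler_wpM2l; first exact: ltW.
  suff : S <= (S + T) / 2 by move: (S) (T) => v w; lra.
  apply: le_trans mid; rewrite SE; apply: ler_sum => i _; apply: ler_sum => j _.
  rewrite -subr_ge0 -mulrBr -mulrBl.
  rewrite /pos; case: (leP 0 (d 0 i + a - s)) => h1; first by rewrite subrr mul0r mulr0.
  case: (leP 0 (d' 0 j - s)) => h2; last by rewrite !mulr0.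
  have gp : 0 < d' 0 j - d 0 i by lra.
  rewrite mulr_ge0 //; last by rewrite mulr_ge0 //; lra.
  by have := Csgn i j; rewrite -mulrA pmulr_rge0 // pmulr_lge0.
Qed.

(** The tangent inequality is averaged against the doubly stochastic matrix of
    the squared overlaps. *)
Lemma klein (f g : R -> R) : (forall v w, f w + g w * (v - w) <= f v) ->
  \sum_j f (d' 0 j) - \sum_i f (d 0 i) <= a * \sum_j y 0 j ^+ 2 * g (d' 0 j).
Proof.
move=> fg.
have or i : \sum_j o i j ^+ 2 = 1.
  have : (o *m o^T) i i = 1 by rewrite o1 mxE eqxx.
  rewrite [LHS]mxE => h; rewrite -[RHS]h.
  by apply: eq_bigr => j _; rewrite [(o^T) _ _]mxE expr2.
have oc j : \sum_i o i j ^+ 2 = 1.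
  have : (o^T *m o) j j = 1 by rewrite o2 mxE eqxx.
  rewrite [LHS]mxE => h; rewrite -[RHS]h.
  by apply: eq_bigr => i _; rewrite [(o^T) _ _]mxE expr2.
have -> : \sum_i f (d 0 i) = \sum_i \sum_j o i j ^+ 2 * f (d 0 i).
  by apply: eq_bigr => i _; rewrite -mulr_suml or mul1r.
have -> : \sum_j f (d' 0 j) = \sum_i \sum_j o i j ^+ 2 * f (d' 0 j).
  by rewrite exchange_big; apply: eq_bigr => j _; rewrite -mulr_suml oc mul1r.
have -> : a * \sum_j y 0 j ^+ 2 * g (d' 0 j) = \sum_i \sum_j o i j ^+ 2 * (g (d' 0 j) * (d' 0 j - d 0 i)).
  rewrite exchange_big mulr_sumr; apply: eq_bigr => j _ /=.
  have -> : \sum_i o i j ^+ 2 * (g (d' 0 j) * (d' 0 j - d 0 i)) = g (d' 0 j) * (a * \sum_i C i j).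
    rewrite !mulr_sumr; apply: eq_bigr => i _.
    rewrite (_ : o i j ^+ 2 * _ = g (d' 0 j) * o i j * ((d' 0 j - d 0 i) * o i j)); last by ring.
    by rewrite gap /C; ring.
  by rewrite C_col; ring.
rewrite -sumrB; apply: ler_sum => i _; rewrite -sumrB; apply: ler_sum => j _.
rewrite -mulrBr ler_wpM2l ?sqr_ge0 //.
have := fg (d 0 i) (d' 0 j); lra.
Qed.
End Step.
End RankOne.

(** * The trace of the cubed positive part *)

Section TraceCube.
Variable R : realType.

Definition eigen n (W : 'M[R]_n) : 'M[R]_n * 'rV[R]_n :=
  xget (0, 0) [set Qd | eigenbasis W Qd.1 Qd.2]%classic.

Lemma eigenP n (W : 'M[R]_n) : W^T = W -> eigenbasis W (eigen W).1 (eigen W).2.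
Proof.
move=> /spectral_theorem[Q [d h]].
by rewrite /eigen; case: xgetP => [Qd -> //|/(_ (Q, d))]; case.
Qed.

Definition eigenval n (W : 'M[R]_n) i : R := (eigen W).2 0 i.

Definition trcube s n (W : 'M[R]_n) : R := \sum_i pcube (eigenval W i - s).

Definition weight n (W : 'M[R]_n) (u : 'rV[R]_n) i : R := (u *m (eigen W).1^T) 0 i ^+ 2.

Lemma pcube_tangent (v w : R) : pcube w + 3 * Num.max 0 w ^+ 2 * (v - w) <= pcube v.
Proof.
rewrite /pcube; case: (leP 0 w) => w0; case: (leP 0 v) => v0.
- have -> : v ^+ 3 = w ^+ 3 + 3 * w ^+ 2 * (v - w) + (v - w) ^+ 2 * (v + 2 * w) by ring.
  by rewrite lerDl mulr_ge0 ?sqr_ge0 // addr_ge0 // mulr_ge0.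
- rewrite expr0n /=; have -> : w ^+ 3 + 3 * w ^+ 2 * (v - w) = w ^+ 2 * (3 * v - 2 * w) by ring.
  by rewrite mulr_ge0_le0 ?sqr_ge0 //; lra.
- by rewrite !expr0n /= mulr0 mul0r addr0 exprn_ge0.
- by rewrite !expr0n /= mulr0 mul0r addr0.
Qed.

Lemma rank_one_sym n (W : 'M[R]_n) (u : 'rV[R]_n) a : W^T = W ->
  (W + a *: (u^T *m u))^T = W + a *: (u^T *m u).
Proof. by move=> Ws; rewrite linearD linearZ /= trmx_mul trmxK Ws. Qed.

(** Each of the N + 1 steps is bounded by the derivative at its right end,
    which is moved to the eigenbasis of W; by convexity this derivative is in
    turn at most the next increment, and the sum telescopes with a shift by one
    step. *)
Lemma trcube_rank_one_step n (W : 'M[R]_n) (u : 'rV[R]_n) a s (N : nat) :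
  W^T = W -> u *m u^T = 1%:M ->
  trcube s (W + a *: (u^T *m u)) <= trcube s W +
    \sum_i weight W u i * (pcube (eigenval W i + a + a / N.+1%:R - s)
                           - pcube (eigenval W i + a / N.+1%:R - s)).
Proof.
move=> Ws u1; pose h := a / N.+1%:R.
pose Wr (r : nat) := W + (r%:R * h) *: (u^T *m u).
have Wrs r : (Wr r)^T = Wr r by apply: rank_one_sym.
have WrS r : Wr r.+1 = Wr r + h *: (u^T *m u).
  by rewrite /Wr -natr1 mulrDl mul1r scalerDl addrA.
have step r : trcube s (Wr r.+1) - trcube s (Wr r) <=
    \sum_i weight W u i * (pcube (eigenval W i + r.+2%:R * h - s) - pcube (eigenval W i + r.+1%:R * h - s)).
  have tan (v w : R) : pcube (w - s) + 3 * Num.max 0 (w - s) ^+ 2 * (v - w) <= pcube (v - s).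
    by have := pcube_tangent (v - s) (w - s); rewrite (_ : v - s - (w - s) = v - w) //; ring.
  have k1 := klein (eigenP (Wrs r)) (eigenP (Wrs r.+1)) (WrS r) tan.
  apply: (le_trans k1).
  have rn : r.+1%:R != 0 :> R by rewrite pnatr_eq0.
  have k2 := rank_one_square (eigenP Ws) (eigenP (Wrs r.+1)) (erefl _) u1 s.
  have {}k2 := ler_wpM2l (_ : 0 <= 3 / r.+1%:R) k2.
  have -> : h * \sum_j (u *m (eigen (Wr r.+1)).1^T) 0 j ^+ 2 *
      (3 * Num.max 0 ((eigen (Wr r.+1)).2 0 j - s) ^+ 2) =
      3 / r.+1%:R * (r.+1%:R * h * \sum_j (u *m (eigen (Wr r.+1)).1^T) 0 j ^+ 2 *
      (Num.max 0 ((eigen (Wr r.+1)).2 0 j - s) ^+ 2)).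
    rewrite !mulr_sumr; apply: eq_bigr => j _.
    by move: (r.+1%:R) rn => b bn; field.
  apply: le_trans (k2 _) _; first by rewrite divr_ge0.
  rewrite !mulr_sumr; apply: ler_sum => i _.
  have -> : 3 / r.+1%:R * (r.+1%:R * h * ((u *m (eigen W).1^T) 0 i ^+ 2 *
     Num.max 0 ((eigen W).2 0 i + r.+1%:R * h - s) ^+ 2)) =
     weight W u i * (3 * Num.max 0 (eigenval W i + r.+1%:R * h - s) ^+ 2 * h).
    by rewrite /weight /eigenval; move: (r.+1%:R) rn => b bn; field.
  apply: ler_wpM2l; first exact: sqr_ge0.
  have := pcube_tangent (eigenval W i + r.+2%:R * h - s) (eigenval W i + r.+1%:R * h - s).
  have -> : eigenval W i + r.+2%:R * h - s - (eigenval W i + r.+1%:R * h - s) = h.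
    by rewrite -[r.+2%:R]natr1; ring.
  lra.
have W0 : Wr 0%N = W by rewrite /Wr mul0r scale0r addr0.
have WN : Wr N.+1 = W + a *: (u^T *m u).
  by rewrite /Wr /h; congr (_ + _ *: _); rewrite mulrC divfK // pnatr_eq0.
have : \sum_(0 <= r < N.+1) (trcube s (Wr r.+1) - trcube s (Wr r)) <=
  \sum_(0 <= r < N.+1) \sum_i weight W u i * (pcube (eigenval W i + r.+2%:R * h - s) - pcube (eigenval W i + r.+1%:R * h - s)).
  by apply: ler_sum => r _; apply: step.
rewrite telescope_sumr // WN W0 lerBlDl => /le_trans; apply.
rewrite lerD2l exchange_big /=; apply: ler_sum => i _.
rewrite -mulr_sumr ler_wpM2l ?sqr_ge0 //.
rewrite (@telescope_sumr_eq _ _ _ (fun r => pcube (eigenval W i + r.+1%:R * h - s))) // mul1r.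
suff -> : N.+2%:R * h = a + a / N.+1%:R by rewrite addrA.
by rewrite -natr1 mulrDl mul1r /h [N.+1%:R * _]mulrC divfK // pnatr_eq0.
Qed.

Lemma continuous_pcube : continuous (@pcube R).
Proof.
move=> x; apply: (@continuous_comp _ _ _ (fun y : R => Num.max 0 y) (fun y : R => y ^+ 3)).
  by apply: (@continuous_max _ R (fun=> 0) id); [exact: cst_continuous|exact: cvg_id].
exact: exprn_continuous.
Qed.

(** The shift by one step disappears in the limit of fine subdivisions. *)
Lemma trcube_rank_one n (W : 'M[R]_n) (u : 'rV[R]_n) a s :
  W^T = W -> u *m u^T = 1%:M ->
  trcube s (W + a *: (u^T *m u)) <= trcube s W +
    \sum_i weight W u i * (pcube (eigenval W i + a - s) - pcube (eigenval W i - s)).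
Proof.
move=> Ws u1.
pose f (h : R) := trcube s W + \sum_i weight W u i *
   (pcube (eigenval W i + a + h - s) - pcube (eigenval W i + h - s)).
have fc : continuous f.
  move=> h; apply: cvgD; first exact: cvg_cst.
  elim: (index_enum _) => [|i r IHr].
    by under eq_fun do rewrite big_nil; rewrite big_nil; exact: cvg_cst.
  under eq_fun do rewrite big_cons; rewrite big_cons; apply: cvgD; last exact: IHr.
  apply: cvgM; first exact: cvg_cst.
  apply: cvgB; apply: (continuous_comp (f := fun h => _ + h - s) (g := @pcube R)); try exact: continuous_pcube.
    by apply: cvgB; [apply: cvgD; [exact: cvg_cst|exact: cvg_id]|exact: cvg_cst].
  by apply: cvgB; [apply: cvgD; [exact: cvg_cst|exact: cvg_id]|exact: cvg_cst].
have hc : ((fun N : nat => f (a / N.+1%:R)) @ \oo --> f 0)%classic.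
  apply: (@cvg_comp _ _ _ (fun N : nat => a / N.+1%:R) f); last exact: fc.
  have -> : 0 = a * 0 :> R by rewrite mulr0.
  by apply: cvgM; [exact: cvg_cst|exact: cvg_harmonic].
have f0 : f 0 = trcube s W +
    \sum_i weight W u i * (pcube (eigenval W i + a - s) - pcube (eigenval W i - s)).
  by rewrite /f; congr (_ + _); apply: eq_bigr => i _; rewrite !addr0.
rewrite -f0; apply: (cvgr_to_ge hc).
by near=> N; exact: trcube_rank_one_step.
Unshelve. all: by end_near.
Qed.

End TraceCube.

(** * Comparison of random rank-one sums with a binomial law *)

Section Averaging.
Variable R : realType.

Definition ffcons (T : finType) c (x : T) (f : {ffun 'I_c -> T}) : {ffun 'I_c.+1 -> T} :=
  [ffun i => if unlift ord0 i is Some j then f j else x].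

Lemma big_ffun_recl (T : finType) c (G : {ffun 'I_c.+1 -> T} -> R) :
  \sum_f G f = \sum_x \sum_f G (ffcons x f).
Proof.
rewrite pair_big (reindex (fun xf : T * {ffun 'I_c -> T} => ffcons xf.1 xf.2)) //=.
exists (fun f => (f ord0, [ffun j => f (lift ord0 j)])) => [[x f] _|f _].
  congr pair => /=; first by rewrite ffunE unlift_none.
  by apply/ffunP => j; rewrite !ffunE liftK.
apply/ffunP => i; rewrite ffunE /=.
by case: unliftP => [j ->|->] //; rewrite ffunE.
Qed.

Lemma bin_pmf0 q n : bin_pmf 0 q n = (n == 0)%:R :> R.
Proof. by case: n => [|n]; rewrite /bin_pmf bin0n /= ?mul0r // !mulr1. Qed.

Lemma bin_pmf_gt q c n : (c < n)%N -> bin_pmf c q n = 0 :> R.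
Proof. by move=> cn; rewrite /bin_pmf bin_small // !mul0r. Qed.

Lemma bin_pmfS0 (q : R) c : bin_pmf c.+1 q 0 = (1 - q) * bin_pmf c q 0.
Proof. by rewrite /bin_pmf !bin0 !expr0 !subn0 exprS; ring. Qed.

Lemma bin_pmfSS (q : R) c n : bin_pmf c.+1 q n.+1 = (1 - q) * bin_pmf c q n.+1 + q * bin_pmf c q n.
Proof.
rewrite /bin_pmf binS natrD subSS exprS.
have [cn|nc] := leqP c n; last by rewrite -(subnSK nc) exprS; ring.
by rewrite bin_small // !mul0r mulr0; ring.
Qed.

Lemma sum_bin_pmfS (q : R) c (g : nat -> R) :
  \sum_(n < c.+2) bin_pmf c.+1 q n * g n =
  \sum_(n < c.+1) bin_pmf c q n * ((1 - q) * g n + q * g n.+1).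
Proof.
rewrite big_ord_recl /=.
under eq_bigr do rewrite /bump /= add1n bin_pmfSS mulrDl.
rewrite big_split /= addrA.
have -> : bin_pmf c.+1 q 0 * g 0 + \sum_(i < c.+1) (1 - q) * bin_pmf c q i.+1 * g i.+1 =
  \sum_(n < c.+1) bin_pmf c q n * ((1 - q) * g n).
  rewrite [X in _ + X = _]big_ord_recr /= [X in _ * X * _]bin_pmf_gt // mulr0 mul0r addr0 [RHS]big_ord_recl /=.
  by rewrite bin_pmfS0; congr (_ + _); [ring|apply: eq_bigr => i _; rewrite /bump /= add1n; ring].
by rewrite -big_split; apply: eq_bigr => i _ /=; ring.
Qed.

Variables (k n : nat) (p : 'I_n -> R) (u : 'I_n -> 'rV[R]_k) (q : R).
Hypotheses (p0 : forall i, 0 <= p i) (p1 : \sum_i p i = 1).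
Hypothesis (u1 : forall i, p i = 0 \/ u i *m (u i)^T = 1%:M).
Hypothesis (q01 : 0 <= q <= 1).
Hypothesis (pu : \sum_i p i *: ((u i)^T *m u i) = q%:M).

(** The isotropy of the draws, seen in one eigenvector of W. *)
Lemma average_weight (W : 'M[R]_k) l : W^T = W -> \sum_i p i * weight W (u i) l = q.
Proof.
move=> /eigenP[Q1 _]; set Q := (eigen W).1 in Q1.
have -> : q = (Q *m q%:M *m Q^T) l l.
  by rewrite mul_mx_scalar -scalemxAl Q1 !mxE eqxx mulr1.
rewrite -pu mulmx_sumr mulmx_suml summxE; apply: eq_bigr => i _.
rewrite -scalemxAr -scalemxAl [RHS]mxE; congr (_ * _).
have -> : Q *m ((u i)^T *m u i) *m Q^T = (u i *m Q^T)^T *m (u i *m Q^T).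
  by rewrite trmx_mul trmxK !mulmxA.
by rewrite [RHS]mxE big_ord1 [((_)^T) l 0]mxE -expr2.
Qed.

(** On average one draw shifts each eigenvalue by a with probability q and
    leaves it unchanged otherwise. *)
Lemma average_trcube (W : 'M[R]_k) a s : W^T = W ->
  \sum_i p i * trcube s (W + a *: ((u i)^T *m u i)) <=
  (1 - q) * trcube s W + q * trcube (s - a) W.
Proof.
move=> Ws.
have -> : (1 - q) * trcube s W + q * trcube (s - a) W =
  \sum_i p i * (trcube s W + \sum_l weight W (u i) l *
     (pcube (eigenval W l + a - s) - pcube (eigenval W l - s))).
  under eq_bigr do rewrite mulrDr mulr_sumr.
  rewrite big_split /= -mulr_suml p1 mul1r exchange_big /=.
  have -> : \sum_(j < k) \sum_(i < n) p i * (weight W (u i) j * (pcube (eigenval W j + a - s) -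
        pcube (eigenval W j - s))) = q * (trcube (s - a) W - trcube s W).
    rewrite /trcube -sumrB mulr_sumr; apply: eq_bigr => l _.
    rewrite -{1}(average_weight l Ws) mulr_suml; apply: eq_bigr => i _.
    by rewrite opprB mulrA; congr (_ * (pcube _ - _)); ring.
  by ring.
apply: ler_sum => i _; have [->|ui] := u1 i; first by rewrite !mul0r.
by apply: ler_wpM2l => //; apply: trcube_rank_one.
Qed.

Lemma sample_sum_sym c (t : {ffun 'I_c -> 'I_n}) a :
  (a *: \sum_j ((u (t j))^T *m u (t j)))^T = a *: \sum_j ((u (t j))^T *m u (t j)).
Proof.
rewrite linearZ linear_sum /=; congr (_ *: _); apply: eq_bigr => j _.
by rewrite trmx_mul trmxK.
Qed.

(** Induction on the number of draws: the first one is added last, to the sum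
    of the others, which is fixed when it is averaged. *)
Lemma sampled_trcube c a s :
  \sum_(t : {ffun 'I_c -> 'I_n}) (\prod_j p (t j)) *
     trcube s (a *: \sum_j ((u (t j))^T *m u (t j))) <=
  \sum_(N < c.+1) bin_pmf c q N * trcube (s - a * N%:R) (0 : 'M[R]_k).
Proof.
elim: c s => [|c IH] s.
  rewrite big_ord1 bin_pmf0 mul1r mulr0 subr0.
  have -> : \sum_(t : {ffun 'I_0 -> 'I_n}) (\prod_j p (t j)) *
     trcube s (a *: \sum_j ((u (t j))^T *m u (t j))) =
     \sum_(t : {ffun 'I_0 -> 'I_n}) trcube s (0 : 'M[R]_k).
    by apply: eq_bigr => t _; rewrite !big_ord0 mul1r scaler0.
  by rewrite sumr_const card_ffun !card_ord expn0.
rewrite big_ffun_recl exchange_big /=.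
have -> : \sum_(N < c.+2) bin_pmf c.+1 q N * trcube (s - a * N%:R) (0 : 'M[R]_k) =
  (1 - q) * \sum_(N < c.+1) bin_pmf c q N * trcube (s - a * N%:R) (0 : 'M[R]_k) +
  q * \sum_(N < c.+1) bin_pmf c q N * trcube (s - a - a * N%:R) (0 : 'M[R]_k).
  rewrite (sum_bin_pmfS q c (fun N => trcube (s - a * N%:R) (0 : 'M[R]_k))).
  rewrite !mulr_sumr -big_split; apply: eq_bigr => N _ /=.
  have -> : s - a * N.+1%:R = s - a - a * N%:R by rewrite -natr1; ring.
  ring.
have /andP[q0 q1] := q01.
apply: le_trans (lerD (ler_wpM2l _ (IH s)) (ler_wpM2l q0 (IH (s - a)))); last by rewrite subr_ge0.
rewrite !mulr_sumr -big_split; apply: ler_sum => t _ /=.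
have := average_trcube a s (sample_sum_sym t a).
set S := a *: _; set P := \prod_j _ => h.
have -> : (1 - q) * (P * trcube s S) + q * (P * trcube (s - a) S) =
  P * ((1 - q) * trcube s S + q * trcube (s - a) S) by ring.
have P0 : 0 <= P by apply: prodr_ge0.
apply: le_trans (ler_wpM2l P0 h).
rewrite mulr_sumr; apply: ler_sum => x _; rewrite le_eqVlt; apply/orP; left; apply/eqP.
rewrite big_ord_recl {1}/ffcons ffunE unlift_none big_ord_recl.
have -> : \prod_(i < c) p (ffcons x t (lift ord0 i)) = P.
  by apply: eq_bigr => j _; rewrite ffunE liftK.
have -> : \sum_(i < c) ((u (ffcons x t (lift ord0 i)))^T *m u (ffcons x t (lift ord0 i))) =
   \sum_j ((u (t j))^T *m u (t j)).
  by apply: eq_bigr => j _; rewrite ffunE liftK.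
rewrite ffunE unlift_none scalerDr -/S addrC [in RHS]mulrCA mulrA.
by [].
Qed.

End Averaging.

(** * Numerical bounds for the exponential *)

Section Numeric.
Variable R : realType.
Implicit Types (x y z a A l rho : R) (k : nat).

Lemma is_derive_expRN (t : R) : is_derive t 1 (fun x : R => expR (- x)) (- expR (- t)).
Proof.
have d := @is_derive1_comp R (@expR R) (-%R) t _ _ (is_derive_expR (- t)) (is_deriveN (is_derive_id t 1)).
by apply: (is_derive_eq d); rewrite mulrN1.
Qed.

Lemma is_derive_quad (c2 c1 c0 t : R) :
  is_derive t 1 (fun x : R => c2 * x ^+ 3 + c1 * x ^+ 2 + c0 * x) (3 * c2 * t ^+ 2 + 2 * c1 * t + c0).
Proof.
have d1 : is_derive t 1 (fun x : R => x) 1 := is_derive_id t 1.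
have d2 : is_derive t 1 (fun x : R => x ^+ 2) (2 * t).
  by apply: (is_derive_eq (is_deriveM d1 d1)); rewrite /GRing.scale /=; ring.
have d3 : is_derive t 1 (fun x : R => x ^+ 3) (3 * t ^+ 2).
  by apply: (is_derive_eq (is_deriveM d1 d2)); rewrite /GRing.scale /=; ring.
have {}d3 := is_deriveZ c2 d3; have {}d2 := is_deriveZ c1 d2; have {}d1 := is_deriveZ c0 d1.
apply: (is_derive_eq (is_deriveD (is_deriveD d3 d2) d1)).
by rewrite /GRing.scale /=; ring.
Qed.

Lemma expR_cubic x : 0 <= x -> 1 + x + x ^+ 2 / 2 + x ^+ 3 / 6 <= expR x.
Proof.
move=> x0.
have E2 y : 0 <= y -> 1 + y + y ^+ 2 / 2 <= expR y.
  move=> y0.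
  have := @le_of_derive_ge0 R (fun t => expR t + (0 * t ^+ 3 + (- 2^-1) * t ^+ 2 + (- 1) * t)) _ 0 y y0
    (fun t _ => is_deriveD (is_derive_expR t) (is_derive_quad 0 (- 2^-1) (-1) t)).
  rewrite expR0 => h; have {h} := h _.
  have : forall t, 0 < t < y -> 0 <= expR t + (3 * 0 * t ^+ 2 + 2 * - 2^-1 * t - 1).
    by move=> t _; have := expR_ge1Dx t; lra.
  by move=> h1 /(_ h1); lra.
have := @le_of_derive_ge0 R (fun t => expR t + ((- 6^-1) * t ^+ 3 + (- 2^-1) * t ^+ 2 + (- 1) * t)) _ 0 x x0
    (fun t _ => is_deriveD (is_derive_expR t) (is_derive_quad (- 6^-1) (- 2^-1) (-1) t)).
rewrite expR0 => h; have {h} := h _.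
have : forall t, 0 < t < x -> 0 <= expR t + (3 * - 6^-1 * t ^+ 2 + 2 * - 2^-1 * t - 1).
  by move=> t /andP[/ltW t0 _]; have := E2 t t0; lra.
by move=> h1 /(_ h1); lra.
Qed.

Lemma expRN_cubic x : 0 <= x -> 1 - x + x ^+ 2 / 2 - x ^+ 3 / 6 <= expR (- x).
Proof.
move=> x0.
have E2 y : 0 <= y -> expR (- y) <= 1 - y + y ^+ 2 / 2.
  move=> y0.
  have := @le_of_derive_ge0 R (fun t => (0 * t ^+ 3 + 2^-1 * t ^+ 2 + (- 1) * t) - expR (- t)) _ 0 y y0
    (fun t _ => is_deriveB (is_derive_quad 0 2^-1 (-1) t) (is_derive_expRN t)).
  rewrite oppr0 expR0 => h; have {h} := h _.
  have : forall t, 0 < t < y -> 0 <= (3 * 0 * t ^+ 2 + 2 * 2^-1 * t - 1) - - expR (- t).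
    by move=> t _; have := expR_ge1Dx (- t); lra.
  by move=> h1 /(_ h1); lra.
have := @le_of_derive_ge0 R (fun t => expR (- t) + (6^-1 * t ^+ 3 + (- 2^-1) * t ^+ 2 + 1 * t)) _ 0 x x0
    (fun t _ => is_deriveD (is_derive_expRN t) (is_derive_quad 6^-1 (- 2^-1) 1 t)).
rewrite oppr0 expR0 => h; have {h} := h _.
have : forall t, 0 < t < x -> 0 <= - expR (- t) + (3 * 6^-1 * t ^+ 2 + 2 * - 2^-1 * t + 1).
  by move=> t /andP[/ltW t0 _]; have := E2 t t0; lra.
by move=> h1 /(_ h1); lra.
Qed.

Lemma expR_le_inv x : 0 <= x <= 1 -> expR x <= (1 - x + x ^+ 2 / 2 - x ^+ 3 / 6)^-1.
Proof.
move=> /andP[x0 x1].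
have d0 : 0 < 1 - x + x ^+ 2 / 2 - x ^+ 3 / 6 by nra.
rewrite -[expR x]invrK -expRN lef_pV2 ?posrE ?expR_gt0 //.
exact: expRN_cubic.
Qed.

Lemma expRN_le_inv x : 0 <= x -> expR (- x) <= (1 + x + x ^+ 2 / 2 + x ^+ 3 / 6)^-1.
Proof.
move=> x0.
have d0 : 0 < 1 + x + x ^+ 2 / 2 + x ^+ 3 / 6.
  by rewrite ltr_wpDr ?divr_ge0 ?exprn_ge0 // ltr_wpDr ?divr_ge0 ?exprn_ge0 // ltr_wpDr.
by rewrite expRN lef_pV2 ?posrE ?expR_gt0 // expR_cubic.
Qed.

(** exp (1/8) is raised to the powers 2, 4, 8 and 24 with five decimals. *)
Lemma expR3_le : expR 3 <= 20 + 98 / 1000 :> R.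
Proof.
have sq x y z : 0 <= x -> x <= y -> y ^+ 2 <= z -> x ^+ 2 <= z.
  by move=> x0 xy; apply: le_trans; rewrite lerXn2r ?nnegrE // (le_trans x0).
have e1 : expR (1 / 8) <= 1133 / 1000 + 17 / 10 ^+ 5 :> R.
  apply: le_trans (expR_le_inv _) _; first by lra.
  rewrite (_ : (_ - _)^-1 = 3072 / 2711); last by field.
  lra.
have p n : 0 <= expR (1 / 8) ^+ n :> R by rewrite exprn_ge0 ?expR_ge0.
have e2 := sq _ _ (1284 / 1000 + 8 / 10 ^+ 5) (expR_ge0 _) e1 ltac:(lra).
have e4 := sq _ _ (1648 / 1000 + 87 / 10 ^+ 5) (p 2%N) e2 ltac:(lra).
have e8 := sq _ _ (2718 / 1000 + 78 / 10 ^+ 5) (exprn_ge0 _ (p 2%N)) e4 ltac:(lra).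
rewrite -!exprM in e8.
have -> : expR 3 = (expR (1 / 8) ^+ (2 * 2 * 2)) ^+ 3 :> R.
  by rewrite -exprM -expRM_natl; congr expR; field.
have := p (2 * 2 * 2)%N; move: (expR (1 / 8) ^+ (2 * 2 * 2)%N) e8 => y y1 y0.
have y2 := sq _ _ (7391 / 1000 + 77 / 10 ^+ 5) y0 y1 ltac:(lra).
rewrite exprS; apply: le_trans (ler_pM y0 (exprn_ge0 _ y0) y1 y2) _; lra.
Qed.

Lemma sqrt_le_of_sqr x y : 0 <= x -> 0 <= y -> x <= y ^+ 2 -> Num.sqrt x <= y.
Proof.
by move=> x0 y0 h; rewrite -(@ler_pXn2r _ 2) ?nnegrE ?sqrtr_ge0 // sqr_sqrtr.
Qed.

Lemma sharp_cst_le : sharp_cst R <= 2521 / 2000.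
Proof.
have s : Num.sqrt (36 / 113 : R) <= 564 / 1000 + 44 / 10 ^+ 5.
  by apply: sqrt_le_of_sqr; lra.
rewrite /sharp_cst; set w := Num.sqrt _ in s *; set e := expR 3.
have h : e * w <= (20 + 98 / 1000) * (564 / 1000 + 44 / 10 ^+ 5).
  by apply: ler_pM; [exact: expR_ge0|exact: sqrtr_ge0|exact: expR3_le|exact: s].
lra.
Qed.

Lemma psi_le a (u1 u2 : R) : 0 < a -> 0 <= u1 -> 0 <= u2 -> 1 <= u1 ^+ 2 * a -> 1 <= u2 ^+ 2 * (a + 3) ->
  psi a <= 2521 / 2000 * (u1 / 3 + 2 * u2 / 3).
Proof.
move=> a0 u10 u20 h1 h2.
have inv (b u : R) : 0 < b -> 0 <= u -> 1 <= u ^+ 2 * b -> (Num.sqrt b)^-1 <= u.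
  move=> b0 u0 h; rewrite -(@ler_pM2r _ (Num.sqrt b)) ?sqrtr_gt0 // mulVf ?gt_eqF ?sqrtr_gt0 //.
  rewrite -(@ler_pXn2r _ 2) ?nnegrE ?mulr_ge0 ?sqrtr_ge0 //.
  by rewrite expr1n exprMn sqr_sqrtr // ltW.
have i1 := inv _ _ a0 u10 h1.
have i2 := inv (a + 3) u2 (ltac:(lra)) u20 h2.
rewrite /psi; apply: ler_pM.
- by rewrite /sharp_cst !mulr_ge0 ?expR_ge0 ?sqrtr_ge0 ?invr_ge0.
- by rewrite addr_ge0 // mulr_ge0 ?invr_ge0 ?sqrtr_ge0 ?divr_ge0.
- exact: sharp_cst_le.
lra.
Qed.

Lemma psi_homo a A : 0 < a -> a <= A -> psi A <= psi a.
Proof.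
move=> a0 aA; have A0 := lt_le_trans a0 aA.
have h (b c : R) : 0 < b -> b <= c -> (Num.sqrt c)^-1 <= (Num.sqrt b)^-1.
  by move=> b0 bc; rewrite lef_pV2 ?posrE ?sqrtr_gt0 ?ler_wsqrtr // (lt_le_trans b0).
rewrite /psi ler_wpM2l //.
  by rewrite /sharp_cst !mulr_ge0 ?expR_ge0 ?sqrtr_ge0 ?invr_ge0.
have h1 := h _ _ a0 aA; have h2 := h (a + 3) (A + 3) (ltac:(lra)) (ltac:(lra)); lra.
Qed.

(** Both K / (K - 1) and 1 / (K - 1) decrease with K, while the logarithm
    increases: on an interval the former are evaluated at the right end and the
    latter at the left end. *)
Lemma log_interval k1 k2 k A l (a0 z : R) :
  (1 < k1)%N -> (k1 <= k <= k2)%N -> l <= ln k1%:R -> 0 <= z ->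
  a0 * (k2%:R - 1) <= l * k2%:R -> z * (k2%:R - 1) <= l ->
  k%:R / (k%:R - 1) * ln k%:R <= A -> a0 <= A /\ z <= A / k%:R.
Proof.
move=> k1_gt1 /andP[k1k kk2] hl z0 ha hz hA.
have K1 : 1 < k%:R :> R by rewrite ltr1n (leq_trans k1_gt1).
have K2 : k%:R <= k2%:R :> R by rewrite ler_nat.
have lk : l <= ln k%:R.
  by apply: le_trans hl _; rewrite ler_ln ?posrE ?ler_nat // ltr0n ?(leq_trans _ k1k) // ltnW.
move: (k%:R : R) (k2%:R : R) (ln _) K1 K2 lk hA ha hz => K L lnk K1 K2 lk hA ha hz.
have K0 : 0 <= K by lra.
have L0 : 0 <= L by lra.
have K10 : 0 < K - 1 by lra.
have L10 : 0 < L - 1 by lra.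
have l0 : 0 <= l by apply: le_trans hz; rewrite mulr_ge0 // ltW.
have lnk0 : 0 <= lnk by apply: le_trans lk.
split.
  apply: le_trans hA; rewrite -(@ler_pM2r _ (L - 1)) //.
  apply: (le_trans ha); apply: le_trans (ler_wpM2r L0 lk) _.
  rewrite -(@ler_pM2r _ (K - 1)) // (_ : K / (K - 1) * _ * _ * _ = lnk * (K * (L - 1))).
    rewrite -mulrA; apply: ler_wpM2l => //; lra.
  by field; rewrite gt_eqF.
rewrite ler_pdivlMr; last by lra.
apply: le_trans hA; rewrite mulrC -mulrA; apply: ler_wpM2l => //.
rewrite [leRHS]mulrC ler_pdivlMr //; apply: le_trans lk; apply: le_trans hz.
by apply: ler_wpM2l => //; lra.
Qed.

(** Checks the comparison on k1 <= k <= k2 from a few rational bounds: l for ln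
    k1, a0 for A, u1 and u2 for the two inverse square roots in psi, and z for
    A / k. *)
Lemma psi_base_interval k1 k2 k A l (a0 u1 u2 z rho : R) :
  (1 < k1)%N -> (k1 <= k <= k2)%N -> l <= ln k1%:R -> 0 < a0 -> 0 <= u1 -> 0 <= u2 -> 0 <= z -> 0 <= rho ->
  a0 * (k2%:R - 1) <= l * k2%:R -> z * (k2%:R - 1) <= l ->
  1 <= u1 ^+ 2 * a0 -> 1 <= u2 ^+ 2 * (a0 + 3) ->
  2521 / 2000 * (u1 / 3 + 2 * u2 / 3) <= rho * (1 + z + z ^+ 2 / 2 + z ^+ 3 / 6) ->
  k%:R / (k%:R - 1) * ln k%:R <= A -> psi A <= rho * expR (A / k%:R).
Proof.
move=> k1_gt1 kk hl a00 u10 u20 z0 rho0 ha hz h1 h2 h hA.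
have [aA zA] := log_interval k1_gt1 kk hl z0 ha hz hA.
apply: le_trans (psi_homo a00 aA) _; apply: le_trans (psi_le a00 u10 u20 h1 h2) _.
apply: (le_trans h); apply: ler_wpM2l => //.
by apply: le_trans (expR_cubic z0) _; rewrite ler_expR.
Qed.

End Numeric.

(** * The sharp factor against the spare exponential *)

Section Base.
Variable R : realType.
Implicit Types (A l rho : R) (k : nat).

Lemma ln_sub_ge_pade (a b : R) : 0 < a -> 0 < b ->
  (b - a) * (5 * b + a) / (2 * b * (b + 2 * a)) <= ln b - ln a.
Proof.
move=> a0 b0; rewrite -ln_div ?posrE //; apply: le_trans (ln_ge_pade (divr_gt0 b0 a0)).
have c0 : 0 < b + 2 * a by rewrite addr_gt0 // mulr_gt0.
by rewrite le_eqVlt; apply/orP; left; apply/eqP; field; rewrite !gt_eqF //= addrC.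
Qed.

Lemma ln_ratio (k1 k2 : nat) (l : R) : (0 < k1)%N -> (0 < k2)%N ->
  l * (2 * k2%:R * (k2%:R + 2 * k1%:R)) <= (k2%:R - k1%:R) * (5 * k2%:R + k1%:R) ->
  l <= ln k2%:R - ln k1%:R.
Proof.
move=> k10 k20; have a0 : 0 < k1%:R :> R by rewrite ltr0n.
have b0 : 0 < k2%:R :> R by rewrite ltr0n.
move: (k1%:R : R) (k2%:R : R) a0 b0 => a b a0 b0 h.
apply: le_trans (ln_sub_ge_pade a0 b0); rewrite ler_pdivlMr //.
by rewrite !mulr_gt0 // addr_gt0 // mulr_gt0.
Qed.

(** Lower bounds for logarithms of integers are propagated along the chain of
    left ends of intervals. *)
Lemma ln_step (k1 k2 : nat) (l l' : R) : (0 < k1)%N -> (0 < k2)%N -> l <= ln k1%:R ->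
  (l' - l) * (2 * k2%:R * (k2%:R + 2 * k1%:R)) <= (k2%:R - k1%:R) * (5 * k2%:R + k1%:R) ->
  l' <= ln k2%:R.
Proof. by move=> k10 k20 hl /(ln_ratio k10 k20); lra. Qed.

Lemma ln_powM (a n : nat) : (0 < a)%N -> ln (a ^ n)%:R = n%:R * ln a%:R :> R.
Proof. by move=> a0; rewrite natrX lnXn ?ltr0n // mulr_natl. Qed.

(** From 5/4 and 128/125 = 2^7 / 5^3. *)
Lemma ln2_ge : 692 / 1000 + 9 / 10 ^+ 4 <= ln 2%:R :> R.
Proof.
have h1 : 223 / 1000 + 7 / 10 ^+ 5 <= ln 5%:R - ln 4%:R :> R by apply: ln_ratio => //; lra.
have h2 : 237 / 10 ^+ 4 <= ln 128%:R - ln 125%:R :> R by apply: ln_ratio => //; lra.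
have := @ln_powM 2 7 isT; have := @ln_powM 5 3 isT; have := @ln_powM 2 2 isT.
rewrite (_ : 2 ^ 2 = 4)%N // (_ : 2 ^ 7 = 128)%N // (_ : 5 ^ 3 = 125)%N //; lra.
Qed.

Lemma ln3_ge : 549 / 500 <= ln 3%:R :> R.
Proof.
have l2 := ln2_ge; have h1 : 117 / 1000 + 7 / 10 ^+ 4 <= ln 9%:R - ln 8%:R :> R.
  by apply: ln_ratio => //; lra.
have := @ln_powM 2 3 isT; have := @ln_powM 3 2 isT.
rewrite (_ : 2 ^ 3 = 8)%N // (_ : 3 ^ 2 = 9)%N //; lra.
Qed.

Lemma ln4_ge : 277 / 200 <= ln 4%:R :> R.
Proof. have := ln2_ge; have := @ln_powM 2 2 isT; rewrite (_ : 2 ^ 2 = 4)%N //; lra. Qed.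

Lemma ln5_ge : 201 / 125 <= ln 5%:R :> R.
Proof. by apply: (@ln_step 4 5 _ _ isT isT ln4_ge); lra. Qed.

(** In three and four dimensions psi is smaller compared with exp (A / k), and
    the extra room is used. *)
Lemma psi_base3 A : 3%:R / (3%:R - 1) * ln 3%:R <= A -> psi A <= 52 / 125 * expR (A / 3%:R).
Proof.
move=> hA; apply: (@psi_base_interval R 3 3 3 A (549 / 500) (1647 / 1000) (39 / 50) (58 / 125) (549 / 1000) (52 / 125) isT isT ln3_ge) hA; clear; lra.
Qed.

Lemma psi_base4 A : 4%:R / (4%:R - 1) * ln 4%:R <= A -> psi A <= 437 / 1000 * expR (A / 4%:R).
Proof.
move=> hA; apply: (@psi_base_interval R 4 4 4 A (277 / 200) (923 / 500) (737 / 1000) (91 / 200) (461 / 1000) (437 / 1000) isT isT ln4_ge) hA; clear; lra.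
Qed.

Lemma ln_nat_le (a b : nat) : (0 < a)%N -> (a <= b)%N -> ln a%:R <= ln b%:R :> R.
Proof. by move=> a0 ab; rewrite ler_ln ?posrE ?ler_nat ?ltr0n // (leq_trans a0). Qed.

(** From here on psi itself is below 1/2. *)
Lemma psi_base_large k A : (505 <= k)%N -> 759 / 125 <= ln 505%:R :> R ->
  k%:R / (k%:R - 1) * ln k%:R <= A -> psi A <= 2^-1 * expR (A / k%:R).
Proof.
move=> lo505 l505 hA.
have {}l505 := le_trans l505 (@ln_nat_le 505 k isT lo505).
have K0 : 1 < k%:R :> R by rewrite ltr1n (leq_trans _ lo505).
have A0 : 759 / 125 <= A.
  apply: (le_trans l505); apply: le_trans hA.
  have L0 := ln_ge0 (ltW K0); apply: ler_peMl => //.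
  move: (k%:R : R) K0 => K K0; rewrite ler_pdivlMr; clear -K0; lra.
have a0 : 0 < 759 / 125 :> R by clear; lra.
have A1 : 0 <= A / k%:R.
  by rewrite divr_ge0 ?ler0n // (le_trans (ltW a0)).

apply: le_trans (psi_homo a0 A0) _.
apply: (@le_trans _ _ 2^-1); last first.
  apply: ler_peMr; first by rewrite invr_ge0 ler0n.
  by apply: le_trans (expR_ge1Dx _); rewrite lerDl.
by apply: le_trans (@psi_le R _ (203 / 500) (333 / 1000) a0 _ _ _ _) _; clear; lra.
Qed.

(** The critical comparison. Its least margin is below two per cent, near k =
    25, so that it is checked on a chain of intervals. *)
Lemma psi_base k A : (5 <= k)%N -> k%:R / (k%:R - 1) * ln k%:R <= A ->
  psi A <= 2^-1 * expR (A / k%:R).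
Proof.
move=> lo5 hA.
have l5 := ln5_ge.
have [hi|lo7] := leqP k 6.
  have kk : (5 <= k <= 6)%N by rewrite lo5.
  by apply: (@psi_base_interval R 5 6 k A (201 / 125) (1929 / 1000) (721 / 1000) (451 / 1000) (321 / 1000) (2^-1) isT kk l5) hA; clear; lra.
have l7 : 243 / 125 <= ln 7%:R :> R by apply: (@ln_step 5 7 _ _ isT isT l5); clear; lra.
have [hi|lo9] := leqP k 8.
  have kk : (7 <= k <= 8)%N by rewrite lo7.
  by apply: (@psi_base_interval R 7 8 k A (243 / 125) (2221 / 1000) (84 / 125) (219 / 500) (277 / 1000) (2^-1) isT kk l7) hA; clear; lra.
have l9 : 439 / 200 <= ln 9%:R :> R by apply: (@ln_step 7 9 _ _ isT isT l7); clear; lra.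
have [hi|lo11] := leqP k 10.
  have kk : (9 <= k <= 10)%N by rewrite lo9.
  by apply: (@psi_base_interval R 9 10 k A (439 / 200) (1219 / 500) (641 / 1000) (429 / 1000) (243 / 1000) (2^-1) isT kk l9) hA; clear; lra.
have l11 : 479 / 200 <= ln 11%:R :> R by apply: (@ln_step 9 11 _ _ isT isT l9); clear; lra.
have [hi|lo13] := leqP k 12.
  have kk : (11 <= k <= 12)%N by rewrite lo11.
  by apply: (@psi_base_interval R 11 12 k A (479 / 200) (653 / 250) (619 / 1000) (423 / 1000) (217 / 1000) (2^-1) isT kk l11) hA; clear; lra.
have l13 : 1281 / 500 <= ln 13%:R :> R by apply: (@ln_step 11 13 _ _ isT isT l11); clear; lra.
have [hi|lo15] := leqP k 14.
  have kk : (13 <= k <= 14)%N by rewrite lo13.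
  by apply: (@psi_base_interval R 13 14 k A (1281 / 500) (2759 / 1000) (603 / 1000) (417 / 1000) (197 / 1000) (2^-1) isT kk l13) hA; clear; lra.
have l15 : 541 / 200 <= ln 15%:R :> R by apply: (@ln_step 13 15 _ _ isT isT l13); clear; lra.
have [hi|lo17] := leqP k 16.
  have kk : (15 <= k <= 16)%N by rewrite lo15.
  by apply: (@psi_base_interval R 15 16 k A (541 / 200) (577 / 200) (589 / 1000) (413 / 1000) (9 / 50) (2^-1) isT kk l15) hA; clear; lra.
have l17 : 283 / 100 <= ln 17%:R :> R by apply: (@ln_step 15 17 _ _ isT isT l15); clear; lra.
have [hi|lo19] := leqP k 18.
  have kk : (17 <= k <= 18)%N by rewrite lo17.
  by apply: (@psi_base_interval R 17 18 k A (283 / 100) (749 / 250) (289 / 500) (409 / 1000) (83 / 500) (2^-1) isT kk l17) hA; clear; lra.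
have l19 : 2941 / 1000 <= ln 19%:R :> R by apply: (@ln_step 17 19 _ _ isT isT l17); clear; lra.
have [hi|lo21] := leqP k 20.
  have kk : (19 <= k <= 20)%N by rewrite lo19.
  by apply: (@psi_base_interval R 19 20 k A (2941 / 1000) (619 / 200) (569 / 1000) (203 / 500) (77 / 500) (2^-1) isT kk l19) hA; clear; lra.
have l21 : 3041 / 1000 <= ln 21%:R :> R by apply: (@ln_step 19 21 _ _ isT isT l19); clear; lra.
have [hi|lo23] := leqP k 22.
  have kk : (21 <= k <= 22)%N by rewrite lo21.
  by apply: (@psi_base_interval R 21 22 k A (3041 / 1000) (637 / 200) (561 / 1000) (403 / 1000) (18 / 125) (2^-1) isT kk l21) hA; clear; lra.
have l23 : 3131 / 1000 <= ln 23%:R :> R by apply: (@ln_step 21 23 _ _ isT isT l21); clear; lra.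
have [hi|lo26] := leqP k 25.
  have kk : (23 <= k <= 25)%N by rewrite lo23.
  by apply: (@psi_base_interval R 23 25 k A (3131 / 1000) (3261 / 1000) (277 / 500) (2 / 5) (13 / 100) (2^-1) isT kk l23) hA; clear; lra.
have l26 : 3253 / 1000 <= ln 26%:R :> R by apply: (@ln_step 23 26 _ _ isT isT l23); clear; lra.
have [hi|lo29] := leqP k 28.
  have kk : (26 <= k <= 28)%N by rewrite lo26.
  by apply: (@psi_base_interval R 26 28 k A (3253 / 1000) (3373 / 1000) (109 / 200) (397 / 1000) (3 / 25) (2^-1) isT kk l26) hA; clear; lra.
have l29 : 1681 / 500 <= ln 29%:R :> R by apply: (@ln_step 26 29 _ _ isT isT l26); clear; lra.
have [hi|lo33] := leqP k 32.
  have kk : (29 <= k <= 32)%N by rewrite lo29.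
  by apply: (@psi_base_interval R 29 32 k A (1681 / 500) (347 / 100) (537 / 1000) (197 / 500) (27 / 250) (2^-1) isT kk l29) hA; clear; lra.
have l33 : 3491 / 1000 <= ln 33%:R :> R by apply: (@ln_step 29 33 _ _ isT isT l29); clear; lra.
have [hi|lo38] := leqP k 37.
  have kk : (33 <= k <= 37)%N by rewrite lo33.
  by apply: (@psi_base_interval R 33 37 k A (3491 / 1000) (3587 / 1000) (529 / 1000) (39 / 100) (12 / 125) (2^-1) isT kk l33) hA; clear; lra.
have l38 : 454 / 125 <= ln 38%:R :> R by apply: (@ln_step 33 38 _ _ isT isT l33); clear; lra.
have [hi|lo46] := leqP k 45.
  have kk : (38 <= k <= 45)%N by rewrite lo38.
  by apply: (@psi_base_interval R 38 45 k A (454 / 125) (1857 / 500) (519 / 1000) (193 / 500) (41 / 500) (2^-1) isT kk l38) hA; clear; lra.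
have l46 : 3823 / 1000 <= ln 46%:R :> R by apply: (@ln_step 38 46 _ _ isT isT l38); clear; lra.
have [hi|lo59] := leqP k 58.
  have kk : (46 <= k <= 58)%N by rewrite lo46.
  by apply: (@psi_base_interval R 46 58 k A (3823 / 1000) (389 / 100) (127 / 250) (381 / 1000) (67 / 1000) (2^-1) isT kk l46) hA; clear; lra.
have l59 : 4071 / 1000 <= ln 59%:R :> R by apply: (@ln_step 46 59 _ _ isT isT l46); clear; lra.
have [hi|lo94] := leqP k 93.
  have kk : (59 <= k <= 93)%N by rewrite lo59.
  by apply: (@psi_base_interval R 59 93 k A (4071 / 1000) (823 / 200) (493 / 1000) (3 / 8) (11 / 250) (2^-1) isT kk l59) hA; clear; lra.
have l94 : 907 / 200 <= ln 94%:R :> R by apply: (@ln_step 59 94 _ _ isT isT l59); clear; lra.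
have [hi|lo505] := leqP k 504.
  have kk : (94 <= k <= 504)%N by rewrite lo94.
  by apply: (@psi_base_interval R 94 504 k A (907 / 200) (568 / 125) (47 / 100) (73 / 200) (9 / 1000) (2^-1) isT kk l94) hA; clear; lra.
have l505 : 759 / 125 <= ln 505%:R :> R by apply: (@ln_step 94 505 _ _ isT isT l94); clear; lra.
exact: psi_base_large lo505 l505 hA.
Qed.

End Base.

(** * Which pair of tail bounds suffices: three and four dimensions *)

(* The goals are comparisons of rational constants, possibly with 0 < e <= 1;
   clearing the context keeps the linear arithmetic fast. *)
Ltac numeric :=
  first [assumption | clear; lra
        | match goal with e0 : is_true (0 < ?e), e1 : is_true (?e <= 1) |- _ =>
            clear -e0 e1; lra end].

Section Cases.
Variable R : realType.
Implicit Types (e J A x m rho el er c : R) (k : nat).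

(** The correction exponent of the sharp bound, per unit of om2. *)
Definition corr e A : R := 1 / 3 + 57 / 80 / (A * (1 + e / 3)).
(** The correction exponent of the sharp bound of the upper tail, with J = k -
    1; xlow is its analogue for the lower tail. *)
Definition xup e J A : R := e ^+ 2 * ((J + 1) / J) ^+ 2 / ((1 + e) * (1 - e / J)) * corr e A.
Definition xlow e J A : R := e ^+ 2 * ((J + 1) / J) ^+ 2 / ((1 - e) * (1 + e / J)) * corr e A.
(** The exponent of the lower tail is A (1 + lam e J). *)
Definition lam e J : R := (1 + e / 3) / ((1 - e / 3) * (1 + e / (3 * J))) - 1.

Lemma corr_le el e A0 A c : 0 <= el -> el <= e -> 0 < A0 -> A0 <= A ->
  57 / 80 <= (c - 1 / 3) * (A0 * (1 + el / 3)) -> corr e A <= c.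
Proof.
move=> el0 ee A00 AA h; rewrite /corr -lerBrDl.
have p : 0 < A0 * (1 + el / 3) by rewrite mulr_gt0 //; lra.
apply: (@le_trans _ _ (57 / 80 / (A0 * (1 + el / 3)))); last by rewrite ler_pdivrMr.
apply: ler_wpM2l; first by lra.
rewrite lef_pV2 ?posrE //; first by apply: ler_pM => //; lra.
by apply: (lt_le_trans p); apply: ler_pM => //; lra.
Qed.

Lemma ratio_le J0 J : 0 < J0 -> J0 <= J -> 0 <= (J + 1) / J <= (J0 + 1) / J0.
Proof.
move=> J00 JJ; have J0' := lt_le_trans J00 JJ.
apply/andP; split; first by rewrite divr_ge0 //; lra.
have eqr (j : R) : 0 < j -> (j + 1) / j = 1 + j^-1 by move=> j0; field; rewrite gt_eqF.
by rewrite !eqr // lerD2l lef_pV2.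
Qed.

Lemma corr_ge0 e A : 0 <= e -> 0 < A -> 0 <= corr e A.
Proof. by move=> e0 A0; rewrite /corr addr_ge0 ?divr_ge0 ?mulr_ge0 ?addr_ge0 ?divr_ge0 // ltW. Qed.

(** Each factor of xup is monotone in e, J and A separately, so that it is
    evaluated at the worst corner of a box. *)
Lemma xup_le el er J0 A0 e J A c x :
  0 <= el -> el <= e -> e <= er -> er < J0 -> J0 <= J -> 0 < A0 -> A0 <= A ->
  57 / 80 <= (c - 1 / 3) * (A0 * (1 + el / 3)) ->
  er ^+ 2 * (J0 + 1) ^+ 2 * c <= x * (J0 * ((1 + er) * (J0 - er))) ->
  xup e J A <= x.
Proof.
move=> el0 ee er_ge eJ JJ A00 AA hc hx.
have hcorr := corr_le el0 ee A00 AA hc.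
have c0 : 0 <= corr e A by apply: corr_ge0; [exact: le_trans ee|exact: lt_le_trans AA].
have J00 : 0 < J0 by lra.
have /andP[r0 r1] := ratio_le J00 JJ.
have J0' := lt_le_trans J00 JJ.
have d0 : 0 < (1 + er) * (1 - er / J0).
  by rewrite mulr_gt0 //; [lra|rewrite subr_gt0 ltr_pdivrMr //; lra].
have eJ' : e / J <= er / J0.
  by rewrite ler_pdivrMr // mulrAC ler_pdivlMr //; apply: ler_pM => //; lra.
have d1 : 0 < (1 + e) * (1 - e / J).
  rewrite mulr_gt0 //; first by lra.
  rewrite subr_gt0; apply: le_lt_trans eJ' _; rewrite ltr_pdivrMr //; lra.
have e1 : e ^+ 2 / ((1 + e) * (1 - e / J)) <= er ^+ 2 / ((1 + er) * (1 - er / J0)).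
  rewrite ler_pdivrMr // mulrAC ler_pdivlMr //.
  have h1 : e ^+ 2 * (1 + er) <= er ^+ 2 * (1 + e).
    have e0 : 0 <= e by lra.
    have er0 : 0 <= er by lra.
    rewrite -subr_ge0 (_ : _ - _ = (er - e) * (er + e + e * er)); last by ring.
    by rewrite mulr_ge0 ?subr_ge0 // !addr_ge0 // mulr_ge0.
  have q0 : 0 <= 1 - er / J0 by rewrite subr_ge0 ler_pdivrMr //; lra.
  rewrite !mulrA; apply: ler_pM; rewrite ?mulr_ge0 ?sqr_ge0 //; lra.
have hx' : er ^+ 2 / ((1 + er) * (1 - er / J0)) * ((J0 + 1) / J0) ^+ 2 * c <= x.
  have -> : er ^+ 2 / ((1 + er) * (1 - er / J0)) * ((J0 + 1) / J0) ^+ 2 * c =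
    er ^+ 2 * (J0 + 1) ^+ 2 * c / (J0 * ((1 + er) * (J0 - er))).
    by field; rewrite !gt_eqF //=; lra.
  by rewrite ler_pdivrMr // mulr_gt0 // mulr_gt0 //; lra.
apply: le_trans hx'; rewrite /xup.
rewrite [X in X * corr _ _]mulrAC.
have e0 : 0 <= e ^+ 2 / ((1 + e) * (1 - e / J)) by rewrite divr_ge0 ?sqr_ge0 // ltW.
apply: ler_pM => //; first by rewrite mulr_ge0 // sqr_ge0.
by apply: ler_pM => //; [rewrite sqr_ge0|rewrite lerXn2r ?nnegrE // (le_trans r0)].
Qed.

Lemma lam_ge el e J0 J l0 : 0 <= el -> el <= e -> e <= 1 -> 1 <= J0 -> J0 <= J ->
  (1 + l0) * ((1 - el / 3) * (3 * J0 + el)) <= (1 + el / 3) * (3 * J0) ->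
  l0 <= lam e J.
Proof.
move=> el0 ee e1 J01 JJ h.
have J00 : 0 < J0 by lra.
have J' : 0 < J by lra.
have h0 : 1 + l0 <= (1 + el / 3) / ((1 - el / 3) * (1 + el / (3 * J0))).
  have -> : (1 + el / 3) / ((1 - el / 3) * (1 + el / (3 * J0))) = (1 + el / 3) * (3 * J0) / ((1 - el / 3) * (3 * J0 + el)).
    by field; rewrite !gt_eqF //=; lra.
  by rewrite ler_pdivlMr // mulr_gt0 //; lra.
suff : (1 + el / 3) / ((1 - el / 3) * (1 + el / (3 * J0))) <= (1 + e / 3) / ((1 - e / 3) * (1 + e / (3 * J))).
  by rewrite /lam; lra.
have p0 : 0 <= el / (3 * J0) by rewrite divr_ge0 // mulr_ge0 // ltW.
have e0 : 0 <= e := le_trans el0 ee.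
have p1 : 0 <= e / (3 * J) by apply: divr_ge0 => //; lra.
rewrite ler_pdivrMr; last by rewrite mulr_gt0 //; lra.
rewrite mulrAC ler_pdivlMr; last by rewrite mulr_gt0 //; lra.
have q : (1 + el / 3) * (1 + e / (3 * J)) <= (1 + e / 3) * (1 + el / (3 * J0)).
  have s1 : e / (3 * J) <= e / (3 * J0).
    by apply: ler_wpM2l => //; rewrite lef_pV2 ?posrE; lra.
  have s2 : (3 * J0)^-1 <= 3^-1 by rewrite lef_pV2 ?posrE; lra.
  have s0 : 0 <= (3 * J0)^-1 by rewrite invr_ge0; lra.
  move: ((3 * J0)^-1) s0 s1 s2 => w s0 s1 s2.
  apply: (@le_trans _ _ ((1 + el / 3) * (1 + e * w))).
    by apply: ler_wpM2l; lra.
  nra.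
rewrite mulrCA [leRHS]mulrCA.
apply: ler_pM => //; first by lra.
- by rewrite mulr_ge0 //; lra.
- lra.
Qed.

(** The sharp bound for the upper tail and the plain one for the lower tail,
    after division by exp (- A). *)
Lemma upper_sharp k e J A x m E1 E2 rho :
  0 < k%:R :> R -> 0 <= rho -> 0 <= x <= 1 -> 0 <= m -> 0 <= E1 -> 0 <= E2 ->
  psi A <= rho * expR (A / k%:R) -> xup e J A <= x -> m <= (lam e J + k%:R^-1) * A ->
  1 <= E1 * (1 - x + x ^+ 2 / 2 - x ^+ 3 / 6) -> 1 <= E2 * (1 + m + m ^+ 2 / 2 + m ^+ 3 / 6) ->
  rho * E1 + E2 <= 1 ->
  psi A * expR (xup e J A) + expR (- (lam e J * A)) <= expR (A / k%:R).
Proof.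
move=> k0 rho0 x01 m0 E10 E20 hpsi hx hm h1 h2 h.
have z0 := expR_gt0 (A / k%:R).
have ex : expR (xup e J A) <= E1.
  apply: (@le_trans _ _ (expR x)); first by rewrite ler_expR.
  apply: le_trans (expR_le_inv x01) _.
  have d0 : 0 < 1 - x + x ^+ 2 / 2 - x ^+ 3 / 6.
    by case/andP: x01 => x0 x1; nra.
  by rewrite -(@ler_pM2r _ (1 - x + x ^+ 2 / 2 - x ^+ 3 / 6)) // mulVf // gt_eqF.
have em : expR (- (lam e J * A)) <= E2 * expR (A / k%:R).
  rewrite -ler_pdivrMr // -expRN -expRD.
  apply: (@le_trans _ _ (expR (- m))).
    by rewrite ler_expR; move: hm; rewrite mulrDl [k%:R^-1 * A]mulrC; lra.
  apply: le_trans (expRN_le_inv m0) _.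
  have d0 : 0 < 1 + m + m ^+ 2 / 2 + m ^+ 3 / 6.
    by rewrite ltr_wpDr ?divr_ge0 ?exprn_ge0 // ltr_wpDr ?divr_ge0 ?exprn_ge0 // ltr_wpDr.
  by rewrite -(@ler_pM2r _ (1 + m + m ^+ 2 / 2 + m ^+ 3 / 6)) // mulVf // gt_eqF.
apply: (@le_trans _ _ (rho * expR (A / k%:R) * E1 + E2 * expR (A / k%:R))).
  rewrite lerD //; apply: le_trans (ler_wpM2r (expR_ge0 _) hpsi) _.
  by rewrite ler_wpM2l // mulr_ge0 // ltW.
have -> : rho * expR (A / k%:R) * E1 + E2 * expR (A / k%:R) = (rho * E1 + E2) * expR (A / k%:R) by ring.
by rewrite ler_piMl // ltW.
Qed.

Lemma both_plain k e J A m z E2 :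
  0 <= m -> 0 <= z -> m <= lam e J * A -> z <= A / k%:R ->
  1 <= E2 * (1 + m + m ^+ 2 / 2 + m ^+ 3 / 6) -> 1 + E2 <= 1 + z + z ^+ 2 / 2 + z ^+ 3 / 6 ->
  1 + expR (- (lam e J * A)) <= expR (A / k%:R).
Proof.
move=> m0 z0 hm hz h2 h.
have ez : 1 + z + z ^+ 2 / 2 + z ^+ 3 / 6 <= expR (A / k%:R).
  by apply: le_trans (expR_cubic z0) _; rewrite ler_expR.
apply: le_trans ez; apply: le_trans h; rewrite lerD2l.
apply: (@le_trans _ _ (expR (- m))); first by rewrite ler_expR lerN2.
apply: le_trans (expRN_le_inv m0) _.
have d0 : 0 < 1 + m + m ^+ 2 / 2 + m ^+ 3 / 6.
  by rewrite ltr_wpDr ?divr_ge0 ?exprn_ge0 // ltr_wpDr ?divr_ge0 ?exprn_ge0 // ltr_wpDr.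
by rewrite -(@ler_pM2r _ (1 + m + m ^+ 2 / 2 + m ^+ 3 / 6)) // mulVf // gt_eqF.
Qed.

Lemma xlow_le J0 A0 e J A c D q :
  0 <= e -> e < 1 -> 0 < J0 -> J0 <= J -> 0 < A0 -> A0 <= A ->
  57 / 80 <= (c - 1 / 3) * A0 -> 0 < D -> D <= (1 - e) * (1 + e / J) ->
  (J0 + 1) ^+ 2 * c <= q * (J0 ^+ 2 * D) -> xlow e J A <= q * e ^+ 2.
Proof.
move=> e0 e1 J00 JJ A00 AA hc D0 hD hq.
have hc' : 57 / 80 <= (c - 1 / 3) * (A0 * (1 + 0 / 3)) by rewrite mul0r addr0 mulr1.
have hcorr := corr_le (lexx 0) e0 A00 AA hc'.
have c0 : 0 <= corr e A by apply: corr_ge0 => //; exact: lt_le_trans AA.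
have /andP[r0 r1] := ratio_le J00 JJ.
have -> : xlow e J A = e ^+ 2 * (((J + 1) / J) ^+ 2 * ((1 - e) * (1 + e / J))^-1 * corr e A).
  by rewrite /xlow; ring.
rewrite mulrC; apply: ler_wpM2r; first exact: sqr_ge0.
apply: (@le_trans _ _ (((J0 + 1) / J0) ^+ 2 * D^-1 * c)).
  have D1 : 0 <= ((1 - e) * (1 + e / J))^-1 by rewrite invr_ge0 ltW // (lt_le_trans D0).
  apply: ler_pM => //; first by rewrite mulr_ge0 // sqr_ge0.
  apply: ler_pM => //; first exact: sqr_ge0.
    by rewrite lerXn2r ?nnegrE // (le_trans r0).
  by rewrite lef_pV2 ?posrE // (lt_le_trans D0).
rewrite (_ : _ * c = (J0 + 1) ^+ 2 * c / (J0 ^+ 2 * D)); last by field; rewrite !gt_eqF.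
by rewrite ler_pdivrMr // mulr_gt0 ?exprn_gt0.
Qed.

Lemma both_sharp k e J A E1 E2 rho :
  0 <= rho -> psi A <= rho * expR (A / k%:R) ->
  expR (xup e J A) <= E1 -> expR (xlow e J A - lam e J * A) <= E2 -> rho * (E1 + E2) <= 1 ->
  psi A * (expR (xup e J A) + expR (xlow e J A - lam e J * A)) <= expR (A / k%:R).
Proof.
move=> rho0 hpsi h1 h2 h.
have e0 : 0 <= expR (xup e J A) + expR (xlow e J A - lam e J * A) by rewrite addr_ge0 ?expR_ge0.
apply: le_trans (ler_wpM2r e0 hpsi) _.
have w : 0 <= rho * expR (A / k%:R) by rewrite mulr_ge0 ?expR_ge0.
apply: le_trans (ler_wpM2l w (lerD h1 h2)) _.
rewrite mulrAC; apply: ler_piMl => //; exact: expR_ge0.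
Qed.

Lemma expR_le_of_inv x y E : 0 <= y <= 1 -> x <= y ->
  1 <= E * (1 - y + y ^+ 2 / 2 - y ^+ 3 / 6) -> expR x <= E.
Proof.
move=> y01 xy h; apply: (@le_trans _ _ (expR y)); first by rewrite ler_expR.
apply: le_trans (expR_le_inv y01) _.
have d0 : 0 < 1 - y + y ^+ 2 / 2 - y ^+ 3 / 6 by case/andP: y01 => y0 y1; nra.
by rewrite -(@ler_pM2r _ (1 - y + y ^+ 2 / 2 - y ^+ 3 / 6)) // mulVf // gt_eqF.
Qed.

(** From exp x <= 1 / (1 - x) and exp (- y) <= 1 / (1 + y). *)
Lemma sum_expR_le2 X Y x y : X <= x -> y <= Y -> 0 <= y -> x + 2 * x * y <= y ->
  expR X + expR (- Y) <= 2.
Proof.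
move=> Xx yY y0 h.
have x1 : x < 1 by nra.
have hX : expR X <= (1 - x)^-1.
  apply: (@le_trans _ _ (expR x)); first by rewrite ler_expR.
  rewrite -[expR x]invrK -expRN lef_pV2 ?posrE ?expR_gt0 ?subr_gt0 //.
  exact: expR_ge1Dx.
have hY : expR (- Y) <= (1 + y)^-1.
  apply: (@le_trans _ _ (expR (- y))); first by rewrite ler_expR lerN2.
  by rewrite expRN lef_pV2 ?posrE ?expR_gt0 ?expR_ge1Dx //; lra.
apply: le_trans (lerD hX hY) _.
have d1 : 0 < 1 - x by lra.
have d2 : 0 < 1 + y by lra.
rewrite (_ : (1 - x)^-1 + (1 + y)^-1 = ((1 + y) + (1 - x)) / ((1 - x) * (1 + y))); last by field; rewrite !gt_eqF.
by rewrite ler_pdivrMr ?mulr_gt0 //; lra.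
Qed.

(** The three ways in which the two tails can fit into exp (A / k), after
    division by exp (- A): plain bounds for both, a sharp one for the upper
    tail only, sharp ones for both. *)
Definition regime k e J A : Prop :=
  [\/ 1 + expR (- (lam e J * A)) <= expR (A / k%:R),
      psi A * expR (xup e J A) + expR (- (lam e J * A)) <= expR (A / k%:R) |
      e <= 2 / 5 /\ psi A * (expR (xup e J A) + expR (xlow e J A - lam e J * A)) <= expR (A / k%:R)].

Lemma regime3 e A : 0 < e <= 1 -> 3%:R / (3%:R - 1) * ln 3%:R <= A -> regime 3 e 2 A.
Proof.
move=> /andP[e0 e1] hA; have hpsi := psi_base3 hA.
have [A0 z0] := @log_interval R 3 3 3 A (549 / 500) (1647 / 1000) (549 / 1000) isT isT (@ln3_ge R)
  ltac:(clear; lra) ltac:(clear; lra) ltac:(clear; lra) hA.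
clear hA; have A00 : 0 < A by lra.
have [el|el] := leP e (2 / 5).
  apply: Or33; split => //; apply: (@both_sharp 3 e 2 A (129 / 100) (107 / 100) (52 / 125)) hpsi _ _ _; try numeric.
    apply: (@expR_le_of_inv _ (247 / 1000)); try numeric.
    apply: (@xup_le 0 (2 / 5) 2 (1647 / 1000) e 2 A (383 / 500)); try numeric.
  have hl : e / 2 <= lam e 2 by apply: (@lam_ge e e 2 2); try numeric; clear -e0 e1; nra.
  have hx : xlow e 2 A <= 24 / 10 * e ^+ 2.
    apply: (@xlow_le 2 (1647 / 1000) e 2 A (383 / 500) (72 / 100)); try numeric; try (clear -e0 el; lra).
    clear -e0 el; nra.
  apply: (@expR_le_of_inv _ (66 / 1000)); try numeric.
  have : e / 2 * (1647 / 1000) <= lam e 2 * A.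
    by apply: ler_pM; try numeric; clear -e0; lra.
  clear -e0 el hx; nra.
apply: Or31; apply: (@both_plain 3 e 2 A (37 / 100) (549 / 1000) (173 / 250)) z0 _ _; try numeric.
apply: (@le_trans _ _ (9 / 40 * (1647 / 1000))); first by clear; lra.
apply: ler_pM; try numeric.
by apply: (@lam_ge (2 / 5) e 2 2); try numeric; exact: ltW.
Qed.

Lemma regime4 e A : 0 < e <= 1 -> 4%:R / (4%:R - 1) * ln 4%:R <= A -> regime 4 e 3 A.
Proof.
move=> /andP[e0 e1] hA; have hpsi := psi_base4 hA.
have [A0 z0] := @log_interval R 4 4 4 A (277 / 200) (923 / 500) (461 / 1000) isT isT (@ln4_ge R)
  ltac:(clear; lra) ltac:(clear; lra) ltac:(clear; lra) hA.
clear hA; have A00 : 0 < A by lra.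
have [el|el] := leP e (2 / 5).
  apply: Or33; split => //; apply: (@both_sharp 4 e 3 A (119 / 100) 1 (437 / 1000)) hpsi _ _ _; try numeric.
    apply: (@expR_le_of_inv _ (17 / 100)); try numeric.
    apply: (@xup_le 0 (2 / 5) 3 (923 / 500) e 3 A (18 / 25)); try numeric.
  have hl : 55 / 100 * e <= lam e 3 by apply: (@lam_ge e e 3 3); try numeric; clear -e0 e1; nra.
  have hx : xlow e 3 A <= 19 / 10 * e ^+ 2.
    apply: (@xlow_le 3 (923 / 500) e 3 A (18 / 25) (68 / 100)); try numeric; try (clear -e0 el; lra).
    clear -e0 el; nra.
  apply: (@le_trans _ _ (expR 0)); last by rewrite expR0.
  rewrite ler_expR.
  have : 55 / 100 * e * (923 / 500) <= lam e 3 * A.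
    by apply: ler_pM; try numeric; clear -e0; lra.
  clear -e0 el hx; nra.
have [el2|el2] := leP e (1 / 2).
  apply: Or32; apply: (@upper_sharp 4 e 3 A (6 / 25) (463 / 500) (159 / 125) (403 / 1000) (437 / 1000)) hpsi _ _ _ _ _; try numeric.
    by apply: (@xup_le (2 / 5) (1 / 2) 3 (923 / 500) e 3 A (337 / 500)); try numeric; exact: ltW.
  apply: (@le_trans _ _ ((63 / 250 + 4^-1) * (923 / 500))); first by clear; lra.
  apply: ler_pM; try numeric.
  rewrite lerD2r.
  by apply: (@lam_ge (2 / 5) e 3 3); try numeric; exact: ltW.
apply: Or31; apply: (@both_plain 4 e 3 A (601 / 1000) (461 / 1000) (551 / 1000)) z0 _ _; try numeric.
apply: (@le_trans _ _ (163 / 500 * (923 / 500))); first by clear; lra.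
apply: ler_pM; try numeric.
by apply: (@lam_ge (1 / 2) e 3 3); try numeric; exact: ltW.
Qed.

End Cases.

(** * Which pair of tail bounds suffices: five dimensions and more *)

Section Cases.
Variable R : realType.
Implicit Types (e J A x m rho el er c : R).

(** (l + 1) K - k0 is a lower bound for K ln K, by ln x >= 1 - 1/x at x = K /
    k0. *)
Lemma growth_ge (k0 k : nat) A (l A0 : R) : (0 < k0)%N -> (k0 <= k)%N -> (1 < k)%N -> l <= ln k0%:R ->
  A0 * (k0%:R - 1) <= l * k0%:R -> A0 <= l + 1 ->
  k%:R / (k%:R - 1) * ln k%:R <= A -> A0 <= A.
Proof.
move=> k00 kk k1 hl h1 h2; have K00 : 0 < k0%:R :> R by rewrite ltr0n.
have K0K : k0%:R <= k%:R :> R by rewrite ler_nat.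
have K1 : 1 < k%:R :> R by rewrite ltr1n.
move: (k0%:R : R) (k%:R : R) K00 K0K K1 hl h1 => L K L0 LK K1 hl h1.
have K0 : 0 < K by lra.
apply: le_trans; rewrite mulrAC ler_pdivlMr ?subr_gt0 //.
have d0 : 0 < 2 * K * (K + 2 * L) by rewrite !mulr_gt0 // addr_gt0 // mulr_gt0.
have hln : l * K + (K - L) <= K * ln K.
  have := ln_sub_ge_pade L0 K0; have : (K - L) / K <= (K - L) * (5 * K + L) / (2 * K * (K + 2 * L)).
    rewrite ler_pdivlMr // (_ : (K - L) / K * _ = (K - L) * (2 * (K + 2 * L))); last by field; rewrite gt_eqF.
    by apply: ler_wpM2l; [rewrite subr_ge0|lra].
  move=> a b; have {}a : l + (K - L) / K <= ln K by lra.
  have := ler_wpM2l (ltW K0) a; rewrite mulrDr (_ : K * ((K - L) / K) = K - L); last by field; rewrite gt_eqF.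
  lra.
apply: le_trans hln; nra.
Qed.

(** The decay m0 guaranteed by a rate l0 for all k is increased when the rate
    is l1. *)
Lemma decay_ge (k : nat) e J A (l0 l1 A0 m0 : R) : 0 < k%:R - 1 :> R -> l0 <= l1 -> l1 <= lam e J ->
  0 <= l0 -> 0 < A0 -> A0 <= A -> m0 * (k%:R - 1) <= (l0 * k%:R + 1) * ln k%:R ->
  k%:R / (k%:R - 1) * ln k%:R <= A -> m0 + (l1 - l0) * A0 <= (lam e J + k%:R^-1) * A.
Proof.
move: (k%:R : R) (ln _) => K lnK K1 l01 hl l00 A00 AA hm hA.
have K0 : 0 < K by lra.
have -> : (lam e J + K^-1) * A = (l0 + K^-1) * A + (lam e J - l0) * A by ring.
apply: lerD; last by apply: ler_pM => //; lra.
have c0 : 0 <= l0 + K^-1 by rewrite addr_ge0 // invr_ge0 ltW.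
apply: le_trans (ler_wpM2l c0 hA).
rewrite (_ : (l0 + K^-1) * _ = (l0 * K + 1) * lnK / (K - 1)); last by field; rewrite !gt_eqF.
by rewrite ler_pdivlMr.
Qed.

(** The difference of both sides is not monotone in k; its minimum is near k =
    7. *)
Lemma decay5 (k : nat) : (5 <= k)%N -> 92 / 100 * (k%:R - 1) <= (265 / 1000 * k%:R + 1) * ln k%:R :> R.
Proof.
move=> k5; have K5 : 5%:R <= k%:R :> R by rewrite ler_nat.
have l5 : 1608 / 1000 <= ln 5%:R :> R by have := @ln5_ge R; clear; lra.
move: (k%:R : R) K5 => K K5; have h := @ln_sub_ge_pade R 5%:R K ltac:(lra) ltac:(lra).
have d0 : 0 < 2 * K * (K + 2 * 5) by rewrite !mulr_gt0 //; lra.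
have c0 : 0 <= 265 / 1000 * K + 1 by lra.
have {h}l5 := le_trans (lerD l5 h) (_ : _ <= ln K); have {}l5 := l5 ltac:(lra).
apply: le_trans (ler_wpM2l c0 l5).
rewrite -(@ler_pM2r _ (2 * K * (K + 2 * 5))) //.
rewrite [leRHS](_ : _ = (265 / 1000 * K + 1) * (1608 / 1000 * (2 * K * (K + 2 * 5)) + (K - 5) * (5 * K + 5))); last first.
  by field; rewrite !gt_eqF //=; lra.
have [t [t0 ->]] : exists t, 0 <= t /\ K = t + 5 by exists (K - 5); split; lra.
have h1 : 0 <= t * (t - 7 / 5) ^+ 2 by rewrite mulr_ge0 ?sqr_ge0.
have h2 := sqr_ge0 (t - 8 / 5); clear -t0 h1 h2; lra.
Qed.

Lemma decay6 (k : nat) : (6 <= k)%N -> 129 / 100 * (k%:R - 1) <= (442 / 1000 * k%:R + 1) * ln k%:R :> R.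
Proof.
move=> k5; have K5 : 6%:R <= k%:R :> R by rewrite ler_nat.
have l5 : 1790 / 1000 <= ln 6%:R :> R by apply: (@ln_step R 5 6 _ _ isT isT (@ln5_ge R)); clear; lra.
move: (k%:R : R) K5 => K K5; have h := @ln_sub_ge_pade R 6%:R K ltac:(lra) ltac:(lra).
have d0 : 0 < 2 * K * (K + 2 * 6) by rewrite !mulr_gt0 //; lra.
have c0 : 0 <= 442 / 1000 * K + 1 by lra.
have {h}l5 := le_trans (lerD l5 h) (_ : _ <= ln K); have {}l5 := l5 ltac:(lra).
apply: le_trans (ler_wpM2l c0 l5).
rewrite -(@ler_pM2r _ (2 * K * (K + 2 * 6))) //.
rewrite [leRHS](_ : _ = (442 / 1000 * K + 1) * (1790 / 1000 * (2 * K * (K + 2 * 6)) + (K - 6) * (5 * K + 6))); last first.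
  by field; rewrite !gt_eqF //=; lra.
have [t [t0 ->]] : exists t, 0 <= t /\ K = t + 6 by exists (K - 6); split; lra.
have t2 := mulr_ge0 t0 t0; have t3 := mulr_ge0 t0 t2; clear -t0 t2 t3; lra.
Qed.

(** For small e the loss xup is quadratic in e, while the gain lam e J * A is
    linear. *)
Lemma sharp_pair_le2 e J A : 4 <= J -> 201 / 100 <= A -> 0 < e -> e <= 1 -> e <= 2 / 5 ->
  expR (xup e J A) + expR (xlow e J A - lam e J * A) <= 2.
Proof.
move=> hJ A0 e0 e1 el; have A00 : 0 < A by clear -A0; lra.
have hup : xup e J A <= e ^+ 2 * (108 / 100 - e / 2).
  apply: (@xup_le R 0 e 4 (201 / 100) e J A (688 / 1000)); try numeric; try (clear -el; lra).
  clear -e0 el; nra.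
have hx : xlow e J A <= 18 / 10 * e ^+ 2.
  apply: (@xlow_le R 4 (201 / 100) e J A (688 / 1000) (60 / 100)); try numeric; try (clear -e0 el; lra).
  have eJ : 0 <= e / J by apply: divr_ge0; clear -e0 hJ; lra.
  clear -e0 el eJ; nra.
have hl : 7 / 12 * e + 14 / 100 * e ^+ 2 <= lam e J.
  by apply: (@lam_ge R e e 4 J); try numeric; clear -e0 e1; nra.
have hlA : (7 / 12 * e + 14 / 100 * e ^+ 2) * (201 / 100) <= lam e J * A.
  by apply: ler_pM; try numeric; clear -e0; nra.
rewrite -[xlow _ _ _ - _]opprB.
have y0 : 0 <= 1172 / 1000 - 152 / 100 * e by clear -el; lra.
apply: (sum_expR_le2 (y := e * (1172 / 1000 - 152 / 100 * e)) hup).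
- clear -e0 hx hlA; nra.
- exact: mulr_ge0 (ltW e0) y0.
have -> : e ^+ 2 * (108 / 100 - e / 2) + 2 * (e ^+ 2 * (108 / 100 - e / 2)) * (e * (1172 / 1000 - 152 / 100 * e)) =
  e * (e * (108 / 100 - e / 2) * (1 + 2 * e * (1172 / 1000 - 152 / 100 * e))) by ring.
apply: ler_wpM2l; first exact: ltW.
have h1 : e * (108 / 100 - e / 2) <= 352 / 1000 by clear -e0 el; nra.
have h2 : 1 + 2 * e * (1172 / 1000 - 152 / 100 * e) <= 146 / 100.
  by have := sqr_ge0 (e - 77 / 200); clear -e0 el; lra.
apply: (@le_trans _ _ (352 / 1000 * (146 / 100))); last by clear -el; lra.
have w0 : 0 <= 108 / 100 - e / 2 by clear -el; lra.
apply: ler_pM h1 h2; first exact: mulr_ge0 (ltW e0) w0.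
clear -e0 y0; nra.
Qed.

(** For e above 2/5 the upper tail is sharp and the lower one plain. This is
    checked on short intervals of e, each with the correction exponent at its
    right end and the decay rate at its left end. In five dimensions both
    bounds are plain for e above 3/5. *)
Lemma regime5 (k : nat) e A : (5 <= k)%N -> 0 < e <= 1 -> k%:R / (k%:R - 1) * ln k%:R <= A ->
  regime k e (k%:R - 1) A.
Proof.
move=> k5 /andP[e0 e1] hA; have hpsi := psi_base k5 hA.
have k1 : (1 < k)%N by rewrite (leq_trans _ k5).
have k0 : 0 < k%:R :> R by rewrite ltr0n ltnW.
have K5 : 5%:R <= k%:R :> R by rewrite ler_nat.
have A0 : 201 / 100 <= A.
  apply: (@growth_ge 5 k A (1608 / 1000)) hA => //; last by clear; lra.
    by have := @ln5_ge R; clear; lra.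
  by clear; lra.
have A00 : 0 < A by clear -A0; lra.
have hJ : 4 <= k%:R - 1 :> R by clear -K5; lra.
have hJ0 : 0 < k%:R - 1 :> R by clear -K5; lra.
have rho0 : 0 <= 2^-1 :> R by clear; lra.
have [el|el] := leP e (2 / 5).
  apply: Or33; split; first exact: el.
  have hT := sharp_pair_le2 hJ A0 e0 e1 el.
  apply: le_trans (ler_wpM2r _ hpsi) _; first by rewrite addr_ge0 ?expR_ge0.
  apply: le_trans (ler_wpM2l _ hT) _; first by rewrite mulr_ge0 ?expR_ge0.
  by rewrite mulrAC mulVf ?mul1r // pnatr_eq0.
have hd5 := decay5 k5.
have [er|er] := leP e (9 / 20).
  have hl : 53 / 200 <= lam e (k%:R - 1) by apply: (@lam_ge R (2 / 5) e 4 (k%:R - 1)); try numeric; exact: ltW.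
  have hm := @decay_ge k e (k%:R - 1) A (265 / 1000) (53 / 200) (201 / 100) (92 / 100) hJ0 ltac:(clear; lra) hl ltac:(clear; lra) ltac:(clear; lra) A0 hd5 hA.
  apply: Or32; apply: (@upper_sharp R k e (k%:R - 1) A (4 / 25) (23 / 25) (587 / 500) (81 / 200) 2^-1) hpsi _ _ _ _ _; try numeric.
    by apply: (@xup_le R (2 / 5) (9 / 20) 4 (201 / 100) e (k%:R - 1) A (647 / 1000)); try numeric; exact: ltW.
  by apply: le_trans hm; clear; lra.
clear el; have el := er; clear er.
have [er|er] := leP e (1 / 2).
  have hl : 38 / 125 <= lam e (k%:R - 1) by apply: (@lam_ge R (9 / 20) e 4 (k%:R - 1)); try numeric; exact: ltW.
  have hm := @decay_ge k e (k%:R - 1) A (265 / 1000) (38 / 125) (201 / 100) (92 / 100) hJ0 ltac:(clear; lra) hl ltac:(clear; lra) ltac:(clear; lra) A0 hd5 hA.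
  apply: Or32; apply: (@upper_sharp R k e (k%:R - 1) A (24 / 125) (499 / 500) (303 / 250) (47 / 125) 2^-1) hpsi _ _ _ _ _; try numeric.
    by apply: (@xup_le R (9 / 20) (1 / 2) 4 (201 / 100) e (k%:R - 1) A (321 / 500)); try numeric; exact: ltW.
  by apply: le_trans hm; clear; lra.
clear el; have el := er; clear er.
have [er|er] := leP e (11 / 20).
  have hl : 43 / 125 <= lam e (k%:R - 1) by apply: (@lam_ge R (1 / 2) e 4 (k%:R - 1)); try numeric; exact: ltW.
  have hm := @decay_ge k e (k%:R - 1) A (265 / 1000) (43 / 125) (201 / 100) (92 / 100) hJ0 ltac:(clear; lra) hl ltac:(clear; lra) ltac:(clear; lra) A0 hd5 hA.
  apply: Or32; apply: (@upper_sharp R k e (k%:R - 1) A (113 / 500) (539 / 500) (627 / 500) (349 / 1000) 2^-1) hpsi _ _ _ _ _; try numeric.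
    by apply: (@xup_le R (1 / 2) (11 / 20) 4 (201 / 100) e (k%:R - 1) A (319 / 500)); try numeric; exact: ltW.
  by apply: le_trans hm; clear; lra.
clear el; have el := er; clear er.
have [er|er] := leP e (3 / 5).
  have hl : 77 / 200 <= lam e (k%:R - 1) by apply: (@lam_ge R (11 / 20) e 4 (k%:R - 1)); try numeric; exact: ltW.
  have hm := @decay_ge k e (k%:R - 1) A (265 / 1000) (77 / 200) (201 / 100) (92 / 100) hJ0 ltac:(clear; lra) hl ltac:(clear; lra) ltac:(clear; lra) A0 hd5 hA.
  apply: Or32; apply: (@upper_sharp R k e (k%:R - 1) A (131 / 500) (1161 / 1000) (13 / 10) (81 / 250) 2^-1) hpsi _ _ _ _ _; try numeric.
    by apply: (@xup_le R (11 / 20) (3 / 5) 4 (201 / 100) e (k%:R - 1) A (633 / 1000)); try numeric; exact: ltW.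
  by apply: le_trans hm; clear; lra.
clear el; have el := er; clear er.
clear hd5 A0; have [k6|k6] := leqP k 5.
  have kE : k = 5%N by apply/eqP; rewrite eqn_leq k6.
  rewrite kE in hA *.
  have [A0 z0] := @log_interval R 5 5 5 A (201 / 125) (201 / 100) (201 / 500) isT isT (@ln5_ge R)
    ltac:(clear; lra) ltac:(clear; lra) ltac:(clear; lra) hA.
  apply: Or31; apply: (@both_plain R 5 e _ A (43 / 50) (201 / 500) (429 / 1000)) z0 _ _; try numeric.
  apply: (@le_trans _ _ (107 / 250 * (201 / 100))); first by clear; lra.
  apply: ler_pM; try numeric.
  by apply: (@lam_ge R (3 / 5) e 4 _); try numeric; exact: ltW.
have hd6 := decay6 k6.
have A0 : 537 / 250 <= A.
  apply: (@growth_ge 6 k A (1790 / 1000)) hA => //; try (clear; lra).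
  by apply: (@ln_step R 5 6 _ _ isT isT (@ln5_ge R)); clear; lra.
have {}hJ : 5 <= k%:R - 1 :> R.
  have : 6%:R <= k%:R :> R by rewrite ler_nat.
  by clear; lra.
have [er|er] := leP e (7 / 10).
  have hl : 221 / 500 <= lam e (k%:R - 1) by apply: (@lam_ge R (3 / 5) e 5 (k%:R - 1)); try numeric; exact: ltW.
  have hm := @decay_ge k e (k%:R - 1) A (442 / 1000) (221 / 500) (537 / 250) (129 / 100) hJ0 ltac:(clear; lra) hl ltac:(clear; lra) ltac:(clear; lra) A0 hd6 hA.
  apply: Or32; apply: (@upper_sharp R k e (k%:R - 1) A (59 / 200) (129 / 100) (168 / 125) (36 / 125) 2^-1) hpsi _ _ _ _ _; try numeric.
    by apply: (@xup_le R (3 / 5) (7 / 10) 5 (537 / 250) e (k%:R - 1) A (61 / 100)); try numeric; exact: ltW.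
  by apply: le_trans hm; clear; lra.
clear el; have el := er; clear er.
have [er|er] := leP e (4 / 5).
  have hl : 67 / 125 <= lam e (k%:R - 1) by apply: (@lam_ge R (7 / 10) e 5 (k%:R - 1)); try numeric; exact: ltW.
  have hm := @decay_ge k e (k%:R - 1) A (442 / 1000) (67 / 125) (537 / 250) (129 / 100) hJ0 ltac:(clear; lra) hl ltac:(clear; lra) ltac:(clear; lra) A0 hd6 hA.
  apply: Or32; apply: (@upper_sharp R k e (k%:R - 1) A (46 / 125) (1491 / 1000) (1447 / 1000) (241 / 1000) 2^-1) hpsi _ _ _ _ _; try numeric.
    by apply: (@xup_le R (7 / 10) (4 / 5) 5 (537 / 250) e (k%:R - 1) A (603 / 1000)); try numeric; exact: ltW.
  by apply: le_trans hm; clear; lra.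
clear el; have el := er; clear er.
have [er|er] := leP e (9 / 10).
  have hl : 639 / 1000 <= lam e (k%:R - 1) by apply: (@lam_ge R (4 / 5) e 5 (k%:R - 1)); try numeric; exact: ltW.
  have hm := @decay_ge k e (k%:R - 1) A (442 / 1000) (639 / 1000) (537 / 250) (129 / 100) hJ0 ltac:(clear; lra) hl ltac:(clear; lra) ltac:(clear; lra) A0 hd6 hA.
  apply: Or32; apply: (@upper_sharp R k e (k%:R - 1) A (447 / 1000) (1713 / 1000) (196 / 125) (1 / 5) 2^-1) hpsi _ _ _ _ _; try numeric.
    by apply: (@xup_le R (4 / 5) (9 / 10) 5 (537 / 250) e (k%:R - 1) A (149 / 250)); try numeric; exact: ltW.
  by apply: le_trans hm; clear; lra.
clear el; have el := er; clear er.
have [er|er] := leP e (47 / 50).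
  have hl : 94 / 125 <= lam e (k%:R - 1) by apply: (@lam_ge R (9 / 10) e 5 (k%:R - 1)); try numeric; exact: ltW.
  have hm := @decay_ge k e (k%:R - 1) A (442 / 1000) (94 / 125) (537 / 250) (129 / 100) hJ0 ltac:(clear; lra) hl ltac:(clear; lra) ltac:(clear; lra) A0 hd6 hA.
  apply: Or32; apply: (@upper_sharp R k e (k%:R - 1) A (119 / 250) (391 / 200) (323 / 200) (41 / 250) 2^-1) hpsi _ _ _ _ _; try numeric.
    by apply: (@xup_le R (9 / 10) (47 / 50) 5 (537 / 250) e (k%:R - 1) A (589 / 1000)); try numeric; exact: ltW.
  by apply: le_trans hm; clear; lra.
clear el; have el := er; clear er.
have [er|er] := leP e (97 / 100).
  have hl : 799 / 1000 <= lam e (k%:R - 1) by apply: (@lam_ge R (47 / 50) e 5 (k%:R - 1)); try numeric; exact: ltW.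
  have hm := @decay_ge k e (k%:R - 1) A (442 / 1000) (799 / 1000) (537 / 250) (129 / 100) hJ0 ltac:(clear; lra) hl ltac:(clear; lra) ltac:(clear; lra) A0 hd6 hA.
  apply: Or32; apply: (@upper_sharp R k e (k%:R - 1) A (501 / 1000) (257 / 125) (1657 / 1000) (19 / 125) 2^-1) hpsi _ _ _ _ _; try numeric.
    by apply: (@xup_le R (47 / 50) (97 / 100) 5 (537 / 250) e (k%:R - 1) A (293 / 500)); try numeric; exact: ltW.
  by apply: le_trans hm; clear; lra.
clear el; have el := er; clear er.
have er := e1.
have hl : 209 / 250 <= lam e (k%:R - 1) by apply: (@lam_ge R (97 / 100) e 5 (k%:R - 1)); try numeric; exact: ltW.
have hm := @decay_ge k e (k%:R - 1) A (442 / 1000) (209 / 250) (537 / 250) (129 / 100) hJ0 ltac:(clear; lra) hl ltac:(clear; lra) ltac:(clear; lra) A0 hd6 hA.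
apply: Or32; apply: (@upper_sharp R k e (k%:R - 1) A (263 / 500) (267 / 125) (1701 / 1000) (143 / 1000) 2^-1) hpsi _ _ _ _ _; try numeric.
  by apply: (@xup_le R (97 / 100) (1) 5 (537 / 250) e (k%:R - 1) A (73 / 125)); try numeric; exact: ltW.
by apply: le_trans hm; clear; lra.
Qed.

Lemma regimeP (k : nat) e A : (3 <= k)%N -> 0 < e <= 1 -> k%:R / (k%:R - 1) * ln k%:R <= A ->
  regime k e (k%:R - 1) A.
Proof.
move=> k3 e01 hA; have [k5|k5] := leqP 5 k; first exact: regime5.
have [k4|k4] := leqP 4 k.
  have kE : k = 4%N by apply/eqP; rewrite eqn_leq k4 -ltnS k5.
  rewrite kE in hA *; have -> : 4%:R - 1 = 3 :> R by ring.
  exact: regime4.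
have kE : k = 3%N by apply/eqP; rewrite eqn_leq k3 -ltnS k4.
rewrite kE in hA *; have -> : 3%:R - 1 = 2 :> R by ring.
exact: regime3.
Qed.

End Cases.

(** * The two binomial tails at the given sample size *)

Section Tails.
Variable R : realType.
Implicit Types (p pt e A D : R) (c k : nat).

(** B bounds the third moment of the excess over some s below c pt, normalised
    so that by Markov's inequality it bounds the probability of reaching c
    pt. *)
Definition tail_bound c p pt (B : R) : Prop :=
  exists2 s, s < c%:R * pt & bin_cube c p s <= B * (c%:R * pt - s) ^+ 3.

Lemma tail_plain c p pt D : 0 < p -> p < pt -> pt < 1 -> (0 < c)%N -> D <= c%:R * kl pt p ->
  tail_bound c p pt (expR (- D)).
Proof.
move=> p0 ppt pt1 c0 hD; have [s sm h] := bin_cube_plain p0 ppt pt1 c0.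
exists s => //; apply: (le_trans h); apply: ler_wpM2r.
  by rewrite exprn_ge0 // subr_ge0 ltW.
by rewrite ler_expR lerN2.
Qed.

(** The level c is reached only if all trials succeed. *)
Lemma tail_top c p D : 0 < p -> (0 < c)%N -> D <= - (c%:R * ln p) -> tail_bound c p 1 (expR (- D)).
Proof.
move=> p0 c0 hD; exists (c.-1)%:R.
  by rewrite mulr1 ltr_nat prednK.
have -> : bin_cube c p c.-1%:R = p ^+ c.
  rewrite /bin_cube big_ord_recr /= big1 ?add0r => [|i _].
    rewrite /bin_pmf binn subnn expr0 mul1r mulr1.
    by rewrite -natrB ?leq_pred // /pcube -[in (c - _)%N](prednK c0) subSnn max_r // expr1n mulr1.
  rewrite /pcube max_l ?expr0n ?mulr0 // subr_le0 ler_nat -ltnS prednK //.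
rewrite mulr1 -natrB ?leq_pred // -[in (c - _)%N](prednK c0) subSnn expr1n mulr1.
have -> : p ^+ c = expR (c%:R * ln p) by rewrite mulrC expRM_natr lnK.
by rewrite ler_expR; lra.
Qed.

Lemma kl_upper (K e : R) : 1 < K -> 0 < e -> 1 + e < K ->
  e ^+ 2 / (2 * (K - 1) * (1 + e / 3)) <= kl ((1 + e) / K) K^-1.
Proof.
move=> K1 e0 eK; have K0 : 0 < K by lra.
apply: le_trans (kl_ge _ _); last first.
- by rewrite divr_gt0 ?ltr_pdivrMr ?mul1r //; lra.
- by rewrite invr_gt0 K0 invf_lt1.
have -> : ((1 + e) / K - K^-1) ^+ 2 / (2 * (K^-1 + ((1 + e) / K - K^-1) / 3) * (1 - K^-1 - ((1 + e) / K - K^-1) / 3)) =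
  e ^+ 2 / (2 * (K - 1 - e / 3) * (1 + e / 3)).
  by field; rewrite !gt_eqF //=; lra.
apply: ler_wpM2l; first exact: sqr_ge0.
have h : 0 < 1 + e / 3 by lra.
rewrite lef_pV2 ?posrE; [|by apply: mulr_gt0 => //; lra..].
by apply: ler_wpM2r; lra.
Qed.

Lemma kl_lower (K e : R) : 1 < K -> 0 < e -> e < 1 ->
  e ^+ 2 / (2 * (K - 1) * ((1 - e / 3) * (1 + e / (3 * (K - 1))))) <= kl (1 - (1 - e) / K) (1 - K^-1).
Proof.
move=> K1 e0 e1; have K0 : 0 < K by lra.
have iK : K^-1 < 1 by rewrite invf_lt1.
have iK0 : 0 < K^-1 by rewrite invr_gt0.
apply: le_trans (kl_ge _ _); last first.
- have : 0 < (1 - e) / K < 1 by rewrite divr_gt0 ?ltr_pdivrMr ?mul1r //; lra.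
  by case/andP => *; rewrite subr_gt0 gtrBl; apply/andP.
- by rewrite subr_gt0 gtrBl; apply/andP.
rewrite le_eqVlt; apply/orP; left; apply/eqP; field; rewrite !gt_eqF //=; lra.
Qed.

(** At A = c e^2 / (2 (k - 1) (1 + e/3)) the hypothesis on c leaves exactly a
    factor exp (A / k) for the sum of the tails divided by exp (- A). *)
Lemma two_tails_ge3 c k e (delta : R) : (3 <= k)%N -> (0 < c)%N -> 0 < e <= 1 -> 0 < delta < 1 ->
  (2 + 2 * e / 3) * k%:R * (ln (k%:R / delta) / e ^+ 2) <= c%:R ->
  exists U L, [/\ 0 <= U, 0 <= L, tail_bound c k%:R^-1 ((1 + e) / k%:R) U,
    tail_bound c (1 - k%:R^-1) (1 - (1 - e) / k%:R) L & k%:R * (U + L) <= delta].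
Proof.
move=> k3 c0 e01 /andP[d0 d1] hc; have /andP[e0 e1] := e01.
pose K : R := k%:R; have K3 : 3 <= K by rewrite /K (ler_nat _ 3).
have C0 : 0 < c%:R :> R by rewrite ltr0n.
have K0 : 0 < K by lra.
have J0 : 0 < K - 1 by lra.
have e3 : 0 < 1 + e / 3 by lra.
pose a := c%:R * e ^+ 2 / (2 * (K - 1)); pose A := a / (1 + e / 3).
have a0 : 0 < a by rewrite divr_gt0 ?mulr_gt0 ?exprn_gt0.
have A0 : 0 < A by rewrite divr_gt0.
have aE : a = A * (1 + e / 3) by rewrite /A divfK // gt_eqF.
have Aa : A <= a by rewrite aE ler_peMr ?ltW //; lra.
have hA : ln (K / delta) <= A * (1 - K^-1).
  have -> : A * (1 - K^-1) = c%:R * (e ^+ 2 / ((2 + 2 * e / 3) * K)).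
    by rewrite /A /a; field; rewrite !gt_eqF //=; clear -K3 e0 e1; lra.
  have q0 : 0 < (2 + 2 * e / 3) * K by rewrite mulr_gt0 //; lra.
  have z0 : 0 <= e ^+ 2 / ((2 + 2 * e / 3) * K) by rewrite divr_ge0 ?sqr_ge0 // ltW.
  apply: le_trans (ler_wpM2r z0 hc); rewrite -/K le_eqVlt; apply/orP; left; apply/eqP.
  by field; rewrite !gt_eqF //=; clear -K3 e0 e1; lra.
have hln : ln K <= ln (K / delta).
  by rewrite ler_ln ?posrE ?divr_gt0 // ler_pdivlMr // ler_piMr // ltW.
have hAK : K / (K - 1) * ln K <= A.
  rewrite mulrAC ler_pdivrMr //; have := ler_wpM2l (ltW K0) (le_trans hln hA).
  by rewrite (_ : K * (A * (1 - K^-1)) = A * (K - 1)) //; field; rewrite gt_eqF.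
have fin F : F <= expR (A / K) -> K * (expR (- A) * F) <= delta.
  move=> hF; have h1 : expR (- A) * F <= expR (- ln (K / delta)).
    apply: le_trans (ler_wpM2l (expR_ge0 _) hF) _; rewrite -expRD ler_expR.
    by move: hA; rewrite mulrBr mulr1; lra.
  apply: le_trans (ler_wpM2l (ltW K0) h1) _.
  rewrite expRN lnK ?posrE ?divr_gt0 // le_eqVlt; apply/orP; left; apply/eqP.
  by field; rewrite !gt_eqF.
have lE : expR (- (A * (1 + lam e (K - 1)))) = expR (- A) * expR (- (lam e (K - 1) * A)).
  by rewrite -expRD; congr expR; ring.
have p0 : 0 < K^-1 by rewrite invr_gt0.
have ppt : K^-1 < (1 + e) / K by rewrite -[ltLHS]mul1r ltr_pM2r //; lra.
have pt1 : (1 + e) / K < 1 by rewrite ltr_pdivrMr //; lra.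
have hD : A <= c%:R * kl ((1 + e) / K) K^-1.
  have h := @kl_upper K e ltac:(lra) e0 ltac:(lra).
  apply: le_trans (ler_wpM2l (ltW C0) h); rewrite le_eqVlt; apply/orP; left; apply/eqP.
  by rewrite /A /a; field; rewrite !gt_eqF //=; clear -K3 e0 e1; lra.
have U1 := tail_plain p0 ppt pt1 c0 hD.
have q0 : 0 < 1 - K^-1 by rewrite subr_gt0 invf_lt1 //; lra.
have qpt : 1 - K^-1 < 1 - (1 - e) / K.
  by rewrite ltrD2l ltrN2 -[ltRHS]mul1r ltr_pM2r //; lra.
have lamE : A * (1 + lam e (K - 1)) = a / ((1 - e / 3) * (1 + e / (3 * (K - 1)))).
  by rewrite /lam /A; field; rewrite !gt_eqF //=; clear -K3 e0 e1; lra.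
have L1 : tail_bound c (1 - K^-1) (1 - (1 - e) / K) (expR (- (A * (1 + lam e (K - 1))))).
  have [e1'|] := ltP e 1; last first.
    move=> h1; have {h1}eE : e = 1 by apply/eqP; rewrite eq_le e1.
    have -> : 1 - (1 - e) / K = 1 by rewrite eE subrr mul0r subr0.
    apply: tail_top => //; rewrite lamE /a eE.
    have : ln (1 - K^-1) <= - K^-1 by have := @le_ln1Dx R (- K^-1) ltac:(lra).
    move=> /(ler_wpM2l (ltW C0)); rewrite mulrN => hl.
    have : c%:R * 1 ^+ 2 / (2 * (K - 1)) / ((1 - 1 / 3) * (1 + 1 / (3 * (K - 1)))) <= c%:R * K^-1; last by lra.
    rewrite (_ : _ / _ / _ = c%:R * (9 / (4 * (3 * K - 2)))); last by field; rewrite !gt_eqF //=; clear -K3; lra.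
    apply: ler_wpM2l; first exact: ltW.
    by rewrite ler_pdivrMr; [rewrite mulrC ler_pdivlMr //; lra|lra].
  have pt1' : 1 - (1 - e) / K < 1 by rewrite gtrBl divr_gt0 // subr_gt0.
  apply: tail_plain => //.
  have h := @kl_lower K e ltac:(lra) e0 e1'.
  apply: le_trans (ler_wpM2l (ltW C0) h); rewrite lamE le_eqVlt; apply/orP; left; apply/eqP.
  by rewrite /a; field; rewrite !gt_eqF //=; clear -K3 e0 e1'; lra.
have psi0 (x : R) : 0 <= psi x.
  apply: mulr_ge0; first by rewrite /sharp_cst !mulr_ge0 ?expR_ge0 ?sqrtr_ge0 ?invr_ge0.
  by apply: addr_ge0; rewrite mulr_ge0 ?invr_ge0 ?sqrtr_ge0 ?divr_ge0.
have U2 : tail_bound c K^-1 ((1 + e) / K) (expR (- A) * (psi A * expR (xup e (K - 1) A))).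
  have [s sm h] := bin_cube_sharp (a := a) p0 ppt pt1 c0 ltac:(rewrite /a; field; rewrite !gt_eqF //=; clear -K3 e0 e1; lra) (erefl _).
  exists s => //; apply: (le_trans h); apply: ler_wpM2r; first by rewrite exprn_ge0 // subr_ge0 ltW.
  apply: ler_pM; rewrite ?mulr_ge0 ?expR_ge0 ?psi0 // ?ler_expR ?lerN2 //.
  apply: ler_pM; rewrite ?psi0 ?expR_ge0 //; first exact: psi_homo.
  rewrite ler_expR /xup /corr -aE le_eqVlt; apply/orP; left; apply/eqP; congr (_ * _).
  by field; rewrite !gt_eqF //=; clear -K3 e0 e1; lra.
have := regimeP k3 e01 hAK; rewrite -/K; case.
- move=> h; exists (expR (- A)), (expR (- (A * (1 + lam e (K - 1))))).
  rewrite !expR_ge0; split=> //; rewrite lE.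
  by have := fin _ h; rewrite mulrDr mulr1.
- move=> h; exists (expR (- A) * (psi A * expR (xup e (K - 1) A))), (expR (- (A * (1 + lam e (K - 1))))).
  rewrite ?mulr_ge0 ?expR_ge0 ?psi0 //; split=> //; rewrite lE.
  by have := fin _ h; rewrite mulrDr.
move=> [e25 h].
have e1' : e < 1 by lra.
have pt1' : 1 - (1 - e) / K < 1 by rewrite gtrBl divr_gt0 // subr_gt0.
exists (expR (- A) * (psi A * expR (xup e (K - 1) A))), (expR (- (A * (1 + lam e (K - 1)))) * (psi A * expR (xlow e (K - 1) A))).
rewrite ?mulr_ge0 ?expR_ge0 ?psi0 //; split=> //.
- have [s sm h'] := bin_cube_sharp (a := a) q0 qpt pt1' c0 ltac:(rewrite /a; field; rewrite !gt_eqF //=; clear -K3 e0 e1'; lra) (erefl _).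
  exists s => //; apply: (le_trans h'); apply: ler_wpM2r; first by rewrite exprn_ge0 // subr_ge0 ltW.
  apply: ler_pM; rewrite ?mulr_ge0 ?expR_ge0 ?psi0 // ?ler_expR ?lerN2 //.
    have h2 := @kl_lower K e ltac:(lra) e0 e1'.
    apply: le_trans (ler_wpM2l (ltW C0) h2); rewrite lamE le_eqVlt; apply/orP; left; apply/eqP.
    by rewrite /a; field; rewrite !gt_eqF //=; clear -K3 e0 e1'; lra.
  apply: ler_pM; rewrite ?psi0 ?expR_ge0 //; first exact: psi_homo.
  rewrite ler_expR /xlow /corr -aE le_eqVlt; apply/orP; left; apply/eqP; congr (_ * _).
  by field; rewrite !gt_eqF //=; clear -K3 e0 e1'; lra.
apply: le_trans (fin _ h); rewrite lE expRD le_eqVlt; apply/orP; left; apply/eqP; ring.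
Qed.

(** For p = 1/2 the two tails are mirror images, and each of them is at most
    (delta / 2)^2. *)
Lemma two_tails2 c e (delta : R) : (0 < c)%N -> 0 < e <= 1 -> 0 < delta < 1 ->
  (2 + 2 * e / 3) * 2%:R * (ln (2%:R / delta) / e ^+ 2) <= c%:R ->
  exists U L, [/\ 0 <= U, 0 <= L, tail_bound c 2%:R^-1 ((1 + e) / 2%:R) U,
    tail_bound c (1 - 2%:R^-1) (1 - (1 - e) / 2%:R) L & 2%:R * (U + L) <= delta].
Proof.
move=> c0 /andP[e0 e1] /andP[d0 d1] hc.
have C0 : 0 < c%:R :> R by rewrite ltr0n.
set D := ln (2%:R / delta) in hc.
have dD : expR (- D) = delta / 2.
  by rewrite expRN lnK ?posrE ?divr_gt0 // invf_div.
have D0 : 0 < D by apply: ln_gt0; rewrite ltr_pdivlMr // mul1r; lra.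
have hcD : 2 * (2 * D) <= c%:R * e ^+ 2.
  have e20 : 0 < e ^+ 2 by rewrite exprn_gt0.
  have := ler_wpM2r (ltW e20) hc; apply: le_trans.
  rewrite (_ : _ * _ * _ * _ = (2 + 2 * e / 3) * 2%:R * D); last by field; rewrite gt_eqF.
  by apply: (@le_trans _ _ (2 * 2%:R * D)); [lra|rewrite !ler_wpM2r // ?ltW //; lra].
have T : tail_bound c 2%:R^-1 ((1 + e) / 2%:R) (expR (- (2 * D))).
  have [e1'|] := ltP e 1; last first.
    move=> h1; have {h1}eE : e = 1 by apply/eqP; rewrite eq_le e1.
    rewrite eE (_ : (1 + 1) / 2%:R = 1) ?divff // ?pnatr_eq0 //.
    apply: tail_top => //; rewrite lnV ?posrE // mulrN opprK.
    rewrite eE expr1n mulr1 in hcD; have := @ln2_ge R.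
    by move=> /(ler_wpM2l (ltW C0)); clear -C0 hcD; lra.
  apply: tail_plain => //.
  - by rewrite -[ltLHS]mul1r ltr_pM2r //; lra.
  - by rewrite ltr_pdivrMr //; lra.
  have h := @kl_ge R 2%:R^-1 ((1 + e) / 2%:R) ltac:(lra) ltac:(lra).
  apply: le_trans (ler_wpM2l (ltW C0) h).
  have -> : c%:R * (((1 + e) / 2 - 2^-1) ^+ 2 / (2 * (2^-1 + ((1 + e) / 2 - 2^-1) / 3) * (1 - 2^-1 - ((1 + e) / 2 - 2^-1) / 3))) =
     c%:R * e ^+ 2 / (2 * (1 - e ^+ 2 / 9)).
    by field; rewrite !gt_eqF //=; nra.
  have q0 : 0 < 2 * (1 - e ^+ 2 / 9) by nra.
  rewrite ler_pdivlMr //; apply: le_trans hcD.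
  by rewrite mulrC ler_wpM2r ?mulr_ge0 ?ltW //; nra.
have t12 : 1 - 2%:R^-1 = 2%:R^-1 :> R by lra.
have t34 : 1 - (1 - e) / 2%:R = (1 + e) / 2%:R by lra.
exists (expR (- (2 * D))), (expR (- (2 * D))); rewrite !expR_ge0 t12 t34; split => //.
have -> : - (2 * D) = 2 * - D by ring.
rewrite expRM_natl dD expr2; nra.
Qed.

Lemma two_tails c k e (delta : R) : (2 <= k)%N -> (0 < c)%N -> 0 < e <= 1 -> 0 < delta < 1 ->
  (2 + 2 * e / 3) * k%:R * (ln (k%:R / delta) / e ^+ 2) <= c%:R ->
  exists U L, [/\ 0 <= U, 0 <= L, tail_bound c k%:R^-1 ((1 + e) / k%:R) U,
    tail_bound c (1 - k%:R^-1) (1 - (1 - e) / k%:R) L & k%:R * (U + L) <= delta].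
Proof.
by case: k => [//|[//|[_|k _]]]; [exact: two_tails2|exact: two_tails_ge3].
Qed.

End Tails.

(** * Spectral norms through a thin singular value decomposition *)

Section Norms.
Variable R : realType.

Definition normsq n (x : 'cV[R]_n) : R := \sum_i x i 0 ^+ 2.

Lemma normsq_ge0 n (x : 'cV[R]_n) : 0 <= normsq x.
Proof. by apply: sumr_ge0 => i _; rewrite sqr_ge0. Qed.

Lemma normsqE n (x : 'cV[R]_n) : normsq x = (x^T *m x) 0 0.
Proof. by rewrite mxE; apply: eq_bigr => i _; rewrite [x^T _ _]mxE expr2. Qed.

Lemma norm2_le_normsq m n (x : 'cV[R]_m) (y : 'cV[R]_n) b : 0 <= b ->
  normsq x <= b ^+ 2 * normsq y -> norm2 x <= b * norm2 y.
Proof.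
move=> b0 h; rewrite /norm2 -/(normsq x) -/(normsq y) -[b]ger0_norm // -sqrtr_sqr.
by rewrite -sqrtrM ?sqr_ge0 // ler_wsqrtr.
Qed.

Lemma normsq_isometry m n (U : 'M[R]_(m, n)) x : U^T *m U = 1%:M -> normsq (U *m x) = normsq x.
Proof. by move=> U1; rewrite !normsqE trmx_mul mulmxA -[x^T *m _ *m U]mulmxA U1 mulmx1. Qed.

Lemma normsq_contraction m n (U : 'M[R]_(m, n)) x : U^T *m U = 1%:M -> normsq (U^T *m x) <= normsq x.
Proof.
move=> U1; have := normsq_ge0 (x - U *m (U^T *m x)); rewrite normsqE [(_ - _)^T]linearB mulmxBl !mulmxBr.
have -> : (U *m (U^T *m x))^T *m x = (U^T *m x)^T *m (U^T *m x).
  by rewrite [(U *m _)^T]trmx_mul mulmxA.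
have -> : x^T *m (U *m (U^T *m x)) = (U^T *m x)^T *m (U^T *m x).
  by rewrite [(U^T *m x)^T]trmx_mul trmxK mulmxA.
have -> : (U *m (U^T *m x))^T *m (U *m (U^T *m x)) = (U^T *m x)^T *m (U^T *m x).
  by rewrite [(U *m _)^T]trmx_mul mulmxA -[(_)^T *m U^T *m U]mulmxA U1 mulmx1.
rewrite subrr subr0 => h.
have entry (B D : 'M[R]_1) : (B - D) 0 0 = B 0 0 - D 0 0 by rewrite !mxE.
by rewrite -subr_ge0 !normsqE -entry.
Qed.

Lemma normsq_diag n (d : 'rV[R]_n) s x : (forall i, d 0 i ^+ 2 <= s ^+ 2) ->
  normsq (diag_mx d *m x) <= s ^+ 2 * normsq x.
Proof.
move=> h; rewrite /normsq mulr_sumr; apply: ler_sum => i _.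
by rewrite mul_diag_mx mxE exprMn ler_wpM2r ?sqr_ge0.
Qed.

Lemma normsq_eigenbasis n (W Q : 'M[R]_n) d s x : eigenbasis W Q d ->
  (forall i, d 0 i ^+ 2 <= s ^+ 2) -> normsq (W *m x) <= s ^+ 2 * normsq x.
Proof.
move=> [Q1 ->] h; have Q2 : Q^T *m Q = 1%:M by apply: mulmx1C.
rewrite -!mulmxA normsq_isometry ?trmxK // -(normsq_isometry x Q2); exact: normsq_diag.
Qed.

Lemma spectral_norm_le m n (M : 'M[R]_(m, n)) b : 0 <= b ->
  (forall x, normsq (M *m x) <= b ^+ 2 * normsq x) -> spectral_norm M <= b.
Proof.
move=> b0 h; apply: ge_sup.
  exists (norm2 (M *m 0)); exists 0 => //=.
  by rewrite /norm2 big1 ?sqrtr0 // => i _; rewrite mxE expr0n.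
move=> _ [x /= x1 <-]; apply: le_trans (norm2_le_normsq b0 (h x)) _.
by rewrite -[leRHS]mulr1 ler_wpM2l.
Qed.

Lemma spectral_norm_ge m n (M : 'M[R]_(m, n)) b x : 0 <= b ->
  (forall x, normsq (M *m x) <= b ^+ 2 * normsq x) -> norm2 x <= 1 -> norm2 (M *m x) <= spectral_norm M.
Proof.
move=> b0 h x1; apply: ub_le_sup; last by exists x.
exists b => _ [y /= y1 <-]; apply: le_trans (norm2_le_normsq b0 (h y)) _.
by rewrite -[leRHS]mulr1 ler_wpM2l.
Qed.

Section ThinSVD.
Variables (m n k : nat) (A : 'M[R]_(m, n)) (U : 'M[R]_(m, k)) (Sigma : 'M[R]_k) (V : 'M[R]_(n, k)).
Hypotheses (hA : A != 0) (hsvd : thin_svd A U Sigma V).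

Lemma rank_gt0 : (0 < k)%N.
Proof. by case: hsvd => kE *; move: hA; rewrite -mxrank_eq0 -kE lt0n. Qed.

(** The common factor U Sigma costs the square of the largest singular value s,
    which is also attained by A A^T at the corresponding column of U. *)
Lemma gram_perturbation (G : 'M[R]_n) e : 0 <= e ->
  (forall x, normsq ((V^T *m G *m V - 1%:M) *m x) <= e ^+ 2 * normsq x) ->
  spectral_norm (A *m G *m A^T - A *m A^T) / spectral_norm (A *m A^T) <= e.
Proof.
move=> e0 hY; have k0 := rank_gt0; have [_ U1 V1 [Sd Sp] AE] := hsvd.
pose d : 'rV[R]_k := \row_i Sigma i i.
have SE : Sigma = diag_mx d.
  apply/matrixP => i j; rewrite !mxE; have [->|ij] := eqVneq i j; first by rewrite mulr1n.
  by rewrite mulr0n; move/is_diag_mxP: Sd; apply.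
have [i0 hi0] : exists i0, forall i, d 0 i <= d 0 i0.
  pose i1 : 'I_k := Ordinal k0.
  by case: (@arg_maxP _ _ _ i1 xpredT (fun i => d 0 i) isT) => i _ h; exists i => j; apply: h.
set s := d 0 i0; have s0 : 0 < s by rewrite /s mxE.
have ds i : d 0 i ^+ 2 <= s ^+ 2.
  by rewrite lerXn2r ?nnegrE ?(ltW s0) // mxE ltW.
have St : Sigma^T = Sigma by rewrite SE tr_diag_mx.
have At : A^T = V *m (Sigma *m U^T) by rewrite AE !trmx_mul trmxK St.
have bound (Y : 'M[R]_k) b x : (forall x, normsq (Y *m x) <= b ^+ 2 * normsq x) ->
    normsq ((U *m Sigma *m Y *m Sigma *m U^T) *m x) <= (b * s ^+ 2) ^+ 2 * normsq x.
  move=> h; rewrite -!mulmxA normsq_isometry // SE.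
  apply: le_trans (normsq_diag _ ds) _.
  have s2 : 0 <= s ^+ 2 by apply: sqr_ge0.
  apply: le_trans (ler_wpM2l s2 (h _)) _.
  apply: le_trans (ler_wpM2l s2 (ler_wpM2l (sqr_ge0 b) (normsq_diag _ ds))) _.
  have := ler_wpM2l s2 (ler_wpM2l (sqr_ge0 b) (ler_wpM2l s2 (normsq_contraction x U1))).
  move=> /le_trans; apply; rewrite le_eqVlt; apply/orP; left; apply/eqP; ring.
have AAE : A *m A^T = U *m Sigma *m 1%:M *m Sigma *m U^T.
  by rewrite At AE !mulmxA -[_ *m V^T *m V]mulmxA V1.
have AGE : A *m G *m A^T - A *m A^T = U *m Sigma *m (V^T *m G *m V - 1%:M) *m Sigma *m U^T.
  rewrite AAE mulmxBr !mulmxBl; congr (_ - _).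
  by rewrite At AE !mulmxA.
have up : spectral_norm (A *m G *m A^T - A *m A^T) <= e * s ^+ 2.
  apply: spectral_norm_le => [|x]; first by rewrite mulr_ge0 ?sqr_ge0.
  by rewrite AGE; apply: bound.
have lo : s ^+ 2 <= spectral_norm (A *m A^T).
  pose x := U *m (delta_mx i0 0 : 'cV[R]_k).
  have x1 : normsq x = 1.
    rewrite /x normsq_isometry // /normsq (bigD1 i0) //= big1 ?addr0 => [|i ii0].
      by rewrite mxE !eqxx expr1n.
    by rewrite mxE (negPf ii0) expr0n.
  have nx : norm2 x = 1 by rewrite /norm2 -/(normsq x) x1 sqrtr1.
  have AAx : A *m A^T *m x = s ^+ 2 *: x.
    rewrite AAE mulmx1 /x -!mulmxA [U^T *m _]mulmxA U1 mul1mx.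
    have Se : Sigma *m (delta_mx i0 0 : 'cV[R]_k) = s *: (delta_mx i0 0 : 'cV[R]_k).
      rewrite SE mul_diag_mx; apply/matrixP => i j; rewrite !mxE.
      by have [->|_] := eqVneq i i0; [rewrite /s mxE|rewrite !mulr0n !mulr0].
    by rewrite Se -scalemxAr Se scalerA -expr2 -scalemxAr.
  have s20 : 0 <= s ^+ 2 by apply: sqr_ge0.
  have one : forall x : 'cV[R]_k, normsq (1%:M *m x) <= 1 ^+ 2 * normsq x.
    by move=> y; rewrite mul1mx expr1n mul1r.
  have := @spectral_norm_ge _ _ (A *m A^T) (1 * s ^+ 2) x.
  move=> /(_ _ _ _); rewrite mul1r AAx => h.
  have <- : norm2 (s ^+ 2 *: x) = s ^+ 2.
    rewrite /norm2 (_ : \sum_i _ = (s ^+ 2) ^+ 2 * normsq x).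
      by rewrite x1 mulr1 sqrtr_sqr ger0_norm.
    by rewrite /normsq mulr_sumr; apply: eq_bigr => i _; rewrite mxE exprMn.
  apply: h => //; last by rewrite nx.
  by move=> y; have := bound 1%:M 1 y one; rewrite mul1r -AAE.
have sp : 0 < spectral_norm (A *m A^T) by apply: lt_le_trans lo; rewrite exprn_gt0.
rewrite ler_pdivrMr //; apply: (le_trans up); exact: ler_wpM2l.
Qed.

End ThinSVD.
End Norms.

(** * Markov bounds for the extreme eigenvalues of the sample sum *)

Section SampleEigen.
Variable R : realType.

Lemma row_orthonormal n (Q : 'M[R]_n) i : Q *m Q^T = 1%:M -> row i Q *m (row i Q)^T = 1%:M.
Proof.
move=> Q1; apply/matrixP => a b; rewrite !ord1.
transitivity ((Q *m Q^T) i i); last by rewrite Q1 !mxE !eqxx.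
by rewrite !mxE; apply: eq_bigr => j _; rewrite !mxE.
Qed.

Lemma eigenval_quad n (W : 'M[R]_n) i : W^T = W ->
  exists2 q : 'rV[R]_n, q *m q^T = 1%:M & (q *m W *m q^T) 0 0 = eigenval W i.
Proof.
move=> /eigenP; rewrite /eigenval; move: (eigen W) => [Q d] /= [Q1 WE].
have q1 := row_orthonormal i Q1; exists (row i Q) => //.
rewrite -row_mul WE !mulmxA Q1 mul1mx row_mul row_diag_mx -scalemxAl -rowE -scalemxAl q1.
by rewrite !mxE eqxx mulr1.
Qed.

Lemma quad_le n (W : 'M[R]_n) b (q : 'rV[R]_n) : W^T = W -> (forall i, eigenval W i <= b) ->
  q *m q^T = 1%:M -> (q *m W *m q^T) 0 0 <= b.
Proof.
move=> /eigenP; rewrite /eigenval; move: (eigen W) => [Q d] /= [Q1 WE] hb q1.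
pose x := q *m Q^T.
have x1 : x *m x^T = 1%:M.
  have Q2 : Q^T *m Q = 1%:M by apply: mulmx1C.
  by rewrite /x trmx_mul trmxK mulmxA -[q *m _ *m Q]mulmxA Q2 mulmx1.
have -> : q *m W *m q^T = x *m diag_mx d *m x^T.
  by rewrite WE /x trmx_mul trmxK !mulmxA.
have -> : b = \sum_i b * (x 0 i * x 0 i).
  by rewrite -mulr_sumr -mul_tr00 x1 mxE mulr1.
rewrite mul_tr00; apply: ler_sum => i _; rewrite mul_mx_diag mxE.
rewrite mulrAC mulrC; apply: ler_wpM2r => //; rewrite -expr2; exact: sqr_ge0.
Qed.

(** The eigenbases chosen for W and for - W are unrelated; they are compared
    through quadratic forms. *)
Lemma eigenval_opp_ge n (W : 'M[R]_n) b : W^T = W -> (forall i, eigenval (- W) i <= b) ->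
  forall i, - b <= eigenval W i.
Proof.
move=> Ws hb i; have [q q1 <-] := eigenval_quad i Ws.
have Wn : (- W)^T = - W by rewrite linearN /= Ws.
have := quad_le Wn hb q1; rewrite mulmxN mulNmx mxE => h.
by rewrite lerNl.
Qed.

Lemma eigenval_scalar n (a : R) i : eigenval (a%:M : 'M[R]_n) i = a.
Proof.
have [|q q1 <-] := @eigenval_quad n a%:M i; first by rewrite tr_scalar_mx.
by rewrite mul_mx_scalar -scalemxAl q1 !mxE eqxx mulr1.
Qed.

Lemma trcube0 n s : trcube s (0 : 'M[R]_n) = n%:R * pcube (- s).
Proof.
have -> : (0 : 'M[R]_n) = 0%:M by rewrite raddf0.
rewrite /trcube (eq_bigr (fun=> pcube (- s))).
  by rewrite sumr_const card_ord mulr_natl.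
by move=> i _; rewrite eigenval_scalar sub0r.
Qed.

(** One eigenvalue beyond m suffices to make the trace large. *)
Lemma trcube_markov n (W : 'M[R]_n) s m i : s <= m -> m <= eigenval W i ->
  (m - s) ^+ 3 <= trcube s W.
Proof.
move=> sm mW; rewrite /trcube (bigD1 i) //=.
apply: (@le_trans _ _ (pcube (eigenval W i - s))).
  rewrite /pcube max_r ?subr_ge0 ?(le_trans sm) // lerXn2r ?nnegrE ?subr_ge0 ?(le_trans sm) //.
  by rewrite lerD2r.
by rewrite lerDl sumr_ge0 // => j _; apply: pcube_ge0.
Qed.

(** Failures of a Bin(c, q) sample are Bin(c, 1 - q) distributed. *)
Lemma bin_cube_reflect c (q x : R) :
  bin_cube c (1 - q) x = \sum_(N < c.+1) bin_pmf c q N * pcube (c%:R - N%:R - x).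
Proof.
rewrite /bin_cube (reindex_inj rev_ord_inj) /=; apply: eq_bigr => N _.
have Nc : (N <= c)%N by rewrite -ltnS.
rewrite subSS /bin_pmf bin_sub // subKn // subKr natrB //; ring.
Qed.

Section Sampling.
Variables (n k c : nat) (p : 'I_n -> R) (u : 'I_n -> 'rV[R]_k).
Hypotheses (k2 : (2 <= k)%N) (c0 : (0 < c)%N).
Hypotheses (p0 : forall i, 0 <= p i) (p1 : \sum_i p i = 1).
Hypothesis (u1 : forall i, p i = 0 \/ u i *m (u i)^T = 1%:M).
Hypothesis (pu : \sum_i p i *: ((u i)^T *m u i) = (k%:R^-1)%:M).

Definition zsum (f : {ffun 'I_c -> 'I_n}) : 'M[R]_k := \sum_j ((u (f j))^T *m u (f j)).
Definition mass (f : {ffun 'I_c -> 'I_n}) : R := \prod_j p (f j).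

Lemma mass_ge0 f : 0 <= mass f.
Proof. exact: prodr_ge0. Qed.

Let q01 : 0 <= (k%:R^-1 : R) <= 1.
Proof. by rewrite invr_ge0 ler0n invf_le1 ?ltr0n ?ler1n // ltnW. Qed.

Lemma mass_markov (a m s B : R) (bad : pred {ffun 'I_c -> 'I_n}) : s < m ->
  (forall f, bad f -> exists i, m <= eigenval (a *: zsum f) i) ->
  \sum_(N < c.+1) bin_pmf c k%:R^-1 N * trcube (s - a * N%:R) (0 : 'M[R]_k) <= B * (m - s) ^+ 3 ->
  \sum_(f | bad f) mass f <= B.
Proof.
move=> sm hbad hB; have d0 : 0 < (m - s) ^+ 3 by rewrite exprn_gt0 // subr_gt0.
rewrite -(ler_pM2r d0); apply: le_trans hB.
apply: le_trans (sampled_trcube p0 p1 u1 q01 pu c a s).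
rewrite mulr_suml big_mkcond /=; apply: ler_sum => f _.
case: ifP => [/hbad[i hi]|_].
  apply: ler_wpM2l; first exact: mass_ge0.
  exact: trcube_markov (ltW sm) hi.
apply: mulr_ge0; first exact: mass_ge0.
by apply: sumr_ge0 => i _; apply: pcube_ge0.
Qed.

Lemma mass_upper (pt B : R) (bad : pred {ffun 'I_c -> 'I_n}) : tail_bound c k%:R^-1 pt B ->
  (forall f, bad f -> exists i, c%:R * pt <= eigenval (zsum f) i) ->
  \sum_(f | bad f) mass f <= k%:R * B.
Proof.
move=> [s sm h] hbad; apply: (@mass_markov 1 (c%:R * pt) s) => // [f /hbad|].
  by rewrite scale1r.
rewrite -[leRHS]mulrA; apply: le_trans (ler_wpM2l (ler0n _ k) h).
rewrite /bin_cube mulr_sumr; apply: ler_sum => N _.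
by rewrite trcube0 mul1r opprB mulrCA.
Qed.

(** The lower tail of the sum is the upper tail of its opposite, and a = -1
    turns successes into failures. *)
Lemma mass_lower (pt B : R) (bad : pred {ffun 'I_c -> 'I_n}) : tail_bound c (1 - k%:R^-1) (1 - pt) B ->
  (forall f, bad f -> exists i, - (c%:R * pt) <= eigenval (- zsum f) i) ->
  \sum_(f | bad f) mass f <= k%:R * B.
Proof.
move=> [s sm h] hbad; apply: (@mass_markov (-1) (- (c%:R * pt)) (s - c%:R)) => [|f /hbad|].
- by move: sm; lra.
- by rewrite scaleN1r.
have -> : - (c%:R * pt) - (s - c%:R) = c%:R * (1 - pt) - s by ring.
rewrite -[leRHS]mulrA; apply: le_trans (ler_wpM2l (ler0n _ k) h).
rewrite bin_cube_reflect mulr_sumr; apply: ler_sum => N _.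
rewrite trcube0 mulrCA le_eqVlt; apply/orP; left; apply/eqP; congr (_ * (_ * pcube _)); ring.
Qed.

End Sampling.
End SampleEigen.

(** * Leverage-score sampling *)

Section Leverage.
Variable R : realType.
Variables (m n k : nat) (A : 'M[R]_(m, n)) (U : 'M[R]_(m, k)) (Sigma : 'M[R]_k) (V : 'M[R]_(n, k)).
Hypotheses (hA : A != 0) (hsvd : thin_svd A U Sigma V).

Let p := leverage_prob A V.
Let len i : R := (row i V *m (row i V)^T) 0 0.
(** The unit vector along the i-th row of V; it is 0 when the row is, and then
    i has probability 0. *)
Definition dir i : 'rV[R]_k := (Num.sqrt ((row i V *m (row i V)^T) 0 0))^-1 *: row i V.

Let len_ge0 i : 0 <= len i.
Proof. by rewrite /len mul_tr00 sumr_ge0 // => j _; rewrite -expr2 sqr_ge0. Qed.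

Let row_eq0 i : len i = 0 -> row i V = 0.
Proof.
rewrite /len mul_tr00 => /eqP; rewrite psumr_eq0; last by move=> j _; rewrite -expr2 sqr_ge0.
move=> /allP h; apply/rowP => j; have := h j; rewrite mem_index_enum => /(_ isT) /=.
by rewrite -expr2 sqrf_eq0 [X in _ -> _ = X]mxE => /eqP.
Qed.

Lemma leverageE i : p i = len i / k%:R.
Proof.
have [kE _ _ _ _] := hsvd; rewrite /p /leverage_prob -kE; congr (_ / _).
rewrite /norm2 sqr_sqrtr; last by apply: sumr_ge0 => j _; rewrite sqr_ge0.
rewrite /len mul_tr00; apply: eq_bigr => j _.
by rewrite -colE !mxE expr2.
Qed.

Lemma leverage_ge0 i : 0 <= p i.
Proof. by rewrite leverageE divr_ge0. Qed.

(** The probability cancels the squared length of the row, which makes the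
    draws isotropic. *)
Lemma leverage_dir i : p i *: ((dir i)^T *m dir i) = k%:R^-1 *: ((row i V)^T *m row i V).
Proof.
have [l0|ln0] := eqVneq (len i) 0.
  by rewrite /dir (row_eq0 l0) scaler0 mulmx0 !scaler0.
rewrite /dir [(_ *: _)^T]linearZ -scalemxAl -scalemxAr !scalerA -/(len i); congr (_ *: _).
rewrite leverageE -[X in X / _ * _ * _]sqr_sqrtr // expr2.
by field; rewrite sqrtr_eq0 -ltNge lt_def ln0 len_ge0 /= pnatr_eq0 -lt0n (rank_gt0 hA hsvd).
Qed.

Lemma dir_unit i : p i = 0 \/ dir i *m (dir i)^T = 1%:M.
Proof.
have [l0|ln0] := eqVneq (len i) 0; [left; by rewrite leverageE l0 mul0r|right].
rewrite /dir [(_ *: _)^T]linearZ -scalemxAl -scalemxAr scalerA -/(len i).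
apply/matrixP => a b; rewrite !ord1 mxE -/(len i) -[X in _ * X]sqr_sqrtr // expr2.
rewrite mxE eqxx mulrACA mulVf ?mulr1 //.
by rewrite sqrtr_eq0 -ltNge lt_def ln0 len_ge0.
Qed.

Lemma gram_rows : \sum_i (row i V)^T *m row i V = 1%:M.
Proof.
have [_ _ <- _ _] := hsvd; apply/matrixP => a b; rewrite summxE [RHS]mxE.
by apply: eq_bigr => i _; rewrite !mxE big_ord1 !mxE.
Qed.

Lemma average_dir : \sum_i p i *: ((dir i)^T *m dir i) = (k%:R^-1)%:M.
Proof.
under eq_bigr do rewrite leverage_dir.
by rewrite -scaler_sumr gram_rows scalemx1.
Qed.

Lemma sum_leverage : \sum_i p i = 1.
Proof.
under eq_bigr do rewrite leverageE.
rewrite -mulr_suml.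
have -> : \sum_i len i = \tr (1%:M : 'M[R]_k).
  rewrite -gram_rows linear_sum /=; apply: eq_bigr => i _.
  by rewrite mxtrace_mulC /len /mxtrace big_ord1.
by rewrite mxtrace1 divff // pnatr_eq0 -lt0n (rank_gt0 hA hsvd).
Qed.

Lemma sampled_gramE c (t : 'I_c -> 'I_n) :
  sampled_gram A p t = A *m (sampling_mx p t *m (sampling_mx p t)^T) *m A^T.
Proof. by rewrite /sampled_gram trmx_mul !mulmxA. Qed.

(** The rescaling by 1 / (c p_i) is k / c times the normalisation of the row;
    for indices of probability 0 both sides vanish. *)
Lemma sampling_zsum c (f : {ffun 'I_c -> 'I_n}) (t : 'I_c -> 'I_n) : (0 < c)%N -> (forall j, f j = t j) ->
  V^T *m (sampling_mx p t *m (sampling_mx p t)^T) *m V = (k%:R / c%:R) *: zsum dir f.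
Proof.
move=> c0 ft.
have VS : V^T *m sampling_mx p t = \matrix_(l, j) (V (t j) l / Num.sqrt (c%:R * p (t j))).
  apply/matrixP => l j; rewrite [RHS]mxE mxE (bigD1 (t j)) //= big1 ?addr0 => [|i ij].
    by rewrite !mxE !eqxx /= mul1r.
  by rewrite !mxE (negPf ij) /= mul0r mulr0.
have -> : V^T *m (sampling_mx p t *m (sampling_mx p t)^T) *m V = (V^T *m sampling_mx p t) *m (V^T *m sampling_mx p t)^T.
  by rewrite [in RHS]trmx_mul trmxK !mulmxA.
rewrite VS; apply/matrixP => a b; rewrite [LHS]mxE [RHS]mxE /zsum summxE mulr_sumr.
apply: eq_bigr => j _; rewrite ft; set i := t j.
have -> : ((dir i)^T *m dir i) a b = (len i)^-1 * (V i a * V i b).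
  have dE b' : dir i 0 b' = (Num.sqrt (len i))^-1 * V i b'.
    by rewrite /dir [LHS]mxE [row i V 0 b']mxE.
  rewrite mxE big_ord1 [(dir i)^T a 0]mxE !dE -[in RHS](sqr_sqrtr (len_ge0 i)) expr2 invfM.
  ring.
rewrite !mxE -/i mulrACA -invfM -expr2 sqr_sqrtr; last first.
  by rewrite mulr_ge0 ?leverage_ge0.
rewrite leverageE !invfM invrK; ring.
Qed.

(** In the eigenbasis of Z the matrix (k / c) Z - 1 is diagonal with entries of
    modulus at most e. *)
Lemma deviation_small c (f : {ffun 'I_c -> 'I_n}) (t : 'I_c -> 'I_n) e : (0 < c)%N -> (forall j, f j = t j) -> 0 <= e ->
  (forall i, eigenval (zsum dir f) i <= c%:R * ((1 + e) / k%:R)) ->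
  (forall i, eigenval (- zsum dir f) i <= - (c%:R * ((1 - e) / k%:R))) ->
  spectral_norm (sampled_gram A p t - A *m A^T) / spectral_norm (A *m A^T) <= e.
Proof.
move=> c0 ft e0 hup hlow; rewrite sampled_gramE.
apply: (gram_perturbation hA hsvd) => // x; rewrite (sampling_zsum c0 ft).
set Z := zsum dir f in hup hlow *.
have Zs : Z^T = Z.
  by have := sample_sum_sym dir f 1; rewrite scale1r.
have C0 : 0 < c%:R :> R by rewrite ltr0n.
have K0 : 0 < k%:R :> R by rewrite ltr0n (rank_gt0 hA hsvd).
have [Q1 ZE] := eigenP Zs.
pose d : 'rV[R]_k := \row_i (k%:R / c%:R * eigenval Z i - 1).
apply: (@normsq_eigenbasis _ _ _ (eigen Z).1 d) => [|i].
  split => //; have Q2 : (eigen Z).1^T *m (eigen Z).1 = 1%:M by apply: mulmx1C.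
  have -> : diag_mx d = (k%:R / c%:R) *: diag_mx (eigen Z).2 - 1%:M.
    apply/matrixP => a b; rewrite !mxE /eigenval; case: eqP => _; last by rewrite !mulr0n mulr0 subr0.
    by rewrite !mulr1n.
  by rewrite mulmxBr mulmxBl mulmx1 Q2 -scalemxAr -scalemxAl -ZE.
have h1 := hup i; have := eigenval_opp_ge Zs hlow i; rewrite opprK mxE => h2.
have K1 : 0 <= k%:R / c%:R :> R by rewrite divr_ge0.
have := ler_wpM2l K1 h1; have := ler_wpM2l K1 h2.
rewrite (_ : k%:R / c%:R * (c%:R * ((1 - e) / k%:R)) = 1 - e); last by field; rewrite !gt_eqF.
rewrite (_ : k%:R / c%:R * (c%:R * ((1 + e) / k%:R)) = 1 + e); last by field; rewrite !gt_eqF.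
move: (_ * eigenval Z i) => z a b; rewrite -ler_sqrt; last by nra.
by rewrite !sqrtr_sqr (ger0_norm e0) ler_norml; apply/andP; split; lra.
Qed.

(** For k >= 2 a bad sample has an extreme eigenvalue on one side, and the two
    Markov bounds add up to delta. For k = 1 each u_i is a sign, Z = c and no
    sample of positive probability is bad. *)
Lemma bad_mass c delta e (bad : pred {ffun 'I_c -> 'I_n}) : (0 < c)%N -> 0 < e <= 1 -> 0 < delta < 1 ->
  (2 + 2 * e / 3) * k%:R * (ln (k%:R / delta) / e ^+ 2) <= c%:R ->
  (forall f, bad f -> e < spectral_norm (sampled_gram A p f - A *m A^T) / spectral_norm (A *m A^T)) ->
  \sum_(f | bad f) mass p f <= delta.
Proof.
move=> c0 e01 d01 hc hbad; have /andP[/ltW e0 e1] := e01; have /andP[/ltW d0 _] := d01.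
have badE f : bad f -> [exists i, c%:R * ((1 + e) / k%:R) <= eigenval (zsum dir f) i] ||
                       [exists i, - (c%:R * ((1 - e) / k%:R)) <= eigenval (- zsum dir f) i].
  move=> /hbad; apply: contraTT; rewrite negb_or !negb_exists -leNgt => /andP[/forallP h1 /forallP h2].
  by apply: deviation_small => // i; [have := h1 i|have := h2 i]; rewrite -ltNge => /ltW.
have [k2|k1] := leqP 2 k.
  have [B [L [B0 L0 hB hL hd]]] := two_tails k2 c0 e01 d01 hc.
  apply: le_trans hd; rewrite mulrDr.
  apply: (@le_trans _ _ (\sum_(f : {ffun 'I_c -> 'I_n} | [exists i, c%:R * ((1 + e) / k%:R) <= eigenval (zsum dir f) i]) mass p f +
     \sum_(f : {ffun 'I_c -> 'I_n} | [exists i, - (c%:R * ((1 - e) / k%:R)) <= eigenval (- zsum dir f) i]) mass p f)).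
    rewrite (big_mkcond bad) (big_mkcond (fun f => [exists i, _ <= eigenval (zsum dir f) i])).
    rewrite (big_mkcond (fun f => [exists i, _ <= eigenval (- zsum dir f) i])) -big_split /=.
    apply: ler_sum => f _; have := mass_ge0 leverage_ge0 f; case: ifP => [/badE/orP[]->|_] M0.
    - by case: ifP => _; rewrite ?addr0 // lerDl.
    - by case: ifP => _; rewrite ?add0r // lerDr.
    by case: ifP => _; case: ifP => _; rewrite ?addr0 ?add0r // addr_ge0.
  apply: lerD.
    apply: (mass_upper k2 leverage_ge0 sum_leverage dir_unit average_dir hB) => f /existsP[i hi].
    by exists i.
  apply: (mass_lower k2 leverage_ge0 sum_leverage dir_unit average_dir hL) => f /existsP[i hi].
  by exists i.
rewrite big1 // => f bf; apply/eqP; apply: contraTT bf => mf; apply/negP => bf.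
have := hbad f bf; rewrite ltNge; apply/negP; rewrite negbK.
have kE : k = 1%N by apply/eqP; rewrite eqn_leq -ltnS k1 (rank_gt0 hA hsvd).
have ord1k (a b : 'I_k) : a = b.
  have := leq_trans (ltn_ord a) k1; have := leq_trans (ltn_ord b) k1; rewrite !ltnS !leqn0.
  by move=> /eqP b0 /eqP a0; apply: val_inj; rewrite /= a0 b0.
have ZE : zsum dir f = (c%:R : R)%:M.
  rewrite /zsum (eq_bigr (fun=> 1%:M)).
    by rewrite sumr_const card_ord -scaler_nat scalemx1.
  move=> j _; have [p0|] := dir_unit (f j).
    by move: mf; rewrite /mass (bigD1 j) //= p0 mul0r eqxx.
  move: (dir (f j)) => u /matrixP/(_ 0 0).
  rewrite mul_tr00 => uu; apply/matrixP => a b; move: uu.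
  rewrite [RHS]mxE (ord1k a b) eqxx mxE big_ord1 [u^T _ _]mxE.
  rewrite (bigD1 b) //= big1 ?addr0 => [->|i ib]; first by rewrite !mxE !eqxx.
  by rewrite (ord1k i b) eqxx in ib.
have K1 : k%:R = 1 :> R by rewrite kE.
apply: deviation_small => // i; rewrite ZE.
  by rewrite eigenval_scalar K1 divr1 ler_peMr //; lra.
have -> : - (c%:R%:M : 'M[R]_k) = (- c%:R)%:M by rewrite raddfN.
by rewrite eigenval_scalar K1 divr1 lerN2 ler_piMr //; lra.
Qed.

End Leverage.

(** * The probability of a good sample *)

Local Open Scope classical_set_scope.
Local Open Scope ring_scope.

Section IndexLaw.
Context {d : measure_display} {T : measurableType d} {R : realType} (P : probability T R).

Lemma probability_bigsetU (I : choiceType) (s : seq I) (F : I -> set T) : uniq s ->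
  (forall i, measurable (F i)) -> (forall i j w, F i w -> F j w -> i = j) ->
  P (\big[setU/set0]_(i <- s) F i) = (\sum_(i <- s) P (F i))%E.
Proof.
move=> us mF dF; elim: s us => [|i s IH] /=; first by rewrite !big_nil measure0.
move=> /andP[i_s us]; rewrite !big_cons.
have mU : measurable (\big[setU/set0]_(j <- s) F j) by apply: bigsetU_measurable.
have dU : F i `&` \big[setU/set0]_(j <- s) F j = set0.
  apply/seteqP; split => // w [Fi]; rewrite -bigcup_seq => -[j /= js Fj].
  by move: i_s; rewrite (dF _ _ _ Fi Fj) js.
apply: etrans (measureU P (mF i) mU dU) _; congr (_ + _)%E; exact: IH.
Qed.

(** The events that the whole sample equals a given one are disjoint, and
    independence gives their probabilities. *)
Lemma iid_indices_law n c (p : 'I_n -> R) (t : 'I_c -> T -> 'I_n) (B : pred {ffun 'I_c -> 'I_n}) :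
  iid_indices P p t ->
  P [set w | B [ffun j => t j w]] = (\sum_(f | B f) mass p f)%:E.
Proof.
move=> [tm ti tp].
pose F (f : {ffun 'I_c -> 'I_n}) := \bigcap_(j in [set` [set: 'I_c]%SET]) (t j @^-1` [set f j]).
have FE f w : F f w <-> [ffun j => t j w] = f.
  split => [h|<- j _ /=]; last by rewrite ffunE.
  by apply/ffunP => j; rewrite ffunE; apply: h; rewrite /= inE.
have mF f : measurable (F f).
  apply: fin_bigcap_measurable; first exact: finite_finset.
  by move=> j _; apply: tm.
have -> : [set w | B [ffun j => t j w]] = \big[setU/set0]_(f <- enum B) F f.
  rewrite -bigcup_seq; apply/seteqP; split => w /= h.
    by exists [ffun j => t j w]; [rewrite /= mem_enum|apply/FE].
  by case: h => f /=; rewrite mem_enum => Bf /FE ->.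
rewrite probability_bigsetU ?enum_uniq //; last by move=> f g w /FE <- /FE.
rewrite -sumEFin big_enum /=; apply: eq_bigr => f _.
rewrite /F ti /mass -prodEFin; apply: eq_big => j; first by rewrite inE.
by move=> _; exact: tp.
Qed.

End IndexLaw.

Lemma mass_sum (R : realType) n c (p : 'I_n -> R) : \sum_i p i = 1 ->
  \sum_(f : {ffun 'I_c -> 'I_n}) mass p f = 1.
Proof.
move=> p1; rewrite -(bigA_distr_bigA (fun=> p)) big1 //.
Qed.

Theorem theorem5p1 (R : realType) (m n k : nat) (A : 'M[R]_(m, n))
    (U : 'M[R]_(m, k)) (Sigma : 'M[R]_k) (V : 'M[R]_(n, k))
    (hA : A != 0) (hsvd : thin_svd A U Sigma V)
    (c : nat) (hc1 : (1 <= c)%N) (hcn : (c <= n)%N)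
    (d : measure_display) (T : measurableType d) (P : probability T R)
    (t : 'I_c -> T -> 'I_n)
    (ht : iid_indices P (leverage_prob A V) t)
    (delta eps : R) (hdelta : 0 < delta < 1) (heps : 0 < eps <= 1)
    (hc : c0 eps * (\rank A)%:R * (ln ((\rank A)%:R / delta) / eps ^+ 2)
            <= c%:R) :
  ((1 - delta)%:E <=
    P [set w | (spectral_norm
                  (sampled_gram A (leverage_prob A V) (fun j => t j w)
                     - A *m A^T)
                / spectral_norm (A *m A^T) <= eps)%R])%E.
Proof.
have kE : k = \rank A by case: hsvd.
rewrite -kE in hc.
pose good (f : {ffun 'I_c -> 'I_n}) :=
  spectral_norm (sampled_gram A (leverage_prob A V) f - A *m A^T) / spectral_norm (A *m A^T) <= eps.
have -> : [set w | (spectral_norm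
                  (sampled_gram A (leverage_prob A V) (fun j => t j w)
                     - A *m A^T)
                / spectral_norm (A *m A^T) <= eps)%R] = [set w | good [ffun j => t j w]].
  have eqt w : (fun_of_fin [ffun j => t j w] : 'I_c -> 'I_n) = (fun j => t j w).
    by apply/funext => j; rewrite ffunE.
  by apply/funext => w; rewrite /= /good eqt.
rewrite (iid_indices_law _ ht) lee_fin.
have := mass_sum c (sum_leverage hA hsvd); rewrite (bigID good) /= => <-.
rewrite lerBlDr lerD2l; apply: (bad_mass hA hsvd hc1 heps hdelta hc) => f.
by rewrite /good -ltNge.
Qed.
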